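(* Let $\Omega\subset\mathbb{C}^2$ be a bounded pseudoconvex domain with smooth boundary, and let $\Sigma$ denote the set of Levi-flat points in $\partial\Omega$. Assume that $\Sigma$ is a real curve and is transversal to the holomorphic tangent vector field $L$ of $\partial\Omega$. Then the Diederich--Fornæss index of $\Omega$ is $1$.
   Context: Coordinates on $\mathbb{C}^2$ are $(z,w)$. A defining function of a bounded domain $\Omega$ with smooth boundary is a smooth real-valued function $\rho$ on a neighborhood of $\overline\Omega$ with $\Omega=\{\rho<0\}$, $\partial\Omega=\{\rho=0\}$ and $\nabla\rho\ne0$ on $\partial\Omega$. On $\partial\Omega$ the holomorphic tangent vector field is $$L=\frac{1}{\sqrt{|\rho_z|^2+|\rho_w|^2}}\Big(\rho_w\frac{\partial}{\partial z}-\rho_z\frac{\partial}{\partial w}\Big),$$ which on $\partial\Omega$ does not depend on the choice of $\rho$. A point of $\partial\Omega$ is Levi-flat if the Levi form $\mathrm{Hess}_\rho(L,L)=\sum_{j,k}\frac{\partial^2\rho}{\partial z_j\partial\bar z_k}L_j\overline{L_k}$ vanishes there (where $(z_1,z_2)=(z,w)$). A real curve is a simple curve in $\mathbb{C}^2$ (closed or not) that can be parametrized by a smooth map $t\mapsto\gamma(t)\in\mathbb{C}^2$ of a real parameter $t$. It is transversal to $L$ if at every point of the curve the real vectors $\gamma'(t)$, $\mathrm{Re}\,L$ and $\mathrm{Im}\,L$ are linearly independent over $\mathbb{R}$, where $L=\mathrm{Re}\,L+\sqrt{-1}\,\mathrm{Im}\,L$ with $\mathrm{Re}\,L,\mathrm{Im}\,L$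 real tangent vectors. A number $0<\tau<1$ is a Diederich--Fornæss exponent of $\Omega$ if there is a defining function $\rho$ of $\Omega$ such that $-(-\rho)^{\tau}$ is plurisubharmonic on $\Omega$. The Diederich--Fornæss index of $\Omega$ is the supremum of all such $\tau$ over all defining functions of $\Omega$. *)

(* Defs.v *)
From mathcomp Require Import all_boot all_order all_algebra.
From mathcomp Require Export complex.
From mathcomp Require Import all_classical all_reals all_analysis.

Set Implicit Arguments.
Unset Strict Implicit.
Unset Printing Implicit Defensive.

Import Order.TTheory GRing.Theory Num.Theory.
Import numFieldNormedType.Exports.

Local Open Scope classical_set_scope.
Local Open Scope ring_scope.
Local Open Scope complex_scope.

(* The point (z_0, z_1) of C^2, z_j = x_j + i y_j, is the real row vector
   (x_0, x_1, y_0, y_1); the coordinates (z, w) are (z_0, z_1). *)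
Notation C2 R := 'rV[R]_4 (only parsing).

(* indices of x_j and y_j *)
Definition xi (j : 'I_2) : 'I_4 := lshift 2 j.
Definition yi (j : 'I_2) : 'I_4 := rshift 2 j.

Definition e_x (R : realType) (j : 'I_2) : C2 R := delta_mx 0 (xi j).
Definition e_y (R : realType) (j : 'I_2) : C2 R := delta_mx 0 (yi j).

Definition scaleC (R : realType) (c : R[i]) (v : C2 R) : C2 R :=
  \sum_(j < 2) ((complex.Re c * v 0 (xi j) - complex.Im c * v 0 (yi j)) *: e_x R j
              + (complex.Re c * v 0 (yi j) + complex.Im c * v 0 (xi j)) *: e_y R j).

Fixpoint iter_derive (R : realType) (V W : normedModType R)
    (s : seq V) (f : V -> W) : V -> W :=
  if s is v :: s' then fun x => 'D_v (iter_derive s' f) x else f.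

(* C^oo on an open set U: all iterated directional derivatives exist and are
   continuous on U. *)
Definition smooth_on (R : realType) (V W : normedModType R)
    (U : set V) (f : V -> W) : Prop :=
  forall (s : seq V) (x : V), U x ->
    {for x, continuous (iter_derive s f)} /\
    forall v : V, derivable (iter_derive s f) x v.

Section ComplexDerivatives.
Variable R : realType.
Implicit Types (f : C2 R -> R[i]) (p v : C2 R).

(* directional derivative of a complex-valued function, componentwise *)
Definition cderive v f p : R[i] :=
  'D_v (fun q => complex.Re (f q)) p +i* 'D_v (fun q => complex.Im (f q)) p.

(* the Wirtinger operators d/dz_j and d/d\bar z_j *)
Definition dz (j : 'I_2) f p : R[i] :=
  (cderive (e_x R j) f p - 'i * cderive (e_y R j) f p) / 2.
Definition dzbar (j : 'I_2) f p : R[i] :=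
  (cderive (e_x R j) f p + 'i * cderive (e_y R j) f p) / 2.

End ComplexDerivatives.

Section Domains.
Variable R : realType.
Implicit Types (Omega : set (C2 R)) (rho : C2 R -> R) (p : C2 R).

Definition is_domain Omega : Prop :=
  [/\ open Omega, connected Omega & Omega !=set0].

Definition frontier Omega : set (C2 R) := closure Omega `\` interior Omega.

(* rho is a total function, but only its values on the neighborhood U of the
   closure of Omega are relevant. *)
Definition defining_function Omega rho : Prop :=
  exists U : set (C2 R),
    [/\ open U, closure Omega `<=` U, smooth_on U rho,
        Omega = [set p | U p /\ rho p < 0] &
        frontier Omega = [set p | U p /\ rho p = 0] /\
        forall p, frontier Omega p -> exists v : C2 R, 'D_v rho p != 0].

Definition toC rho : C2 R -> R[i] := fun p => (rho p)%:C.

(* coefficients of L in the basis (d/dz, d/dw) *)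
Definition Lcoef rho p (j : 'I_2) : R[i] :=
  (if j == 0 then dz 1 (toC rho) p else - dz 0 (toC rho) p) /
  sqrtC (`|dz 0 (toC rho) p| ^+ 2 + `|dz 1 (toC rho) p| ^+ 2).

Definition levi_form rho p : R[i] :=
  \sum_(j < 2) \sum_(k < 2)
    dz j (dzbar k (toC rho)) p * Lcoef rho p j * (Lcoef rho p k)^*.

(* In the order of R[i], 0 <= c says that c is real and nonnegative. For rho a
   defining function of Omega, neither this condition nor the set of Levi-flat
   points depends on the choice of rho. *)
Definition levi_pseudoconvex Omega rho : Prop :=
  forall p, frontier Omega p -> 0 <= levi_form rho p.

Definition levi_flat_points Omega rho : set (C2 R) :=
  [set p | frontier Omega p /\ levi_form rho p = 0].

(* d/dz_j = (d/dx_j - i d/dy_j) / 2 as a vector of the complexified real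
   tangent space, and L as such a vector *)
Definition dz_vec (j : 'I_2) : 'rV[R[i]]_4 :=
  2^-1 *: (delta_mx 0 (xi j) - 'i *: delta_mx 0 (yi j)).
Definition Lvec rho p : 'rV[R[i]]_4 := \sum_(j < 2) Lcoef rho p j *: dz_vec j.
Definition ReL rho p : C2 R := map_mx (@complex.Re R) (Lvec rho p).
Definition ImL rho p : C2 R := map_mx (@complex.Im R) (Lvec rho p).

End Domains.

Section Curves.
Variable R : realType.
Implicit Types (I : set R) (gamma : R -> C2 R) (S : set (C2 R)).

Definition simple_closed gamma : Prop :=
  exists T : R, [/\ 0 < T, forall t, gamma (t + T) = gamma t &
    forall s t, `|s - t| < T -> gamma s = gamma t -> s = t].

(* A homeomorphism from a nondegenerate interval onto its image. Continuity of
   the inverse excludes an end of the curve coming back to the curve, as in a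
   figure eight, which has injective parametrizations by an open interval. *)
Definition simple_arc I gamma : Prop :=
  [/\ is_interval I, exists a b, [/\ I a, I b & a < b],
      {in I &, injective gamma} &
      forall t, I t -> forall e : R, 0 < e -> exists2 d : R, 0 < d &
        forall s, I s -> `|gamma s - gamma t| < d -> `|s - t| < e].

(* S is the simple curve, closed or not, with smooth parametrization gamma on
   I. If an endpoint belongs to I, smoothness is that of an extension across
   it. *)
Definition real_curve I gamma S : Prop :=
  [/\ exists U : set R, [/\ open U, I `<=` U & smooth_on U gamma],
      (I = setT /\ simple_closed gamma) \/ simple_arc I gamma &
      gamma @` I = S].

Definition transversal_to_L rho I gamma : Prop :=
  forall t, I t ->
    free [:: 'D_1 gamma t; ReL rho (gamma t); ImL rho (gamma t)].

End Curves.

Section Index.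
Variable R : realType.
Implicit Types (Omega : set (C2 R)) (u : C2 R -> \bar R).

(* Upper semicontinuous with values in [-oo, +oo[, and with the sub-mean value
   property on every closed disc {a + c b | |c| <= 1} contained in Omega. *)
Definition psh Omega u : Prop :=
  [/\ forall p, Omega p -> (u p < +oo)%E,
      forall p, Omega p -> forall r : R, (u p < r%:E)%E ->
        \forall q \near p, (u q < r%:E)%E &
      forall a b : C2 R,
        (forall c : R[i], `|c| <= 1 -> Omega (a + scaleC c b)) ->
        ((2 * pi)%:E * u a <=
           \int[lebesgue_measure]_(t in `[0%R, (2 * pi)%R])
              u (a + scaleC (cos t +i* sin t) b)%R)%E].

Definition DF_exponent Omega (tau : R) : Prop :=
  0 < tau < 1 /\
  exists2 rho : C2 R -> R, defining_function Omega rho &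
    psh Omega (fun p => (- ((- rho p) `^ tau))%:E).

Definition DF_index Omega : R := sup [set tau : R | DF_exponent Omega tau].

End Index.

(* Main.v *)
From HB Require Import structures.
Require Import Defs.
From mathcomp Require Import all_boot all_order all_algebra.
From mathcomp Require Import all_classical all_reals all_analysis.
From mathcomp Require Import ring lra.
Import Order.TTheory GRing.Theory Num.Theory.
Import numFieldNormedType.Exports.
Local Open Scope classical_set_scope.
Local Open Scope ring_scope.
Set Implicit Arguments.
Unset Strict Implicit.
Unset Printing Implicit Defensive.

(** Why the index is 1.

Fix 0 < tau < 1.  Near the boundary a good defining function is sought in the
form rho1 = rho * exp (- K * phi).  Up to a positive factor, the Levi form of
- (- rho1) ^ tau is the hermitian form [df_form] ([weighted_form]).  Let T be
the direction of the field L, N the gradient of rho, and lambda the Levi form of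
rho on T.  In the complex frame (T, N) ([df_form_expansion]),
- the T-coefficient is (- rho) * (lambda - rho * k), where
  k = K * levi phi T - tau * K ^ 2 * |d phi (T)| ^ 2 and |d phi (T)| ^ 2 is the
  sum of the squares of the derivatives of phi along T and J T;
- the N-coefficient tends to (1 - tau) * |grad rho| ^ 4, which is positive
  because tau < 1;
- the cross terms are O (- rho).
Moving from an inner point to the boundary, where lambda >= 0 by
pseudoconvexity, gives lambda >= l * (- rho) inside, for some constant l, maybe
negative ([boundary_lower_bound]).  Hence the discriminant condition for the
form to be nonnegative can be divided by rho ^ 2, and becomes a strict
inequality between continuous functions, which has to be checked only on the
boundary ([df_form_near]).  At a strictly pseudoconvex point l can be taken as
large as one likes.  At a Levi-flat point everything depends on k: if the
derivatives of phi in the directions T and J T vanish and levi phi T > 0, then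
k = K * levi phi T, the cross terms do not depend on K, and a large K suffices,
uniformly by compactness ([large_weight]).

Such a phi is where the hypothesis on the Levi-flat set Sigma enters.  Since
Sigma is a smooth curve and T is not tangent to it, Sigma lies near each of its
points in the zero set of a smooth function h with d h (T) <> 0
([vanishing_function]): one coordinate as a function of another, cut off to be
globally smooth.  A finite sum phi of squares of such functions vanishes to
second order on Sigma, while levi phi T is twice the sum of the
|d h (T)| ^ 2 ([flat_weight]).

All this makes - (- rho1) ^ tau plurisubharmonic only where - c < rho1 < 0.
Inside, rho1 is replaced by bump (c + rho1) - bump c with bump x = exp (- 1 / x)
for x > 0 and 0 otherwise.  This is still a defining function, it is constant
where rho1 <= - c, and the replacement preserves positivity of the Levi form
because log (bump c - bump (c - x)) is a concave function of log x
([bump_shell_ineq]).  Finally, a smooth function with nonnegative Levi form has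
the sub-mean value property on discs, since its mean over a circle increases
with the radius ([psh_of_levi]).  So every 0 < tau < 1 is an exponent. *)

(** * Continuous partial derivatives and differentiability *)

Section Calculus.
Variable R : realType.

Lemma is_derive_line {V W : normedModType R} (f : V -> W) (y v : V) (t : R) :
  derivable f (y + t *: v) v ->
  is_derive t (1 : R) (fun s : R => f (y + s *: v)) ('D_v f (y + t *: v)).
Proof.
move=> df.
have E : (fun h : R => h^-1 *: (((fun s : R => f (y + s *: v)) \o shift t) (h *: 1)
                         - f (y + t *: v))) =
  (fun h : R => h^-1 *: ((f \o shift (y + t *: v)) (h *: v) - f (y + t *: v))).
  by apply/funext => h /=; rewrite [h *: 1]mulr1 scalerDl addrCA.
by split; rewrite /derivable /derive E.
Qed.

(** The increment from 0 to h has to be estimated for h of either sign, because it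
will be a coordinate of a vector. *)
Lemma MVT_sym (g dg : R -> R) (h : R) :
  (forall t : R, `|t| <= `|h| -> is_derive t (1 : R) g (dg t)) ->
  exists2 c, `|c| <= `|h| & g h - g 0 = dg c * h.
Proof.
move=> dgP.
have cont t : `|t| <= `|h| -> {for t, continuous g}.
  move=> /dgP dt; apply/differentiable_continuous/derivable1_diffP.
  exact: ex_derive.
have [h0|h0] := leP 0 h.
  have [||c] := @MVT_segment _ g dg 0 h h0.
  - move=> x; rewrite in_itv/= => /andP[x0 xh]; apply: dgP.
    by rewrite !ger0_norm// ltW.
  - apply: continuous_in_subspaceT => x; rewrite inE/= in_itv/= => /andP[x0 xh].
    by apply: cont; rewrite !ger0_norm.
  rewrite in_itv/= => /andP[x0 xh]; rewrite subr0 => ->; exists c => //.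
  by rewrite !ger0_norm.
have [||c] := @MVT_segment _ g dg h 0 (ltW h0).
- move=> x; rewrite in_itv/= => /andP[x0 xh]; apply: dgP.
  by rewrite !ler0_norm ?lerN2// ltW.
- apply: continuous_in_subspaceT => x; rewrite inE/= in_itv/= => /andP[x0 xh].
  by apply: cont; rewrite !ler0_norm ?lerN2// ltW.
rewrite in_itv/= => /andP[x0 xh]; rewrite sub0r => E; exists c.
  by rewrite !ler0_norm ?lerN2// ltW.
by rewrite -opprB E mulrN opprK.
Qed.

Lemma increment_along (V : normedModType R) (f : V -> R) (y v : V) (D e h : R) :
  (forall t : R, `|t| <= `|h| -> derivable f (y + t *: v) v /\
    `|'D_v f (y + t *: v) - D| <= e) ->
  `|f (y + h *: v) - f y - h * D| <= e * `|h|.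
Proof.
move=> H.
have [t /H[dt]|c ch] := @MVT_sym (fun s : R => f (y + s *: v))
   (fun t => 'D_v f (y + t *: v)) h.
  by move=> _; exact: is_derive_line.
rewrite scale0r addr0 => ->; rewrite mulrC -mulrBr normrM mulrC.
by rewrite ler_wpM2r// (H c ch).2.
Qed.

Lemma rV_coord_le n (h : 'rV[R]_n) i : `|h 0 i| <= `|h|.
Proof.
rewrite [leRHS]/Num.Def.normr/= mx_normrE.
exact: (le_bigmax _ (fun i : 'I_1 * 'I_n => `|h i.1 i.2|) (0, i)).
Qed.

Lemma rV_norm_le n (h : 'rV[R]_n) (c : R) :
  0 <= c -> (forall i, `|h 0 i| <= c) -> `|h| <= c.
Proof.
move=> c0 H; rewrite [leLHS]/Num.Def.normr/= mx_normrE; apply: bigmax_le => //.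
by move=> -[i j] _ /=; rewrite ord1.
Qed.

(** The corners of the path from 0 to h that changes one coordinate at a time. *)
Definition trunc n (h : 'rV[R]_n) (k : nat) : 'rV[R]_n :=
  \row_i (if (i < k)%N then h 0 i else 0).

Lemma trunc0 n (h : 'rV[R]_n) : trunc h 0 = 0.
Proof. by apply/rowP => i; rewrite !mxE. Qed.

Lemma trunc_full n (h : 'rV[R]_n) : trunc h n = h.
Proof. by apply/rowP => i; rewrite !mxE ltn_ord. Qed.

Lemma truncS n (h : 'rV[R]_n) (k : 'I_n) :
  trunc h k.+1 = trunc h k + h 0 k *: delta_mx 0 k.
Proof.
apply/rowP => i; rewrite !mxE eqxx/= ltnS leq_eqVlt.
have [/val_inj ->|/eqP ik] := eqVneq (val i) k.
  by rewrite eqxx ltnn/= mulr1 add0r.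
by rewrite (_ : (i == k) = false) ?mulr0 ?addr0//; apply/eqP => ?; apply: ik; congr val.
Qed.

(** The increment from x to x + h is the sum of the increments along the coordinate
path [trunc h]; each of them is governed by one partial derivative, which is
continuous at x. *)
Lemma C1_increment n (f : 'rV[R]_n -> R) (x : 'rV[R]_n) :
  (\forall y \near x, forall i, derivable f y (delta_mx 0 i)) ->
  (forall i, {for x, continuous ('D_(delta_mx 0 i) f)}) ->
  forall e : R, 0 < e -> \forall h \near (0 : 'rV[R]_n),
    `|f (x + h) - f x - \sum_i h 0 i * 'D_(delta_mx 0 i) f x| <= e * `|h|.
Proof.
move=> fd fc e e0; set D := fun i => 'D_(delta_mx 0 i) f x.
have e1 : 0 < e / (n%:R + 1) by rewrite divr_gt0// ltr_wpDl.
have near1 : \forall y \near x, forall i,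
    `|'D_(delta_mx 0 i) f y - D i| <= e / (n%:R + 1).
  have FF : Filter (nbhs x) by exact: nbhs_filter.
  have := @filter_forall _ _ (fun (i : 'I_n) (y : 'rV[R]_n) =>
    `|'D_(delta_mx 0 i) f y - D i| <= e / (n%:R + 1)) (nbhs x) FF.
  apply => i.
  have /cvgrPdist_le/(_ _ e1) := fc i.
  by apply: filterS => y; rewrite distrC.
have : \forall y \near x, forall i, derivable f y (delta_mx 0 i) /\
    `|'D_(delta_mx 0 i) f y - D i| <= e / (n%:R + 1).
  by near=> y => i; split; [exact: (near fd y)|exact: (near near1 y)].
move=> /nbhs_normP[r /= r0 rP].
near=> h.
have hr : `|h| < r.
  near: h; exact: (@nbhs0_lt _ 'rV[R]_n r r0).
suff H k : (k <= n)%N -> `|f (x + trunc h k) - f x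
     - \sum_(i < n | (i < k)%N) h 0 i * D i| <= k%:R * (e / (n%:R + 1) * `|h|).
  have := H n (leqnn n); rewrite trunc_full.
  have -> : \sum_(i < n | (i < n)%N) h 0 i * D i = \sum_i h 0 i * D i.
    by apply: eq_bigl => i; rewrite ltn_ord.
  (* n times e / (n + 1) is at most e. *)
  move=> /le_trans; apply; rewrite mulrA ler_wpM2r// mulrCA.
  apply: ler_piMr; first exact: ltW.
  by rewrite ler_pdivrMr ?mul1r ?lerDl// ltr_wpDl.
elim: k => [_|k IH kn].
  by rewrite trunc0 addr0 subrr big_pred0// subrr normr0 mul0r.
pose k' := Ordinal kn; rewrite (truncS h k') (addrA x) (bigD1 k')//=.
rewrite (eq_bigl (fun i : 'I_n => (i < k)%N)); last first.
  move=> i; rewrite ltnS leq_eqVlt; have [->|ik] := eqVneq i k'.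
    by rewrite /= ltnn andbF.
  have -> : (i == k :> nat) = false by apply/negbTE.
  by rewrite andbT.
have inc : `|f (x + trunc h k + h 0 k' *: delta_mx 0 k') - f (x + trunc h k)
     - h 0 k' * D k'| <= e / (n%:R + 1) * `|h 0 k'|.
  apply: increment_along => t th; apply: rP => /=.
  rewrite -addrA opprD addrA subrr sub0r normrN.
  apply: le_lt_trans hr; apply: rV_norm_le => // i; rewrite !mxE eqxx/=.
  have [->|ik] := eqVneq i k'.
    by rewrite ltnn add0r mulr1 (le_trans th)// rV_coord_le.
  by rewrite mulr0 addr0; case: ifP => _; [exact: rV_coord_le|rewrite normr0].
have := lerD inc (IH (ltnW kn)) => /(le_trans (ler_normD _ _)).
set a := (X in `|X| <= _); set b := (X in _ -> `|X| <= _).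
have -> : a = b by rewrite /a /b; ring.
move=> /le_trans; apply; rewrite -natr1 mulrDl mul1r addrC lerD2l.
by rewrite ler_wpM2l ?rV_coord_le// ltW.
Unshelve. all: by end_near. Qed.

(** Smoothness is defined by iterated directional derivatives.  Linearity of the
derivative in the direction, and the chain rule, come from differentiability,
hence from this classical criterion. *)
Lemma C1_differentiable n (f : 'rV[R]_n -> R) (x : 'rV[R]_n) :
  (\forall y \near x, forall i, derivable f y (delta_mx 0 i)) ->
  (forall i, {for x, continuous ('D_(delta_mx 0 i) f)}) ->
  differentiable f x.
Proof.
move=> fd fc.
pose d (h : 'rV[R]_n) : R := \sum_i h 0 i * 'D_(delta_mx 0 i) f x.
have dlin : linear d.
  move=> a u v; rewrite /d scaler_sumr -big_split/=; apply: eq_bigr => i _.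
  by rewrite !mxE mulrDl -mulrA.
pose dM := GRing.isLinear.Build _ _ _ _ _ dlin.
pose dL : {linear _ -> _} := HB.pack d dM.
have cd : continuous dL.
  move=> h; apply: differentiable_continuous.
  rewrite (_ : GRing.Linear.sort dL = \sum_i ((fun u : 'rV[R]_n => u 0 i : R)
      * cst ('D_(delta_mx 0 i) f x))); last by apply/funext => u; rewrite fct_sumE.
  apply: differentiable_sum => i; apply: differentiableM.
    exact: differentiable_coord.
  exact: differentiable_cst.
have fE : f \o shift x = cst (f x) + dL +o_ (0 : 'rV[R]_n) id.
  apply/eqaddoP => _/posnumP[e].
  have /= inc := C1_increment fd fc [gt0 of e%:num].
  near=> h; rewrite !fctE /= (addrC h x) opprD addrA /d.
  by near: h.
by apply/diff_locallyP; rewrite (diff_unique cd fE); split.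
Unshelve. all: by end_near. Qed.

End Calculus.

(** * Calculus of smooth functions *)

Section Smooth.
Variable R : realType.

Lemma is_derive_lineP {V W : normedModType R} (f : V -> W) (x v : V) (d : W) :
  is_derive x v f d <-> is_derive (0 : R) (1 : R) (fun s : R => f (x + s *: v)) d.
Proof.
have E : (fun h : R => h^-1 *: (((fun s : R => f (x + s *: v)) \o shift 0) (h *: 1)
                         - f (x + 0 *: v))) =
  (fun h : R => h^-1 *: ((f \o shift x) (h *: v) - f x)).
  by apply/funext => h /=; rewrite [h *: 1]mulr1 addr0 scale0r addr0 (addrC x).
by split=> -[]; rewrite /derivable /derive ?E => dx <-; split;
  rewrite /derivable /derive ?E.
Qed.

Section General.
Context {V W : normedModType R}.
Implicit Types (f g : V -> W) (U : set V).

Lemma smooth_continuous U f x : smooth_on U f -> U x -> {for x, continuous f}.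
Proof. by move=> /(_ [::] x) H /H[]. Qed.

Lemma smooth_derivable U f x v : smooth_on U f -> U x -> derivable f x v.
Proof. by move=> /(_ [::] x) H /H[]. Qed.

Lemma smooth_derive U f v : smooth_on U f -> smooth_on U ('D_v f).
Proof.
move=> fU s x Ux.
suff -> : iter_derive s ('D_v f) = iter_derive (rcons s v) f by exact: fU.
by elim: s => //= w s ->.
Qed.

Lemma smooth_subset U U' f : U' `<=` U -> smooth_on U f -> smooth_on U' f.
Proof. by move=> UU fU s x /UU; exact: fU. Qed.

Lemma smooth_setU U U' f :
  smooth_on U f -> smooth_on U' f -> smooth_on (U `|` U') f.
Proof. by move=> fU fU' s x [/fU|/fU']. Qed.

Lemma eq_derive_on U f g v x : open U -> {in U, f =1 g} -> U x ->
  'D_v f x = 'D_v g x.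
Proof.
move=> oU fg Ux; apply: near_eq_derive.
have nU : nbhs x U by exact: open_nbhs_nbhs.
by near=> y; apply: fg; rewrite inE; near: y.
Unshelve. all: by end_near. Qed.

(** Coinduction: all iterated derivatives of a member of C are members of C on U,
so they exist and are continuous.  Every smoothness proof below exhibits a class
of functions closed under derivation. *)
Lemma smooth_coind U (C : (V -> W) -> Prop) : open U ->
  (forall f, C f -> forall x, U x -> {for x, continuous f}) ->
  (forall f v, C f -> exists2 g, C g & forall x, U x -> is_derive x v f (g x)) ->
  forall f, C f -> smooth_on U f.
Proof.
move=> oU Cc Cd f Cf s.
suff [g Cg [fg fgd]] : exists2 g, C g & {in U, iter_derive s f =1 g} /\
    (forall x, U x -> forall v, derivable (iter_derive s f) x v).
  move=> x Ux; split; last exact: fgd.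
  have nU : nbhs x U by exact: open_nbhs_nbhs.
  have gc : {for x, continuous g} by exact: Cc.
  rewrite /prop_for /continuous_at fg ?inE//.
  apply: cvg_trans gc; apply: near_eq_cvg.
  by near=> y; apply/esym/fg; rewrite inE; near: y.
elim: s => [|v s [g Cg [fg fgd]]] /=.
  exists f => //; split=> // x Ux v; have [g _ gd] := Cd f v Cf.
  by have [] := gd x Ux.
have [h Ch gh] := Cd g v Cg.
have E : {in U, 'D_v (iter_derive s f) =1 h}.
  move=> x; rewrite inE => Ux; rewrite (eq_derive_on v oU fg Ux).
  by have [_ ->] := gh x Ux.
exists h => //; split=> // x Ux w.
have nU : nbhs x U by exact: open_nbhs_nbhs.
have [k _ kd] := Cd h w Ch; have [hd _] := kd x Ux.
apply: near_eq_derivable hd; near=> y; apply/esym/E.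
by rewrite inE; near: y.
Unshelve. all: by end_near. Qed.

Lemma eq_smooth U f g : open U -> {in U, f =1 g} -> smooth_on U f -> smooth_on U g.
Proof.
move=> oU fg fU.
apply: (@smooth_coind U (fun h => exists2 h', smooth_on U h' & {in U, h' =1 h})) => //.
- move=> h [h' h'U h'h] x Ux.
  have nU : nbhs x U by exact: open_nbhs_nbhs.
  have gc := smooth_continuous h'U Ux.
  rewrite /prop_for /continuous_at -h'h ?inE//.
  apply: cvg_trans gc; apply: near_eq_cvg.
  by near=> y; apply: h'h; rewrite inE; near: y.
- move=> h v [h' h'U h'h]; exists ('D_v h') => [|x Ux].
    by exists ('D_v h') => //; exact: smooth_derive.
  have nU : nbhs x U by exact: open_nbhs_nbhs.
  apply: (near_eq_is_derive (f := h')).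
    by near=> y; apply: h'h; rewrite inE; near: y.
  by apply: derivableP; exact: smooth_derivable h'U Ux.
- by exists f.
Unshelve. all: by end_near. Qed.

Lemma smooth_cst U (c : W) : open U -> smooth_on U (fun=> c).
Proof.
move=> oU; apply: (@smooth_coind U (fun f => exists c, f = fun=> c)) => //.
- by move=> _ [d ->] x _; exact: cst_continuous.
- move=> _ v [d ->]; exists (fun=> 0); first by exists 0.
  by move=> x _; exact: is_derive_cst.
- by exists c.
Qed.

End General.

Section RealValued.
Context {V : normedModType R}.
Implicit Types (f g : V -> R) (U : set V).

Lemma is_derive_scalar_comp (h : R -> R) f (x v : V) (dh df : R) :
  is_derive (f x) (1 : R) h dh -> is_derive x v f df ->
  is_derive x v (h \o f) (dh * df).
Proof.
move=> hd /is_derive_lineP fd; apply/is_derive_lineP.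
apply: (@is_derive1_comp R h (fun s : R => f (x + s *: v))) => //.
by rewrite scale0r addr0.
Qed.

(** The derivatives of a product or of a composition are sums of products that
involve both the given functions and their derivatives.  Closing smooth functions
under all three operations at once makes the class closed under derivation. *)
Inductive smooth_algebra U : (V -> R) -> Prop :=
| SmoothAtom f : smooth_on U f -> smooth_algebra U f
| SmoothAdd f g : smooth_algebra U f -> smooth_algebra U g ->
    smooth_algebra U (fun x => f x + g x)
| SmoothMul f g : smooth_algebra U f -> smooth_algebra U g ->
    smooth_algebra U (fun x => f x * g x)
| SmoothComp (O : set R) (h : R -> R) f : open O -> smooth_on O h ->
    (forall x, U x -> O (f x)) -> smooth_algebra U f ->
    smooth_algebra U (fun x => h (f x)).

Lemma smooth_algebraP U f : open U -> smooth_algebra U f -> smooth_on U f.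
Proof.
move=> oU; apply: smooth_coind => // {}f.
  elim=> {f} [f fU|f g _ IHf _ IHg|f g _ IHf _ IHg|O h f oO hO fO _ IHf] x Ux.
  - exact: smooth_continuous fU Ux.
  - by apply: cvgD; [exact: IHf|exact: IHg].
  - by apply: cvgM; [exact: IHf|exact: IHg].
  - apply: (@continuous_comp _ _ _ f h); first exact: IHf.
    by apply: smooth_continuous hO _; exact: fO.
move=> v; elim=> {f} [f fU|f g sf [f' sf' fd] sg [g' sg' gd]
    |f g sf [f' sf' fd] sg [g' sg' gd]|O h f oO hO fO sf [f' sf' fd]].
- exists ('D_v f); first exact/SmoothAtom/smooth_derive.
  by move=> x Ux; apply: derivableP; exact: smooth_derivable fU Ux.
- exists (fun x => f' x + g' x); first exact: SmoothAdd.
  by move=> x Ux; apply: is_deriveD; [exact: fd|exact: gd].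
- exists (fun x => f x * g' x + g x * f' x).
    by apply: SmoothAdd; apply: SmoothMul.
  move=> x Ux; have := fd x Ux; have := gd x Ux => gx fx.
  exact: is_deriveM.
- exists (fun x => 'D_1 h (f x) * f' x).
    apply: SmoothMul => //.
    exact: (SmoothComp oO (smooth_derive _ hO) fO sf).
  move=> x Ux; apply: is_derive_scalar_comp; last exact: fd.
  by apply: derivableP; exact: smooth_derivable hO (fO x Ux).
Qed.

Lemma smoothD U f g : open U -> smooth_on U f -> smooth_on U g ->
  smooth_on U (fun x => f x + g x).
Proof.
move=> oU fU gU.
exact: (smooth_algebraP oU (SmoothAdd (SmoothAtom fU) (SmoothAtom gU))).
Qed.

Lemma smoothM U f g : open U -> smooth_on U f -> smooth_on U g ->
  smooth_on U (fun x => f x * g x).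
Proof.
move=> oU fU gU.
exact: (smooth_algebraP oU (SmoothMul (SmoothAtom fU) (SmoothAtom gU))).
Qed.

Lemma smooth_comp U (O : set R) (h : R -> R) f : open U -> open O -> smooth_on O h ->
  (forall x, U x -> O (f x)) -> smooth_on U f -> smooth_on U (fun x => h (f x)).
Proof.
move=> oU oO hO fO fU.
exact: (smooth_algebraP oU (SmoothComp oO hO fO (SmoothAtom fU))).
Qed.

Lemma smoothZ U (c : R) f : open U -> smooth_on U f -> smooth_on U (fun x => c * f x).
Proof. by move=> oU fU; exact: (smoothM oU (smooth_cst c oU) fU). Qed.

Lemma smoothN U f : open U -> smooth_on U f -> smooth_on U (fun x => - f x).
Proof.
move=> oU fU; rewrite (_ : (fun _ => _) = (fun x => -1 * f x)).
  exact: smoothZ.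
by apply/funext => x; rewrite mulN1r.
Qed.

Lemma smoothB U f g : open U -> smooth_on U f -> smooth_on U g ->
  smooth_on U (fun x => f x - g x).
Proof. by move=> oU fU gU; exact: (smoothD oU fU (smoothN oU gU)). Qed.

Lemma smooth_sum U (I : Type) (r : seq I) (F : I -> V -> R) : open U ->
  (forall i, smooth_on U (F i)) -> smooth_on U (fun x => \sum_(i <- r) F i x).
Proof.
move=> oU FU; elim: r => [|i r IH].
  under eq_fun do rewrite big_nil.
  exact: smooth_cst.
under eq_fun do rewrite big_cons.
exact: (smoothD oU (FU i) IH).
Qed.

End RealValued.

Lemma is_derive_coord n (x v : 'rV[R]_n) i :
  is_derive x v (fun z : 'rV[R]_n => z 0 i : R) (v 0 i).
Proof.
apply/is_derive_lineP.
rewrite (_ : (fun _ => _) = (fun s : R => x 0 i + s * v 0 i)); last first.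
  by apply/funext => s; rewrite !mxE.
by apply: is_derive_eq; rewrite /GRing.scale/=; ring.
Qed.

Lemma smooth_coord n (U : set 'rV[R]_n) i : open U ->
  smooth_on U (fun z : 'rV[R]_n => z 0 i : R).
Proof.
move=> oU.
apply: (@smooth_coind 'rV[R]_n R U (fun f => f = (fun z => z 0 i) \/ exists c, f = fun=> c)) => //.
- move=> f [->|[c ->]] x _; last exact: cst_continuous.
  exact/differentiable_continuous/differentiable_coord.
- move=> f v [->|[c ->]]; last first.
    exists (fun=> 0); first by right; exists 0.
    by move=> x _; exact: is_derive_cst.
  exists (fun=> v 0 i); first by right; exists (v 0 i).
  by move=> x _; exact: is_derive_coord.
- by left.
Qed.

(** In one variable the derivative in the direction v is v times the derivative in
the direction 1, so only the latter has to be exhibited. *)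
Lemma smooth_coind1 (U : set R) (C : (R -> R) -> Prop) : open U ->
  (forall (c : R) f, C f -> C (fun x => c * f x)) ->
  (forall f, C f -> exists2 g, C g & forall x, U x -> is_derive x (1 : R) f (g x)) ->
  forall f, C f -> smooth_on U f.
Proof.
move=> oU CZ Cd; apply: smooth_coind => //.
  move=> f /Cd[g _ fg] x /fg[fd _].
  exact/differentiable_continuous/derivable1_diffP.
move=> f v /Cd[g Cg fg]; exists (fun x => v * g x); first exact: CZ.
move=> x /fg[/derivable1_diffP fd] <-; apply: DeriveDef.
  exact: diff_derivable.
by rewrite !deriveE// -[in LHS](mulr1 v) [LHS]linearZ.
Qed.

Lemma smooth_expR (U : set R) : open U -> smooth_on U (@expR R).
Proof.
move=> oU; apply: (@smooth_coind1 U (fun f => exists a : R, f = fun x => a * expR x)) => //.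
- by move=> c _ [a ->]; exists (c * a); apply/funext => x; rewrite mulrA.
- move=> _ [a ->]; exists (fun x => a * expR x); first by exists a.
  by move=> x _; apply: is_derive_eq; rewrite /GRing.scale/=; ring.
- by exists 1; apply/funext => x; rewrite mul1r.
Qed.

End Smooth.

(** * A flat function *)

Section Flat.
Variable R : realType.
Implicit Types (p q : {poly R}).

(** By induction on the degree: y is at most a multiple of exp (e y / 2), and
half of the exponent is left for the polynomial of lower degree. *)
Lemma poly_le_expR q : forall e : R, 0 < e ->
  exists C : R, forall y, 0 <= y -> `|q.[y]| <= C * expR (e * y).
Proof.
elim/poly_ind: q => [|q c IH] e e0.
  by exists 0 => y _; rewrite horner0 normr0 mul0r.
have e2 : 0 < e / 2 by rewrite divr_gt0.
have [C CP] := IH _ e2; exists (`|C| * (e / 2)^-1 + `|c|) => y y0.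
rewrite hornerMXaddC (le_trans (ler_normD _ _))// mulrDl lerD//; last first.
  by rewrite ler_peMr// -expR0 ler_expR mulr_ge0// ltW.
have yle : y <= (e / 2)^-1 * expR (e / 2 * y).
  rewrite ler_pdivlMl//; apply: le_trans (expR_ge1Dx _).
  by rewrite lerDr.
have -> : e * y = e / 2 * y + e / 2 * y by field.
rewrite expRD normrM (ger0_norm y0).
apply: le_trans (_ : (`|C| * expR (e / 2 * y)) * ((e / 2)^-1 * expR (e / 2 * y)) <= _).
  apply: ler_pM => //; apply: le_trans (CP y y0) _.
  by rewrite ler_wpM2r// ?expR_ge0// ler_norm.
by rewrite le_eqVlt; apply/orP; left; apply/eqP; ring.
Qed.

(** The polynomial factor makes the family of these functions closed under
derivation ([is_derive_flat]); this is why exp (- 1 / x), extended by 0, is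
smooth at 0. *)
Definition flat p (x : R) : R := if 0 < x then p.[x^-1] * expR (- x^-1) else 0.

Lemma flat_le0 p x : x <= 0 -> flat p x = 0.
Proof. by rewrite /flat ltNge => ->. Qed.

Lemma flat_gt0 p x : 0 < x -> flat p x = p.[x^-1] * expR (- x^-1).
Proof. by rewrite /flat => ->. Qed.

(** With y = 1 / x this is the boundedness of y ^ 2 * p(y) * exp (- y); it gives the
derivative 0 at x = 0. *)
Lemma flat_bound p : exists C : R, forall x, `|flat p x| <= C * x ^+ 2.
Proof.
have [C CP] := poly_le_expR ('X^2 * p) ltr01.
have C0 : 0 <= C.
  by have := CP 0 (lexx 0); rewrite mulr0 expR0 mulr1; apply: le_trans.
exists C => x; have [x0|x0] := leP x 0.
  by rewrite flat_le0// normr0 mulr_ge0// sqr_ge0.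
rewrite flat_gt0// normrM (ger0_norm (expR_ge0 _)).
have xi : 0 < x^-1 by rewrite invr_gt0.
have := CP _ (ltW xi); rewrite mul1r hornerM hornerXn normrM normrX.
rewrite (ger0_norm (ltW xi)) expRN => H.
rewrite ler_pdivrMr ?expR_gt0//.
have -> : `|p.[x^-1]| = x ^+ 2 * (x^-1 ^+ 2 * `|p.[x^-1]|).
  by rewrite mulrA -exprMn mulfV ?gt_eqF// expr1n mul1r.
have -> : C * x ^+ 2 * expR x^-1 = x ^+ 2 * (C * expR x^-1) by ring.
by rewrite ler_wpM2l// sqr_ge0.
Qed.

Lemma is_derive0_quadratic (f : R -> R) (C : R) :
  (forall x, `|f x| <= C * x ^+ 2) -> is_derive (0 : R) (1 : R) f 0.
Proof.
move=> fC.
have f0 : f 0 = 0.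
  by apply/eqP; rewrite -normr_le0 (le_trans (fC 0))// expr0n/= mulr0.
suff H : (fun h : R => h^-1 *: ((f \o shift 0) (h *: 1) - f 0)) @ 0^' --> (0 : R).
  split; first by apply/cvg_ex; exists 0.
  exact: cvg_lim H.
have C0 : 0 <= C.
  by have := fC 1; rewrite expr1n mulr1; apply: le_trans.
apply/cvgrPdist_le => e e0.
have C1 : 0 < C + 1 by rewrite ltr_wpDl.
have e1 : 0 < (C + 1)^-1 * e by rewrite mulr_gt0// invr_gt0.
near=> h.
have h0 : h != 0 by near: h; exact: nbhs_dnbhs_neq.
rewrite sub0r normrN /= f0 subr0 addr0 [h *: 1]mulr1 normrM.
rewrite normfV ler_pdivrMl ?normr_gt0// (le_trans (fC h))//.
have -> : C * h ^+ 2 = `|h| * (C * `|h|).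
  by rewrite -real_normK ?num_real//; ring.
rewrite ler_wpM2l//.
apply: (@le_trans _ _ ((C + 1) * `|h|)).
  by rewrite ler_wpM2r// lerDl.
rewrite -ler_pdivlMl//; near: h; exact: (@dnbhs0_le _ R^o _ e1).
Unshelve. all: by end_near. Qed.

Lemma is_derive_flat p (x : R) :
  is_derive x (1 : R) (flat p) (flat ('X^2 * (p - p^`())) x).
Proof.
have [x0|x0|->] := ltgtP x 0.
- rewrite flat_le0 ?ltW//; apply: (near_eq_is_derive (f := fun=> 0)).
  near=> y; rewrite flat_le0// ltW//; near: y.
    exact: lt_nbhsl.
- have dinv : is_derive x (1 : R) (fun y : R => y^-1) (- x ^- 2).
    have := @is_deriveV R id x 1 1 (lt0r_neq0 x0) (is_derive_id _ _).
    by rewrite [_ *: 1]mulr1.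
  have dp : is_derive x (1 : R) (fun y : R => p.[y^-1]) (p^`().[x^-1] * - x ^- 2).
    have dh : is_derive x^-1 (1 : R) (horner p) (p^`().[x^-1]).
      have -> : p^`().[x^-1] = 'D_1 (horner p) x^-1 by rewrite -derive1E -derivE.
      by apply: derivableP; exact: derivable_horner.
    exact: (@is_derive1_comp R (horner p) (fun y => y^-1) x _ _ dh dinv).
  have de : is_derive x (1 : R) (fun y : R => expR (- y^-1))
     (expR (- x^-1) * x ^- 2).
    apply: (@is_derive1_comp R expR (fun y => - y^-1)).
    by apply: is_derive_eq; rewrite opprK.
  have E : \forall y \near x, ((fun y => p.[y^-1]) * (fun y => expR (- y^-1))) y
      = flat p y.
    near=> y; rewrite flat_gt0//; near: y.
    exact: lt_nbhsr.
  have D := near_eq_is_derive E (is_deriveM dp de).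
  apply: (is_derive_eq D); rewrite flat_gt0//.
  rewrite hornerM hornerXn hornerD hornerN /GRing.scale/= exprVn.
  by ring.
- rewrite flat_le0//; have [C CP] := flat_bound p.
  exact: is_derive0_quadratic CP.
Unshelve. all: by end_near. Qed.

Lemma smooth_flat p (U : set R) : open U -> smooth_on U (flat p).
Proof.
move=> oU; apply: (@smooth_coind1 R U (fun f => exists q, f = flat q)) => //.
- move=> c _ [q ->]; exists (c *: q); apply/funext => x; rewrite /flat.
  by case: ifP => _; rewrite ?mulr0// hornerZ mulrA.
- move=> _ [q ->]; exists (flat ('X^2 * (q - q^`()))); first by eexists.
  by move=> x _; exact: is_derive_flat.
- by exists p.
Qed.

Definition bump : R -> R := flat 1.

Lemma bump_le0 x : x <= 0 -> bump x = 0. Proof. exact: flat_le0. Qed.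

Lemma bumpE x : 0 < x -> bump x = expR (- x^-1).
Proof. by move=> x0; rewrite /bump flat_gt0// hornerE mul1r. Qed.

Lemma bump_gt0 x : 0 < x -> 0 < bump x.
Proof. by move=> x0; rewrite bumpE// expR_gt0. Qed.

Lemma bump_ge0 x : 0 <= bump x.
Proof. by have [/bump_le0->//|/bump_gt0/ltW] := leP x 0. Qed.

Lemma smooth_bump (U : set R) : open U -> smooth_on U bump.
Proof. exact: smooth_flat. Qed.

Lemma bump_lt x y : 0 < x -> x < y -> bump x < bump y.
Proof.
move=> x0 xy; have y0 := lt_trans x0 xy.
by rewrite !bumpE// ltr_expR ltrN2 ltf_pV2.
Qed.

Lemma bump_le x y : x <= y -> bump x <= bump y.
Proof.
move=> xy; have [x0|x0] := leP x 0; first by rewrite (bump_le0 x0) bump_ge0.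
by have [->//|xy'] := eqVneq x y; rewrite ltW// bump_lt// lt_neqAle xy' xy.
Qed.

Definition dbump : R -> R := flat 'X^2.
Definition d2bump : R -> R := flat ('X^2 * ('X^2 - 'X *+ 2)).

Lemma is_derive_bump (x : R) : is_derive x (1 : R) bump (dbump x).
Proof.
have := is_derive_flat 1 x; rewrite (_ : 1^`() = 0) ?subr0 ?mulr1//.
by rewrite derivC.
Qed.

Lemma is_derive_dbump (x : R) : is_derive x (1 : R) dbump (d2bump x).
Proof.
by have := is_derive_flat 'X^2 x; rewrite derivXn.
Qed.

Lemma dbumpE (y : R) : 0 < y -> dbump y = bump y / y ^+ 2.
Proof.
by move=> y0; rewrite bumpE// /dbump flat_gt0// hornerXn exprVn mulrC.
Qed.

Lemma d2bumpE (y : R) : 0 < y -> d2bump y = bump y * (1 - 2 * y) / y ^+ 4.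
Proof.
move=> y0; rewrite bumpE// /d2bump flat_gt0//.
rewrite hornerM hornerD hornerN hornerMn hornerXn hornerX.
by field; rewrite gt_eqF.
Qed.

End Flat.

(** * The complex structure and the Levi form *)

Section ComplexStructure.
Variable R : realType.
Local Notation V := 'rV[R]_4.
Implicit Types (v w : V).

Lemma rV4_ext v w : (forall j, v 0 (xi j) = w 0 (xi j)) ->
  (forall j, v 0 (yi j) = w 0 (yi j)) -> v = w.
Proof.
move=> hx hy; apply/rowP => i.
by have [j ->|j ->] := split_ordP (i : 'I_(2 + 2)); [exact: hx|exact: hy].
Qed.

Lemma xi_eq i j : (xi i == xi j) = (i == j). Proof. exact: eq_lshift. Qed.
Lemma yi_eq i j : (yi i == yi j) = (i == j). Proof. exact: (@eq_rshift 2 2). Qed.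
Lemma xi_yi i j : (xi i == yi j) = false. Proof. exact: (@eq_lrshift 2 2). Qed.
Lemma yi_xi i j : (yi i == xi j) = false. Proof. exact: (@eq_rlshift 2 2). Qed.
Definition xy_eq := (xi_eq, yi_eq, xi_yi, yi_xi).

Lemma scaleC_x (c : R[i]) v j : (scaleC c v) 0 (xi j) =
  complex.Re c * v 0 (xi j) - complex.Im c * v 0 (yi j).
Proof.
rewrite /scaleC /e_x /e_y summxE (bigD1 j)//= big1 ?addr0 => [|k kj].
  by rewrite !mxE !eqxx/= xi_yi mulr1 mulr0 addr0.
rewrite !mxE !xy_eq/= eq_sym (negbTE kj).
by rewrite !mulr0 addr0.
Qed.

Lemma scaleC_y (c : R[i]) v j : (scaleC c v) 0 (yi j) =
  complex.Re c * v 0 (yi j) + complex.Im c * v 0 (xi j).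
Proof.
rewrite /scaleC /e_x /e_y summxE (bigD1 j)//= big1 ?addr0 => [|k kj].
  by rewrite !mxE !eqxx/= yi_xi mulr1 mulr0 add0r.
rewrite !mxE !xy_eq/= eq_sym (negbTE kj).
by rewrite !mulr0 addr0.
Qed.

Definition J v : V := scaleC 'i%C v.

Lemma J_x v j : (J v) 0 (xi j) = - v 0 (yi j).
Proof. by rewrite scaleC_x/= mul0r sub0r mul1r. Qed.

Lemma J_y v j : (J v) 0 (yi j) = v 0 (xi j).
Proof. by rewrite scaleC_y/= mul0r add0r mul1r. Qed.

Lemma scaleCE (c : R[i]) v : scaleC c v = complex.Re c *: v + complex.Im c *: J v.
Proof.
apply: rV4_ext => j.
  by rewrite scaleC_x [RHS]mxE !(mxE _ _ _ (xi j)) J_x mulrN.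
by rewrite scaleC_y [RHS]mxE !(mxE _ _ _ (yi j)) J_y.
Qed.

Lemma JJ v : J (J v) = - v.
Proof. by apply: rV4_ext => j; rewrite ?(J_x, J_y) ?mxE ?(J_x, J_y). Qed.

Lemma J_lin (a : R) v w : J (a *: v + w) = a *: J v + J w.
Proof.
apply: rV4_ext => j; rewrite ?(J_x, J_y) [RHS]mxE [X in _ = X + _]mxE ?(J_x, J_y) !mxE//.
by rewrite opprD mulrN.
Qed.

Lemma J_scale (a : R) v : J (a *: v) = a *: J v.
Proof. by apply: rV4_ext => j; rewrite ?(J_x, J_y) !mxE ?(J_x, J_y) ?mulrN. Qed.

Lemma J_lin2 (a c : R) v w : J (a *: v + c *: w) = a *: J v + c *: J w.
Proof. by rewrite J_lin J_scale. Qed.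

End ComplexStructure.

(** Ring identities in which derivatives are indeterminates. *)
Ltac deriv_ring :=
  repeat match goal with
    |- context [@derive ?K ?V ?W ?f ?x ?v] =>
      let t := fresh "t" in set t := (@derive K V W f x v); clearbody t
  end; ring.

Section SecondOrder.
Variable R : realType.
Local Notation V := 'rV[R]_4.
Implicit Types (f g : V -> R) (U : set V) (v w : V).

Lemma smooth_differentiable n (U : set 'rV[R]_n) (f : 'rV[R]_n -> R) x :
  open U -> smooth_on U f -> U x -> differentiable f x.
Proof.
move=> oU fU Ux; apply: C1_differentiable.
  have nU : nbhs x U by exact: open_nbhs_nbhs.
  near=> y => i; apply: (@smooth_derivable _ _ _ U) => //.
  by near: y.
by move=> i; apply: smooth_continuous (smooth_derive _ fU) Ux.
Unshelve. all: by end_near. Qed.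

Lemma derive_lin U f p (a : R) v w : open U -> smooth_on U f -> U p ->
  'D_(a *: v + w) f p = a * 'D_v f p + 'D_w f p.
Proof.
move=> oU fU Up; have df := smooth_differentiable oU fU Up.
by rewrite !deriveE// linearP.
Qed.

Definition hess f p v w : R := 'D_v ('D_w f) p.

(** The derivative in the inner direction is linear at every point of U, not only at
p, so the identity can be differentiated once more. *)
Lemma hess_linr U f p (a : R) v v' w : open U -> smooth_on U f -> U p ->
  hess f p w (a *: v + v') = a * hess f p w v + hess f p w v'.
Proof.
move=> oU fU Up; rewrite /hess.
rewrite (@eq_derive_on _ _ _ U _ (fun q => a * 'D_v f q + 'D_v' f q))//; last first.
  by move=> q; rewrite inE => Uq; exact: derive_lin oU fU Uq.
have d1 := smooth_derivable (v := w) (smooth_derive v fU) Up.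
have d2 := smooth_derivable (v := w) (smooth_derive v' fU) Up.
by have [] := is_deriveD (is_deriveZ a (derivableP d1)) (derivableP d2).
Qed.

Lemma derive_scale U f p (a : R) v : open U -> smooth_on U f -> U p ->
  'D_(a *: v) f p = a * 'D_v f p.
Proof.
move=> oU fU Up; have df := smooth_differentiable oU fU Up.
by rewrite !deriveE// linearZ.
Qed.

Lemma derive_lin2 U f p (a c : R) v w : open U -> smooth_on U f -> U p ->
  'D_(a *: v + c *: w) f p = a * 'D_v f p + c * 'D_w f p.
Proof.
by move=> oU fU Up; rewrite (derive_lin _ _ _ oU fU Up) (derive_scale _ _ oU fU Up).
Qed.

Lemma hess_lin2l U f p (a c : R) v v' w : open U -> smooth_on U f -> U p ->
  hess f p (a *: v + c *: v') w = a * hess f p v w + c * hess f p v' w.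
Proof. by move=> oU fU Up; apply: (derive_lin2 _ _ _ _ oU (smooth_derive _ fU)). Qed.

Lemma hess_lin2r U f p (a c : R) v v' w : open U -> smooth_on U f -> U p ->
  hess f p w (a *: v + c *: v') = a * hess f p w v + c * hess f p w v'.
Proof.
move=> oU fU Up; rewrite (hess_linr _ _ _ _ oU fU Up); congr (_ + _).
rewrite -[c *: v']addr0 (hess_linr _ _ _ _ oU fU Up) /hess.
rewrite (_ : 'D_0 f = fun=> 0) ?derive_cst ?addr0//.
by apply/funext => q; rewrite derive0.
Qed.

(** Four times the complex Hessian of f on the vector v. *)
Definition levi f p v : R := hess f p v v + hess f p (J v) (J v).

(** Four times the squared modulus of the (1,0)-derivative of f along v. *)
Definition sqgrad f p v : R := ('D_v f p) ^+ 2 + ('D_(J v) f p) ^+ 2.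

(** The polarization of [sqgrad]. *)
Definition dotgrad f g p v : R :=
  'D_v f p * 'D_v g p + 'D_(J v) f p * 'D_(J v) g p.

Lemma derive_mul U f g v p : open U -> smooth_on U f -> smooth_on U g -> U p ->
  'D_v (fun x => f x * g x) p = f p * 'D_v g p + g p * 'D_v f p.
Proof.
move=> oU fU gU Up.
have d1 := smooth_derivable (v := v) fU Up; have d2 := smooth_derivable (v := v) gU Up.
by have [_] := is_deriveM (derivableP d1) (derivableP d2).
Qed.

Lemma derive_add U f g v p : open U -> smooth_on U f -> smooth_on U g -> U p ->
  'D_v (fun x => f x + g x) p = 'D_v f p + 'D_v g p.
Proof.
move=> oU fU gU Up.
have d1 := smooth_derivable (v := v) fU Up; have d2 := smooth_derivable (v := v) gU Up.
by have [_] := is_deriveD (derivableP d1) (derivableP d2).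
Qed.

Lemma hess_add U f g v w p : open U -> smooth_on U f -> smooth_on U g -> U p ->
  hess (fun x => f x + g x) p v w = hess f p v w + hess g p v w.
Proof.
move=> oU fU gU Up; rewrite /hess.
rewrite (@eq_derive_on _ _ _ U _ (fun q => 'D_w f q + 'D_w g q))//; last first.
  by move=> q; rewrite inE => Uq; exact: derive_add oU fU gU Uq.
exact: (derive_add _ oU (smooth_derive _ fU) (smooth_derive _ gU)).
Qed.

Lemma hess_mul U f g v p : open U -> smooth_on U f -> smooth_on U g -> U p ->
  hess (fun x => f x * g x) p v v =
  f p * hess g p v v + 2 * ('D_v f p * 'D_v g p) + g p * hess f p v v.
Proof.
move=> oU fU gU Up; rewrite /hess.
rewrite (@eq_derive_on _ _ _ U _ (fun q => f q * 'D_v g q + g q * 'D_v f q))//;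
  last first.
  by move=> q; rewrite inE => Uq; exact: derive_mul oU fU gU Uq.
have sf := smooth_derive v fU; have sg := smooth_derive v gU.
rewrite (derive_add _ oU (smoothM oU fU sg) (smoothM oU gU sf))//.
by rewrite (derive_mul _ oU fU sg Up) (derive_mul _ oU gU sf Up); deriv_ring.
Qed.

Lemma levi_add U f g v p : open U -> smooth_on U f -> smooth_on U g -> U p ->
  levi (fun x => f x + g x) p v = levi f p v + levi g p v.
Proof.
move=> oU fU gU Up; rewrite /levi (hess_add v v oU fU gU Up).
by rewrite (hess_add (J v) (J v) oU fU gU Up) /hess; deriv_ring.
Qed.

Lemma levi_mul U f g v p : open U -> smooth_on U f -> smooth_on U g -> U p ->
  levi (fun x => f x * g x) p v =
  f p * levi g p v + 2 * dotgrad f g p v + g p * levi f p v.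
Proof.
move=> oU fU gU Up; rewrite /levi /dotgrad (hess_mul v oU fU gU Up).
by rewrite (hess_mul (J v) oU fU gU Up) /hess; deriv_ring.
Qed.

Section Composition.
Variables (U : set V) (O : set R) (h dh d2h : R -> R) (f : V -> R) (p : V).
Hypotheses (oU : open U) (fU : smooth_on U f) (fO : forall x, U x -> O (f x))
  (Up : U p).
Hypothesis hd : forall t, O t -> is_derive t (1 : R) h (dh t).
Hypothesis hd2 : forall t, O t -> is_derive t (1 : R) dh (d2h t).

Lemma is_derive_comp v q : U q ->
  is_derive q v (fun x => h (f x)) (dh (f q) * 'D_v f q).
Proof.
move=> Uq; apply: (@is_derive_scalar_comp R V h f); first exact/hd/fO.
exact: derivableP (smooth_derivable fU Uq).
Qed.

Lemma derive_comp v : 'D_v (fun x => h (f x)) p = dh (f p) * 'D_v f p.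
Proof. by have [] := is_derive_comp v Up. Qed.

Lemma hess_comp v : hess (fun x => h (f x)) p v v =
  dh (f p) * hess f p v v + d2h (f p) * ('D_v f p) ^+ 2.
Proof.
rewrite /hess (@eq_derive_on _ _ _ U _ (fun q => dh (f q) * 'D_v f q))//; last first.
  by move=> q; rewrite inE => Uq; have [] := is_derive_comp v Uq.
have d1 : is_derive p v (fun x => dh (f x)) (d2h (f p) * 'D_v f p).
  apply: (@is_derive_scalar_comp R V dh f); first exact/hd2/fO.
  exact: derivableP (smooth_derivable fU Up).
have d2 := derivableP (smooth_derivable (v := v) (smooth_derive v fU) Up).
have [_ ->] := is_deriveM d1 d2.
by rewrite /GRing.scale/=; deriv_ring.
Qed.

Lemma levi_comp v : levi (fun x => h (f x)) p v =
  dh (f p) * levi f p v + d2h (f p) * sqgrad f p v.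
Proof. by rewrite /levi /sqgrad !hess_comp /hess; deriv_ring. Qed.

Lemma sqgrad_comp v : sqgrad (fun x => h (f x)) p v =
  dh (f p) ^+ 2 * sqgrad f p v.
Proof. by rewrite /sqgrad !derive_comp; deriv_ring. Qed.

End Composition.

End SecondOrder.

(** * Circle means and plurisubharmonicity *)

Section UnderIntegral.
Variable R : realType.
Local Notation mu := (@lebesgue_measure R).
Local Notation B := (`[0%R, (2 * pi)%R]%classic : set R).

Lemma measurable_period : measurable B. Proof. exact: measurable_itv. Qed.

Lemma pi2_gt0 : (0 : R) < 2 * pi.
Proof. by rewrite mulr_gt0// pi_gt0. Qed.

Lemma integrable_cont (f : R -> R) : (forall t, B t -> {for t, continuous f}) ->
  mu.-integrable B (EFin \o f).
Proof.
move=> fc; apply: continuous_compact_integrable; first exact: segment_compact.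
by apply: continuous_in_subspaceT => t; rewrite inE => Bt; exact: fc.
Qed.

(** Differentiation under the integral sign over a period, with a constant as the
dominating function. *)
Lemma is_derive_integral (F dF : R -> R -> R) (C : R) :
  (forall r t : R, -1 < r < 1 -> B t -> is_derive r (1 : R) (F ^~ t) (dF r t)) ->
  (forall r t : R, -1 < r < 1 -> B t -> `|dF r t| <= C) ->
  (forall r t : R, -1 < r < 1 -> B t -> {for t, continuous (F r)}) ->
  forall r : R, -1 < r < 1 ->
  is_derive r (1 : R) (fun r => \int[mu]_(t in B) F r t)%R
    (\int[mu]_(t in B) dF r t)%R.
Proof.
move=> Fd dFC Fc r r1.
have Ir : (`]-1, 1[%classic : set R) r by rewrite /= in_itv.
have H1 x : (`]-1, 1[%classic : set R) x -> mu.-integrable B (EFin \o F x).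
  by rewrite /= in_itv/= => x1; apply: integrable_cont => t Bt; exact: Fc.
have H2 x y : (`]-1, 1[%classic : set R) x -> B y -> derivable (F ^~ y) x 1.
  by rewrite /= in_itv/= => x1 By; have [] := Fd x y x1 By.
have H3 : mu.-integrable B (EFin \o (fun=> `|C|)).
  by apply: integrable_cont => t _; exact: cst_continuous.
have H4 x y : (`]-1, 1[%classic : set R) x -> B y -> `|partial1of2 F x y| <= `|C|.
  rewrite /= in_itv/= => x1 By; rewrite partial1of2E.
  by have [_ ->] := Fd x y x1 By; rewrite (le_trans (dFC _ _ x1 By))// ler_norm.
have D := @derivable_under_integral R _ _ mu F B (@measurable_period) r (-1) 1 Ir H1 H2
  (fun=> `|C|) (fun=> normr_ge0 C) H3 H4.
split => //; rewrite -derive1E.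
rewrite (@differentiation_under_integral R _ _ mu F B (@measurable_period) r (-1) 1 Ir H1 H2
  (fun=> `|C|) (fun=> normr_ge0 C) H3 H4).
apply: eq_Rintegral => t; rewrite inE => Bt; rewrite partial1of2E.
by have [_ ->] := Fd r t r1 Bt.
Qed.

Lemma integral_derive_periodic (A dA : R -> R) :
  (forall t, is_derive t (1 : R) A (dA t)) -> continuous dA ->
  A (2 * pi) = A 0 -> (\int[mu]_(t in B) dA t)%R = 0.
Proof.
move=> Ad dAc A0.
have Ac t : {for t, continuous A}.
  by apply/differentiable_continuous/derivable1_diffP; have [] := Ad t.
have E : (\int[mu]_(x in B) (dA x)%:E = (A (2 * pi))%:E - (A 0)%:E)%E.
  apply: continuous_FTC2 => //; first exact: pi2_gt0.
  - exact: continuous_subspaceT.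
  - split; first by move=> x _; have [] := Ad x.
      exact/cvg_at_right_filter/Ac.
    exact/cvg_at_left_filter/Ac.
  - by move=> x _; rewrite derive1E; have [] := Ad x.
by rewrite /Rintegral E A0 subee.
Qed.

End UnderIntegral.

Section SubMean.
Variable R : realType.
Local Notation V := 'rV[R]_4.
Local Notation mu := (@lebesgue_measure R).
Local Notation B := (`[0%R, (2 * pi)%R]%classic : set R).

Lemma is_derive_chain n (w : 'rV[R]_n -> R) (c : R -> 'rV[R]_n) (t : R) dc :
  differentiable w (c t) -> is_derive t (1 : R) c dc ->
  is_derive t (1 : R) (fun s => w (c s)) ('D_dc w (c t)).
Proof.
move=> dw [/derivable1_diffP dct <-].
have dwc : differentiable (w \o c) t by exact: differentiable_comp.
apply: DeriveDef; first exact/derivable1_diffP.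
by rewrite !deriveE// diff_comp.
Qed.

(** The product of exp (i t) and b. *)
Definition cis (b : V) (t : R) : V := cos t *: b + sin t *: J b.

Lemma J_cis b t : J (cis b t) = - sin t *: b + cos t *: J b.
Proof. by rewrite /cis J_lin2 JJ scalerN scaleNr addrC. Qed.

Lemma is_derive_cis b (t : R) : is_derive t (1 : R) (cis b) (J (cis b t)).
Proof.
rewrite J_cis.
have d (f : R -> R) df (v : V) : is_derive t (1 : R) f df ->
    is_derive t (1 : R) (fun s => f s *: v) (df *: v).
  move=> [/derivable1_diffP fd <-].
  have fvd : differentiable (fun s => f s *: v) t by exact: differentiableZl.
  apply: DeriveDef; first exact/derivable1_diffP.
  by rewrite !deriveE// diffZl.
exact: (is_deriveD (d _ _ _ (is_derive_cos t)) (d _ _ _ (is_derive_sin t))).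
Qed.

Lemma derive_ge0_le (f df : R -> R) (r : R) : 0 < r ->
  (forall x, 0 <= x <= r -> is_derive x (1 : R) f (df x)) ->
  (forall x, 0 < x < r -> 0 <= df x) -> f 0 <= f r.
Proof.
move=> r0 fd df0.
have [| |c cr E] := @MVT R f df 0 r r0.
- by move=> x; rewrite in_itv/= => /andP[x0 xr]; apply: fd; rewrite !ltW.
- apply: continuous_in_subspaceT => x; rewrite inE/= in_itv/= => xr.
  by apply/differentiable_continuous/derivable1_diffP; have [] := fd x xr.
rewrite in_itv/= in cr.
by rewrite -subr_ge0 E subr0 mulr_ge0 ?df0// ltW.
Qed.

Section Disc.
Variables (Omega : set V) (u : V -> R) (a b : V).
Hypotheses (oO : open Omega) (uO : smooth_on Omega u).
Hypothesis levi_ge0 : forall p, Omega p -> forall v, 0 <= levi u p v.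
Hypothesis disc : forall r t : R, -1 <= r <= 1 -> Omega (a + r *: cis b t).
Let q (r t : R) := a + r *: cis b t.

Let disc' (r t : R) : -1 < r < 1 -> Omega (q r t).
Proof. by move=> /andP[r1 r2]; apply: disc; rewrite !ltW. Qed.

Let is_derive_t (w : V -> R) (r t : R) : smooth_on Omega w -> -1 < r < 1 ->
  is_derive t (1 : R) (fun s => w (q r s)) (r * 'D_(J (cis b t)) w (q r t)).
Proof.
move=> wO r1; have dw := smooth_differentiable oO wO (disc' t r1).
have -> : r * 'D_(J (cis b t)) w (q r t) = 'D_(r *: J (cis b t)) w (q r t).
  by rewrite !deriveE// linearZ.
apply: (@is_derive_chain 4 w (q r)) => //; rewrite /q.
have := is_deriveD (is_derive_cst a t 1) (is_deriveZ r (is_derive_cis b t)).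
by rewrite add0r.
Qed.

Let is_derive_r (w : V -> R) (r t : R) : smooth_on Omega w -> -1 < r < 1 ->
  is_derive r (1 : R) (fun s => w (q s t)) ('D_(cis b t) w (q r t)).
Proof.
move=> wO r1; apply: (@is_derive_line R V R w a (cis b t) r).
exact: (smooth_derivable wO (disc' t r1)).
Qed.

Let cont_t (w : V -> R) (r t : R) : smooth_on Omega w -> -1 < r < 1 ->
  {for t, continuous (fun s => w (q r s))}.
Proof.
move=> wO r1; apply/differentiable_continuous/derivable1_diffP.
by have [] := is_derive_t t wO r1.
Qed.

Let cont_cos (t : R) : {for t, continuous (@cos R)}.
Proof. exact: continuous_cos. Qed.

Let cont_sin (t : R) : {for t, continuous (@sin R)}.
Proof. exact: continuous_sin. Qed.

Let cont_Nsin (t : R) : {for t, continuous (fun t : R => - sin t)}.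
Proof. by apply: cvgN; exact: cont_sin. Qed.

Let bounded_on_disc (w : V -> R) : smooth_on Omega w ->
  exists C : R, forall r t : R, -1 <= r <= 1 -> B t -> `|w (q r t)| <= C.
Proof.
move=> wO.
pose K := (`[(-1)%R, 1%R]%classic : set R) `*` B.
have cK : compact K by apply: compact_setX; exact: segment_compact.
pose Q (x : R * R) := w (q x.1 x.2).
have Qc : {within K, continuous Q}.
  apply: continuous_in_subspaceT => -[r t]; rewrite inE => -[/= r1 _].
  rewrite in_itv/= in r1.
  apply: (@continuous_comp _ _ _ (fun x : R * R => q x.1 x.2) w); last first.
    exact: (smooth_continuous wO (disc t r1)).
  apply: cvgD; first exact: cvg_cst.
  apply: cvgZ; first exact: cvg_fst.
  apply: cvgD; apply: cvgZ; try exact: cvg_cst.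
    apply: (@continuous_comp _ _ _ (fun x : R * R => x.2) (@cos R)).
      exact: cvg_snd.
    exact: continuous_cos.
  apply: (@continuous_comp _ _ _ (fun x : R * R => x.2) (@sin R)).
    exact: cvg_snd.
  exact: continuous_sin.
have /compact_bounded[M [_ MP]] := continuous_compact Qc cK.
exists (M + 1) => r t r1 Bt; apply: (MP (M + 1)); first by rewrite ltrDl.
by exists (r, t) => //; split => //=; rewrite in_itv.
Qed.

Let Ub := 'D_b u.
Let Uj := 'D_(J b) u.
Let UbO : smooth_on Omega Ub. Proof. exact: smooth_derive. Qed.
Let UjO : smooth_on Omega Uj. Proof. exact: smooth_derive. Qed.

(* G and H are the first two radial derivatives of u, and r * A is the angular one;
   H + K is the Levi form on the radial direction. *)
Let G (r t : R) := cos t * Ub (q r t) + sin t * Uj (q r t).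
Let H (r t : R) := cos t * 'D_(cis b t) Ub (q r t) + sin t * 'D_(cis b t) Uj (q r t).
Let A (r t : R) := - sin t * Ub (q r t) + cos t * Uj (q r t).
Let K (r t : R) := - sin t * 'D_(J (cis b t)) Ub (q r t) +
             cos t * 'D_(J (cis b t)) Uj (q r t).

Let DcisE (w : V -> R) (r t : R) : smooth_on Omega w -> -1 < r < 1 ->
  'D_(cis b t) w (q r t) = cos t * 'D_b w (q r t) + sin t * 'D_(J b) w (q r t).
Proof.
move=> wO r1; have Oq := disc' t r1.
by rewrite /cis (derive_lin2 _ _ _ _ oO wO Oq).
Qed.

Let HK_ge0 (r t : R) : -1 < r < 1 -> 0 <= H r t + K r t.
Proof.
move=> r1; have Oq := disc' t r1.
suff -> : H r t + K r t = levi u (q r t) (cis b t) by exact: levi_ge0.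
rewrite /levi {2}/cis (hess_lin2r _ _ _ _ _ oO uO Oq).
by rewrite {2}J_cis (hess_lin2r _ _ _ _ _ oO uO Oq).
Qed.

Let trig_bound (x y : R) (t C D : R) : `|x| <= C -> `|y| <= D ->
  `|cos t * x + sin t * y| <= C + D.
Proof.
move=> xC yD; rewrite (le_trans (ler_normD _ _))// lerD// normrM.
  apply: le_trans xC; rewrite ler_piMl// ler_norml cos_geN1//.
  exact: cos_le1.
apply: le_trans yD; rewrite ler_piMl// ler_norml sin_geN1//.
exact: sin_le1.
Qed.

Let D_bounded (w : V -> R) : smooth_on Omega w -> exists C : R,
  forall r t : R, -1 < r < 1 -> B t -> `|'D_(cis b t) w (q r t)| <= C.
Proof.
move=> wO.
have [C CP] := bounded_on_disc (smooth_derive b wO).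
have [D DP] := bounded_on_disc (smooth_derive (J b) wO).
exists (C + D) => r t r1 Bt.
have r1' : -1 <= r <= 1 by move: r1 => /andP[r1 r2]; rewrite !ltW.
by rewrite DcisE//; apply: trig_bound; [exact: CP|exact: DP].
Qed.

Let GE (r t : R) : -1 < r < 1 -> 'D_(cis b t) u (q r t) = G r t.
Proof. by move=> r1; rewrite DcisE. Qed.

Let G_bounded : exists C : R,
  forall r t : R, -1 < r < 1 -> B t -> `|G r t| <= C.
Proof.
have [C CP] := D_bounded uO; exists C => r t r1 Bt.
by rewrite -GE//; exact: CP.
Qed.

Let H_bounded : exists C : R,
  forall r t : R, -1 < r < 1 -> B t -> `|H r t| <= C.
Proof.
have [C CP] := D_bounded UbO; have [D DP] := D_bounded UjO.
by exists (C + D) => r t r1 Bt; apply: trig_bound; [exact: CP|exact: DP].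
Qed.

Let cont_D (w : V -> R) (r t : R) : smooth_on Omega w -> -1 < r < 1 ->
  {for t, continuous (fun t => 'D_(cis b t) w (q r t))}.
Proof.
move=> wO r1; rewrite (_ : (fun _ => _) = (fun t => cos t * 'D_b w (q r t)
    + sin t * 'D_(J b) w (q r t))); last by apply/funext => s; exact: DcisE.
apply: cvgD; apply: cvgM; [exact: cont_cos| |exact: cont_sin|].
  exact: (@cont_t ('D_b w) r t (smooth_derive b wO) r1).
exact: (@cont_t ('D_(J b) w) r t (smooth_derive (J b) wO) r1).
Qed.

Let cont_G (r t : R) : -1 < r < 1 -> {for t, continuous (G r)}.
Proof.
move=> r1; apply: cvgD; apply: cvgM; [exact: cont_cos| |exact: cont_sin|].
  exact: (@cont_t Ub r t UbO r1).
exact: (@cont_t Uj r t UjO r1).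
Qed.

Let cont_H (r t : R) : -1 < r < 1 -> {for t, continuous (H r)}.
Proof.
move=> r1; apply: cvgD; apply: cvgM; [exact: cont_cos| |exact: cont_sin|].
  exact: cont_D.
exact: cont_D.
Qed.

Let cont_DJ (w : V -> R) (r t : R) : smooth_on Omega w -> -1 < r < 1 ->
  {for t, continuous (fun t => 'D_(J (cis b t)) w (q r t))}.
Proof.
move=> wO r1; rewrite (_ : (fun _ => _) = (fun t => - sin t * 'D_b w (q r t)
    + cos t * 'D_(J b) w (q r t))); last first.
  apply/funext => s; have Oq := disc' s r1.
  by rewrite J_cis (derive_lin2 _ _ _ _ oO wO Oq).
apply: cvgD; apply: cvgM; [exact: cont_Nsin| |exact: cont_cos|].
  exact: (@cont_t ('D_b w) r t (smooth_derive b wO) r1).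
exact: (@cont_t ('D_(J b) w) r t (smooth_derive (J b) wO) r1).
Qed.

Let cont_K (r t : R) : -1 < r < 1 -> {for t, continuous (K r)}.
Proof.
move=> r1; apply: cvgD; apply: cvgM; [exact: cont_Nsin| |exact: cont_cos|].
  exact: cont_DJ.
exact: cont_DJ.
Qed.

Let is_derive_G (r t : R) : -1 < r < 1 ->
  is_derive r (1 : R) (G ^~ t) (H r t).
Proof.
move=> r1.
have d1 := is_deriveZ (cos t) (is_derive_r t UbO r1).
have d2 := is_deriveZ (sin t) (is_derive_r t UjO r1).
exact: (is_deriveD d1 d2).
Qed.

Let is_derive_A (r t : R) : -1 < r < 1 ->
  is_derive t (1 : R) (A r) (- G r t + r * K r t).
Proof.
move=> r1.
have d1 := is_deriveM (is_deriveN (is_derive_sin t)) (is_derive_t t UbO r1).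
have d2 := is_deriveM (is_derive_cos t) (is_derive_t t UjO r1).
apply: (is_derive_eq (is_deriveD d1 d2)).
rewrite /G /K /GRing.scale/= /Ub /Uj (_ : (- @sin R)%R t = - sin t)//.
by deriv_ring.
Qed.

Let M r := (\int[mu]_(t in B) u (q r t))%R.
Let P r := (\int[mu]_(t in B) G r t)%R.

Let is_derive_M (r : R) : -1 < r < 1 -> is_derive r (1 : R) M (P r).
Proof.
move=> r1; have [C CP] := G_bounded.
apply: (@is_derive_integral R (fun r t => u (q r t)) G C) => //.
- by move=> s t s1 _; rewrite -GE//; exact: is_derive_r.
- by move=> s t s1 _; exact: cont_t.
Qed.

Let is_derive_P (r : R) : -1 < r < 1 ->
  is_derive r (1 : R) P (\int[mu]_(t in B) H r t)%R.
Proof.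
move=> r1; have [C CP] := H_bounded.
apply: (@is_derive_integral R G H C) => //.
  by move=> s t s1 _; exact: is_derive_G.
by move=> s t s1 _; exact: cont_G.
Qed.

Let rP_mono (r : R) : 0 <= r -> r < 1 ->
  0 <= P r + r * (\int[mu]_(t in B) H r t)%R.
Proof.
move=> r0 rl; have r1 : -1 < r < 1 by rewrite rl andbT (lt_le_trans _ r0).
have iG := integrable_cont (fun t _ => @cont_G r t r1).
have iH := integrable_cont (fun t _ => @cont_H r t r1).
rewrite -(@RintegralZl _ _ _ mu B _ r (@measurable_period R) iH).
have crH t : {for t, continuous (fun t => r * H r t)}.
  by apply: cvgM; [exact: cvg_cst|exact: cont_H].
have irH := integrable_cont (fun t _ => crH t).
rewrite -(@RintegralD _ _ _ mu B _ _ (@measurable_period R) iG irH).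
have cdA t : {for t, continuous (fun t => - (- G r t + r * K r t))}.
  apply: cvgN; apply: cvgD; first by apply: cvgN; exact: cont_G.
  by apply: cvgM; [exact: cvg_cst|exact: cont_K].
have idA := integrable_cont (fun t _ => cdA t).
(* The angular part of the Laplacian is the derivative of the periodic
   function - A, so it does not contribute to the integral. *)
have E0 : (\int[mu]_(t in B) (- (- G r t + r * K r t)))%R = 0.
  apply: (@integral_derive_periodic R (fun t => - A r t)).
  - by move=> t; have := is_deriveN (is_derive_A t r1).
  - exact: cdA.
  - rewrite /A /q /cis; have -> : (2 * pi : R) = pi *+ 2 by rewrite mulr_natl.
    by rewrite sin2pi cos2pi sin0 cos0.
have cGH t : {for t, continuous (fun t => G r t + r * H r t)}.
  by apply: cvgD; [exact: cont_G|exact: crH].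
have iGH := integrable_cont (fun t _ => cGH t).
rewrite -[leLHS]E0; apply: (@le_Rintegral _ _ _ mu B _ _ (@measurable_period R) idA iGH).
move=> t _; rewrite opprD opprK lerD2l -subr_ge0 opprK -mulrDr.
by rewrite mulr_ge0// HK_ge0.
Qed.

Let itvP (r x : R) : r < 1 -> 0 <= x <= r -> -1 < x < 1.
Proof.
move=> r1 /andP[x0 xr]; rewrite (lt_le_trans _ x0)//=.
exact: le_lt_trans r1.
Qed.

Let P_ge0 (r : R) : 0 < r -> r < 1 -> 0 <= P r.
Proof.
move=> r0 rl; pose f x := x * P x.
pose df x := P x + x * (\int[mu]_(t in B) H x t)%R.
suff : f 0 <= f r by rewrite /f mul0r pmulr_rge0.
apply: (@derive_ge0_le f df) => // x.
  move=> /(itvP rl) x1; have [Pd P'] := is_derive_P x1.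
  have := is_deriveM (is_derive_id x (1 : R)) (DeriveDef Pd P').
  by rewrite /GRing.scale/= mulr1 addrC.
by move=> /andP[x0 xr]; apply: rP_mono; [exact: ltW|exact: lt_trans rl].
Qed.

(** Let M r be the integral of u over the circle of radius r around a.  Its second
derivative is controlled through (r * M')', which is r times the integral of the
Levi form, because the angular part of the Laplacian is the derivative of a
periodic function.  So r * M' increases from 0, hence M' >= 0, and M increases
from M 0. *)
Lemma circle_mean_ge (s : R) : 0 < s -> s < 1 -> 2 * pi * u a <= M s.
Proof.
move=> s0 s1.
have M0 : M 0 = 2 * pi * u a.
  rewrite /M /q; under eq_Rintegral do rewrite scale0r addr0.
  have -> : (\int[mu]_(t in B) u a)%R = u a * fine (mu B).
    exact: (@Rintegral_cst _ _ _ mu B (@measurable_period R) (u a)).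
  have -> : mu B = (2 * pi)%:E.
    by rewrite lebesgue_measure_itv/= lte_fin; case: ifP; rewrite ?oppr0 ?adde0 ?pi2_gt0.
  by rewrite mulrC.
rewrite -M0; apply: (@derive_ge0_le M P) => // x.
  by move=> /(itvP s1); exact: is_derive_M.
by move=> /andP[x0 xs]; apply: P_ge0 => //; exact: lt_trans s1.
Qed.

Lemma circle_continuous (r t : R) : -1 < r < 1 ->
  {for t, continuous (fun t => u (a + r *: cis b t))}.
Proof. exact: cont_t. Qed.

End Disc.

End SubMean.

Section PshOfLevi.
Variable R : realType.
Local Notation V := 'rV[R]_4.
Local Notation mu := (@lebesgue_measure R).
Local Notation B := (`[0%R, (2 * pi)%R]%classic : set R).

(** The closed disc is compact.  A margin is needed since the derivatives of the
circle mean are taken on an open interval of radii. *)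
Lemma larger_disc (Omega : set V) (a b : V) : open Omega ->
  (forall c : R[i], `|c| <= 1 -> Omega (a + scaleC c b)) ->
  exists2 d : R, 0 < d & forall r t : R, -1 <= r <= 1 ->
    Omega (a + r *: cis ((1 + d) *: b) t).
Proof.
move=> oO discO.
pose D := [set z : R * R | z.1 ^+ 2 + z.2 ^+ 2 <= 1].
pose K := ((`[(-1)%R, 1%R]%classic : set R) `*` (`[(-1)%R, 1%R]%classic : set R)) `&` D.
have cK : compact K.
  apply: compact_closedI; first by apply: compact_setX; exact: segment_compact.
  rewrite (_ : D = (fun z : R * R => z.1 ^+ 2 + z.2 ^+ 2) @^-1` [set x | x <= 1])//.
  apply: closed_comp; last exact: closed_le.
  move=> z _; apply: cvgD; rewrite -/(GRing.exp _ _).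
    by under eq_fun do rewrite expr2; apply: cvgM; exact: cvg_fst.
  by under eq_fun do rewrite expr2; apply: cvgM; exact: cvg_snd.
pose g (x : R * R * R) : V := a + (1 + x.2) *: (x.1.1 *: b + x.1.2 *: J b).
have gc : continuous g.
  move=> x; apply: cvgD; first exact: cvg_cst.
  apply: cvgZ; first by apply: cvgD; [exact: cvg_cst|exact: cvg_snd].
  apply: cvgD; apply: cvgZ; try exact: cvg_cst.
    apply: (@continuous_comp _ _ _ (fun x : R * R * R => x.1) (fun z => z.1)).
      exact: cvg_fst.
    exact: cvg_fst.
  apply: (@continuous_comp _ _ _ (fun x : R * R * R => x.1) (fun z => z.2)).
    exact: cvg_fst.
  exact: cvg_snd.
have : \forall d \near (0 : R), K `<=` [set z | Omega (g (z, d))].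
  apply: ((compact_near_coveringP K).1 cK (R : Type) (nbhs (0 : R))
    (fun d z => Omega (g (z, d)))).
  move=> [x y] [_ Dxy].
  have O0 : Omega (g ((x, y), 0)).
    rewrite /g/= addr0 scale1r.
    have -> : x *: b + y *: J b = scaleC (x +i* y)%C b by rewrite scaleCE.
    apply: discO; rewrite normc_def/= -[1%R in leRHS]/(1%:C%C) lecR.
    by rewrite -sqrtr1 ler_wsqrtr.
  have : nbhs ((x, y), (0 : R)) (g @^-1` Omega).
    by apply: gc; exact: open_nbhs_nbhs.
  by [].
move=> /nbhs_ballP[e /= e0 eP]; exists (e / 2); first by rewrite divr_gt0.
move=> r t r1.
have Kz : K (r * cos t, r * sin t).
  have rn : `|r| <= 1 by rewrite ler_norml.
  split; last first.
    rewrite /D/= !exprMn -mulrDr cos2Dsin2 mulr1 -real_normK ?num_real//.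
    by rewrite expr_le1.
  split; rewrite /= in_itv/= -ler_norml normrM mulr_ile1// ler_norml.
    by rewrite cos_geN1 cos_le1.
  by rewrite sin_geN1 sin_le1.
have Be : ball (0 : R) e (e / 2).
  rewrite /ball/= sub0r normrN ger0_norm ?divr_ge0 ?ltW//.
  by rewrite ltr_pdivrMr// ltr_pMr// ltr1n.
have := eP _ Be _ Kz; rewrite /g/=.
rewrite (_ : r *: cis _ t = (1 + e / 2) *: ((r * cos t) *: b + (r * sin t) *: J b))//.
rewrite /cis J_scale !scalerDr !scalerA; congr (_ *: _ + _ *: _); ring.
Qed.

(** On a slightly larger disc in the same line the unit circle has radius
(1 + d)^-1 < 1, where the mean value inequality is available. *)
Lemma psh_of_levi (Omega : set V) (u : V -> R) : open Omega ->
  smooth_on Omega u ->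
  (forall p, Omega p -> forall v, 0 <= levi u p v) ->
  psh Omega (fun p => (u p)%:E).
Proof.
move=> oO uO lu; split.
- by move=> p _; rewrite ltry.
- move=> p Op r; rewrite lte_fin => upr.
  have uc := smooth_continuous uO Op.
  have /cvgrPdist_lt/(_ (r - u p)) := uc; rewrite subr_gt0 => /(_ upr) H.
  near=> q; rewrite lte_fin.
  have : `|u p - u q| < r - u p by near: q.
  by rewrite distrC => /(le_lt_trans (ler_norm _)); rewrite ltrD2r.
move=> a b discO.
have [d d0 discd] := larger_disc oO discO.
have d1 : 0 < 1 + d by rewrite addr_gt0.
have s0 : 0 < (1 + d)^-1 by rewrite invr_gt0.
have s1 : (1 + d)^-1 < 1 by rewrite invf_lt1// ltrDl.
have := circle_mean_ge oO uO lu discd s0 s1.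
have E t : a + (1 + d)^-1 *: cis ((1 + d) *: b) t = a + scaleC (cos t +i* sin t)%C b.
  rewrite scaleCE /cis/= J_scale scalerDr !scalerA.
  by congr (_ + (_ *: _ + _ *: _)); field; rewrite gt_eqF.
under eq_Rintegral do rewrite E.
have uc t : {for t, continuous (fun t : R => u (a + scaleC (cos t +i* sin t)%C b))}.
  rewrite (_ : (fun _ => _) =
      (fun t => u (a + (1 + d)^-1 *: cis ((1 + d) *: b) t))).
    apply: (circle_continuous oO uO discd).
    by rewrite s1 andbT (lt_trans _ s0).
  by apply/funext => x; rewrite E.
have iu := integrable_cont (fun t _ => uc t).
rewrite /Rintegral => H.
rewrite -EFinM -[leRHS]fineK ?lee_fin//.
exact: (@integrable_fin_num _ _ _ mu B (@measurable_period R) _ iu).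
Unshelve. all: by end_near. Qed.

End PshOfLevi.

(** * Local equations of a smooth curve *)

Section LocalInverse.
Variable R : realType.

Lemma smooth_inv (U : set R) : open U -> (forall x, U x -> x != 0) ->
  smooth_on U (fun x : R => x^-1).
Proof.
move=> oU U0; apply: (@smooth_coind1 R U
  (fun f => exists c n, f = fun x => c * (x^-1) ^+ n)) => //.
- by move=> c _ [d [n ->]]; exists (c * d), n; apply/funext => x; rewrite mulrA.
- move=> _ [c [n ->]]; exists (fun x => (- c * n%:R) * (x^-1) ^+ n.+1).
    by exists (- c * n%:R), n.+1.
  move=> x /U0 x0.
  have dinv : is_derive x (1 : R) (fun y : R => y^-1) (- x ^- 2).
    have := @is_deriveV R id x 1 1 x0 (is_derive_id _ _).
    by rewrite [_ *: 1]mulr1.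
  have d := is_deriveZ c (is_deriveX n dinv).
  rewrite (_ : (fun _ => _) = c \*: ((fun y : R => y^-1) ^+ n)); last first.
    by apply/funext => y; rewrite /= exprfctE.
  apply: (is_derive_eq d); rewrite /GRing.scale/= -exprVn.
  by case: n {d} => [|n]; rewrite ?mul0r ?mulr0 ?mul0r//= !exprS; ring.
- by exists 1, 1%N; apply/funext => x; rewrite mul1r expr1.
Qed.

(** Where the derivative has constant sign the function is strictly monotone, so it
maps a small interval bijectively to an interval. *)
Lemma local_inverse (U : set R) (g : R -> R) (t0 d0 : R) : open U -> smooth_on U g ->
  U t0 -> 'D_1 g t0 != 0 -> 0 < d0 ->
  exists (d : R) (O : set R) (sigma : R -> R), 0 < d <= d0 /\ open O /\
   [/\ (forall t, `|t - t0| < d -> [/\ U t, O (g t), sigma (g t) = t & 'D_1 g t != 0]) &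
    (forall y, O y -> `|sigma y - t0| < d /\
      is_derive y (1 : R) sigma ('D_1 g (sigma y))^-1)].
Proof.
wlog g0 : g / 0 < 'D_1 g t0 => [wl|] oU gU Ut0 gn0 d00.
  have [g0|g0|g0] := ltgtP ('D_1 g t0) 0; [|exact: wl|by rewrite g0 eqxx in gn0].
  have NgU := smoothN oU gU.
  have DN t : U t -> 'D_1 (fun x => - g x) t = - 'D_1 g t.
    by move=> Ut; have [_] := is_deriveN (derivableP (smooth_derivable (v := (1 : R)) gU Ut)).
  have p1 : 0 < 'D_1 (fun x => - g x) t0 by rewrite DN// oppr_gt0.
  have p2 : 'D_1 (fun x => - g x) t0 != 0 by rewrite DN// oppr_eq0.
  have [d [Y [s [dd [oY [H1 H2]]]]]] := wl _ p1 oU NgU Ut0 p2 d00.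
  exists d, [set y | Y (- y)], (fun y => s (- y)); split => //; split.
    by apply: open_comp => // y _; exact: opp_continuous.
  split => [t /H1[Ut Ogt sgt gt0]|y /H2[sy sd]].
    by split => //; rewrite -oppr_eq0 -DN.
  split => //; have [Us _ _ _] := H1 _ sy.
  rewrite DN// in sd.
  have := @is_derive1_comp R s -%R y _ _ sd (is_deriveN (is_derive_id y (1 : R))).
  by rewrite invrN mulrN1 opprK.
have gc := smooth_continuous (smooth_derive (1 : R) gU) Ut0.
have [d /andP[dd d0'] dP] : exists2 d : R, 0 < d <= d0 &
    forall t, `|t - t0| <= d -> U t /\ 0 < 'D_1 g t.
  have : \forall t \near t0, U t /\ 0 < 'D_1 g t.
    have nU : nbhs t0 U by exact: open_nbhs_nbhs.
    have /cvgrPdist_lt/(_ _ g0) H := gc.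
    near=> t; split; first by near: t.
    have : `|'D_1 g t0 - 'D_1 g t| < 'D_1 g t0 by near: t.
    by rewrite ltr_distlC subrr => /andP[].
  move=> /nbhs_ballP[e /= e0 eP]; exists (Num.min (e / 2) d0).
    by rewrite lt_min divr_gt0// d00/= ge_min lexx orbT.
  move=> t td; apply: eP; rewrite /ball/= distrC.
  apply: (le_lt_trans (le_trans td _)); first by rewrite ge_min; apply/orP; left; exact: lexx.
  by rewrite ltr_pdivrMr// ltr_pMr// ltr1n.
have Ig t : `|t - t0| <= d -> is_derive t (1 : R) g ('D_1 g t).
  by move=> /dP[Ut _]; apply: derivableP; exact: smooth_derivable gU Ut.
have cg t : `|t - t0| <= d -> {for t, continuous g}.
  by move=> /dP[Ut _]; exact: smooth_continuous gU Ut.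
pose a := t0 - d; pose b := t0 + d.
have abP t : (t \in `[a, b]%R) = (`|t - t0| <= d).
  by rewrite in_itv/= ler_distl.
have aboP t : (t \in `]a, b[%R) = (`|t - t0| < d).
  by rewrite in_itv/= ltr_distl.
have ab : a <= b by rewrite /a /b; lra.
have gw : {within `[a, b], continuous g}.
  by apply: continuous_in_subspaceT => t; rewrite inE/= abP; exact: cg.
have gmono : {in `[a, b]%R &, {homo g : x y / x < y}}.
  apply: (@gtr0_derive1_lt_cc R g a b) => //.
    by move=> t; rewrite aboP => /ltW/Ig[].
  by move=> t; rewrite aboP => /ltW td; rewrite derive1E; have [] := dP t td.
have ginj : {in `[a, b]%R &, injective g}.
  move=> s t sab tab gst; have [st|st|//] := ltgtP s t.
    by have := gmono _ _ sab tab st; rewrite gst ltxx.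
  by have := gmono _ _ tab sab st; rewrite gst ltxx.
have aab : a \in `[a, b]%R by rewrite in_itv/= lexx.
have bab : b \in `[a, b]%R by rewrite in_itv/= lexx andbT.
pose O := `]g a, g b[%classic : set R.
pose sigma y := xget t0 [set t | t \in `]a, b[%R /\ g t = y].
have surj y : O y -> exists t, t \in `]a, b[%R /\ g t = y.
  rewrite /O/= in_itv/= => /andP[ya yb].
  have [|t tab gty] := @IVT R g a b y ab gw.
    by rewrite minElt maxElt (lt_trans ya yb)/= !ltW.
  exists t; split => //; move: tab; rewrite !in_itv/= => /andP[at_ tb].
  by rewrite !lt_neqAle at_ tb !andbT; apply/andP; split; apply/eqP => E;
    move: ya yb; rewrite -gty E ltxx.
have sP y : O y -> sigma y \in `]a, b[%R /\ g (sigma y) = y.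
  by move=> /surj; exact: (xgetPex t0).
have gO t : `|t - t0| < d -> O (g t).
  move=> td; have := td; rewrite -aboP in_itv/= => /andP[at_ tb].
  have tab : t \in `[a, b]%R by rewrite abP ltW.
  by rewrite /O/= in_itv/= !gmono.
have sg t : `|t - t0| < d -> sigma (g t) = t.
  move=> td; have [sab gs] := sP _ (gO t td).
  by apply: ginj => //; rewrite abP ltW// -aboP.
exists d, O, sigma; split; first by rewrite dd.
split; first exact: interval_open.
split => [t td|y Oy].
  have [Ut gt0] := dP t (ltW td).
  by split => //; [exact: gO|exact: sg|rewrite gt_eqF].
have [syab gsy] := sP y Oy; have sd : `|sigma y - t0| < d by rewrite -aboP.
split => //; have := @is_derive_inverse R g sigma _ (sigma y) _ _ (Ig _ (ltW sd)).
have nd : \forall t \near sigma y, `|t - t0| < d.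
  have : nbhs (sigma y) (`]a, b[%classic : set R).
    by apply: open_nbhs_nbhs; split => //; exact: interval_open.
  by apply: filterS => t; rewrite /= aboP.
rewrite gsy; apply.
- by apply: filterS nd => t; exact: sg.
- by apply: filterS nd => t /ltW; exact: cg.
- by rewrite gt_eqF//; have [] := dP _ (ltW sd).
Unshelve. all: by end_near. Qed.

End LocalInverse.

Section Curve.
Variable R : realType.
Local Notation V := 'rV[R]_4.

Lemma smooth_coordinate n (U : set R) (f : R -> 'rV[R]_n) i : open U ->
  smooth_on U f -> smooth_on U (fun t => f t 0 i : R).
Proof.
move=> oU fU; apply: (@smooth_coind R R R U
  (fun h : R -> R => exists2 g : R -> 'rV[R]_n,
    smooth_on U g & h = (fun t => g t 0 i))) => //.
- move=> _ [g gU ->] t Ut.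
  apply: (@continuous_comp _ _ _ g (fun z : 'rV[R]_n => z 0 i : R)).
    exact: smooth_continuous gU Ut.
  exact/differentiable_continuous/differentiable_coord.
- move=> _ v [g gU ->]; exists (fun t => 'D_v g t 0 i).
    by exists ('D_v g); [exact: smooth_derive|].
  move=> t Ut; have gd := smooth_derivable (v := v) gU Ut.
  apply: DeriveDef; first exact: (derivable_mxP g t v).1 gd 0 i.
  by rewrite derive_mx// mxE.
- by exists f.
Qed.

Lemma derive_coordinate n (U : set R) (f : R -> 'rV[R]_n) i (v t : R) :
  smooth_on U f -> U t -> 'D_v (fun t => f t 0 i : R) t = 'D_v f t 0 i.
Proof.
by move=> fU Ut; rewrite derive_mx ?mxE//; exact: smooth_derivable fU Ut.
Qed.

(** Coinduction from the formula (h o sigma)' = (h' / g') o sigma, whose right-hand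
side has the same shape. *)
Lemma smooth_inverse_comp (J O : set R) (g sigma : R -> R) : open J -> open O ->
  smooth_on J g -> (forall t, J t -> 'D_1 g t != 0) ->
  (forall y, O y -> J (sigma y) /\
    is_derive y (1 : R) sigma ('D_1 g (sigma y))^-1) ->
  forall h : R -> R, smooth_on J h -> smooth_on O (fun y => h (sigma y)).
Proof.
move=> oJ oO gJ g0 sP h hJ.
have giJ : smooth_on J (fun t => ('D_1 g t)^-1).
  have oN : open [set x : R | x != 0] := @open_neq R 0.
  have inv : smooth_on [set x : R | x != 0] (fun x : R => x^-1).
    by apply: smooth_inv.
  exact: (smooth_comp oJ oN inv g0 (smooth_derive (1 : R) gJ)).
apply: (@smooth_coind1 R O (fun f => exists2 h : R -> R, smooth_on J h &
   f = fun y => h (sigma y))) => //.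
- move=> c _ [k kJ ->]; exists (fun t => c * k t); last by [].
  exact: (smoothZ c oJ kJ).
- move=> _ [k kJ ->]; exists (fun y => 'D_1 k (sigma y) * ('D_1 g (sigma y))^-1).
    exists (fun t => 'D_1 k t * ('D_1 g t)^-1); last by [].
    exact: (smoothM oJ (smooth_derive (1 : R) kJ) giJ).
  move=> y /sP[Jy sd].
  have kd := derivableP (smooth_derivable (v := (1 : R)) kJ Jy).
  exact: (@is_derive1_comp R k sigma y _ _ kd sd).
- by exists h.
Qed.

Lemma periodic_int (gamma : R -> V) (T : R) : (forall t, gamma (t + T) = gamma t) ->
  forall (n : int) t, gamma (t + n%:~R * T) = gamma t.
Proof.
move=> gT.
have H (n : nat) t : gamma (t + n%:R * T) = gamma t.
  elim: n => [|n IH]; first by rewrite mul0r addr0.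
  by rewrite -natr1 mulrDl mul1r addrA gT.
case=> n t; first exact: H.
by rewrite NegzE mulrNz mulNr -(H n.+1 (t - _)) subrK.
Qed.

(** Only the parameters near t0 produce points near gamma t0.  For an arc this is
the continuity of the inverse parametrization.  For a closed curve of period T,
the distance to gamma t0 has a positive lower bound on the compact set of the
parameters that are at distance between d and T / 2 from t0, and every parameter
is within T / 2 of t0 up to a multiple of T. *)
Lemma real_curve_local (I : set R) (gamma : R -> V) S t0 : real_curve I gamma S ->
  I t0 -> forall d : R, 0 < d -> exists2 e : R, 0 < e & forall p, S p ->
    `|p - gamma t0| < e -> exists2 s, `|s - t0| < d & gamma s = p.
Proof.
move=> [[U [oU IU gU]] gI <-] It0 d d0.
case: gI => [[IT [T [T0 gT ginj]]]|[_ _ _ ginv]]; last first.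
  have [e e0 eP] := ginv t0 It0 d d0; exists e => // _ [s Is <-] se.
  by exists s => //; exact: eP.
pose K := [set s : R | `|s - t0| <= T / 2] `&` [set s : R | d <= `|s - t0|].
have nc : continuous (fun s : R => `|s - t0|).
  by move=> s; apply: (@continuous_comp _ _ _ (fun s => s - t0) (fun x : R => `|x|));
    [apply: cvgB; [exact: cvg_id|exact: cvg_cst]|exact: norm_continuous].
have cK : compact K.
  apply: compact_closedI.
    rewrite (_ : [set s | _] = `[t0 - T / 2, t0 + T / 2]%classic); first exact: segment_compact.
    by apply/seteqP; split=> s /=; rewrite in_itv/= ler_distl.
  rewrite (_ : [set s | d <= _] = (fun s : R => `|s - t0|) @^-1` [set x | d <= x])//.
  apply: closed_comp; last exact: closed_ge.
  by move=> s _; exact: nc.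
have gc s : {for s, continuous gamma}.
  by apply: smooth_continuous gU _; apply: IU; rewrite IT.
have : \forall e \near (0 : R), K `<=` [set s | e < `|gamma s - gamma t0|].
  apply: ((compact_near_coveringP K).1 cK (R : Type) (nbhs (0 : R))
    (fun e s => e < `|gamma s - gamma t0|)).
  move=> s [Ks1 Ks2].
  have f0 : 0 < `|gamma s - gamma t0|.
    rewrite normr_gt0 subr_eq0; apply/eqP => gst.
    have sT : `|s - t0| < T.
      by rewrite (le_lt_trans Ks1)// ltr_pdivrMr// ltr_pMr// ltr1n.
    by move: Ks2; rewrite /= (ginj _ _ sT gst) subrr normr0 leNgt d0.
  have fc : {for s, continuous (fun s => `|gamma s - gamma t0|)}.
    apply: (@continuous_comp _ _ _ (fun s => gamma s - gamma t0) (fun x : V => `|x|)).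
      by apply: cvgB; [exact: gc|exact: cvg_cst].
    exact: norm_continuous.
  have hc : {for (s, (0 : R)), continuous (fun z : R * R => `|gamma z.1 - gamma t0| - z.2)}.
    apply: cvgB; last exact: cvg_snd.
    apply: (@continuous_comp _ _ _ (fun z : R * R => z.1)
      (fun s => `|gamma s - gamma t0|)); first exact: cvg_fst.
    exact: fc.
  have : nbhs (s, (0 : R)) ((fun z : R * R => `|gamma z.1 - gamma t0| - z.2) @^-1` [set x | 0 < x]).
    by apply: hc; apply: open_nbhs_nbhs; split; [exact: open_gt|rewrite /= subr0].
  by apply: filterS => -[x y] /=; rewrite subr_gt0.
move=> /nbhs_ballP[e /= e0 eP]; exists (e / 2); first by rewrite divr_gt0.
move=> _ [s Is <-] se.
(* n is the integer nearest to (s - t0) / T, so s - n T is within T / 2 of t0. *)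
pose n := Num.floor ((s - t0) / T + 1 / 2).
pose s' := s - n%:~R * T.
have gs : gamma s' = gamma s.
  by rewrite /s' -mulNr -mulrNz; exact: periodic_int.
exists s' => //; rewrite ltNge; apply/negP => ds.
have Be : ball (0 : R) e (e / 2).
  rewrite /ball/= sub0r normrN ger0_norm ?divr_ge0 ?ltW//.
  by rewrite ltr_pdivrMr// ltr_pMr// ltr1n.
have : K s'.
  split => //=.
  have /andP[n1 n2] := mem_rg1_floor ((s - t0) / T + 1 / 2).
  rewrite -/n in n1 n2.
  have -> : s' - t0 = ((s - t0) / T - n%:~R) * T by rewrite /s'; field; rewrite gt_eqF.
  rewrite normrM (gtr0_norm T0) mulrC ler_pM2l//.
  by rewrite ler_norml; apply/andP; split; lra.
by move=> /(eP _ Be)/=; rewrite gs ltNge (ltW se).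
Qed.

End Curve.

Section Vanishing.
Variable R : realType.
Local Notation V := 'rV[R]_4.

(** The square of the Euclidean distance is smooth, unlike the norm of row vectors,
which is the maximum of the coordinates. *)
Definition sqdist (p z : V) : R := \sum_(i < 4) (z 0 i - p 0 i) * (z 0 i - p 0 i).

Lemma smooth_sqdist p : smooth_on setT (sqdist p).
Proof.
apply: smooth_sum; first exact: openT.
move=> i; have d : smooth_on setT (fun z : V => z 0 i - p 0 i).
  by apply: smoothB (openT) (smooth_coord _ openT) (smooth_cst _ openT).
exact: (smoothM openT d d).
Qed.

Lemma coord_sqdist_le p z (e : R) i : 0 <= e -> sqdist p z <= e ^+ 2 ->
  `|z 0 i - p 0 i| <= e.
Proof.
move=> e0 pz; rewrite -ler_sqr ?nnegrE// real_normK ?num_real//.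
apply: le_trans pz; rewrite /sqdist (bigD1 i)//= expr2 lerDl sumr_ge0// => j _.
by rewrite -expr2 sqr_ge0.
Qed.

Lemma dist_sqdist_le p z (e : R) : 0 <= e -> sqdist p z <= e ^+ 2 -> `|z - p| <= e.
Proof.
move=> e0 pz; apply: rV_norm_le => // i; rewrite !mxE.
exact: coord_sqdist_le.
Qed.

(** Choose k such that the k-th coordinate of gamma' does not vanish, and j such that
T and gamma' are independent in the coordinates (j, k).  Near gamma t0 the curve
is contained in the graph of the j-th coordinate as a function of the k-th one.
The equation of this graph is multiplied by a cut-off, which makes it smooth
everywhere and zero on the rest of the curve. *)
Lemma vanishing_function (I : set R) (gamma : R -> V) S t0 (T : V) :
  real_curve I gamma S -> I t0 -> 'D_1 gamma t0 != 0 ->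
  (forall c : R, T <> c *: 'D_1 gamma t0) ->
  exists h : V -> R, [/\ smooth_on setT h, forall p, S p -> h p = 0 &
    'D_T h (gamma t0) != 0].
Proof.
move=> cS It0 g0 Tg; have [[U [oU IU gU]] _ _] := cS.
have Ut0 := IU _ It0; set g' := 'D_1 gamma t0 in g0 Tg *.
have [k gk] : exists k, g' 0 k != 0.
  apply: contra_notP (elimN eqP g0) => H; apply/rowP => i; rewrite mxE.
  by apply/eqP; apply: contra_notT H => gi; exists i.
(* Otherwise T would be the multiple T_k / gamma'_k of gamma'. *)
have [j Tj] : exists j, T 0 j * g' 0 k != g' 0 j * T 0 k.
  apply: contra_notP (Tg (T 0 k / g' 0 k)) => H; apply/rowP => i; rewrite mxE.
  have Ti : T 0 i * g' 0 k = g' 0 i * T 0 k.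
    by apply/eqP; apply: contra_notT H => Ti; exists i.
  by apply: (mulIf gk); rewrite Ti; field.
pose ga i t : R := gamma t 0 i.
have gaU i : smooth_on U (ga i) by exact: smooth_coordinate.
have Dga i : 'D_1 (ga i) t0 = g' 0 i by exact: (derive_coordinate i _ gU Ut0).
have gk' : 'D_1 (ga k) t0 != 0 by rewrite Dga.
have [d [Y [sg [/andP[d0 _] [oY [gP sP]]]]]] := local_inverse oU (gaU k) Ut0 gk' ltr01.
pose Jt := [set t : R | `|t - t0| < d].
have oJ : open Jt.
  rewrite (_ : Jt = `]t0 - d, t0 + d[%classic); first exact: interval_open.
  by apply/seteqP; split=> t; rewrite /Jt/= in_itv/= ltr_distl.
have JU : Jt `<=` U by move=> t /gP[].
have Jt0 : Jt t0 by rewrite /Jt/= subrr normr0.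
have msm : smooth_on Y (fun y => ga j (sg y)).
  apply: (@smooth_inverse_comp R Jt Y (ga k) sg) => //.
  - exact: smooth_subset JU (gaU k).
  - by move=> t /gP[].
  - exact: smooth_subset JU (gaU j).
set p0 := gamma t0.
have [Yp0 sgp0] : Y (p0 0 k) /\ sg (p0 0 k) = t0 by have [] := gP t0 Jt0.
have [e1 e10 e1P] : exists2 e : R, 0 < e & forall x, `|x - p0 0 k| <= e -> Y x.
  have /nbhs_ballP[e /= e0 eP] : nbhs (p0 0 k) Y by exact: open_nbhs_nbhs.
  exists (e / 2) => [|x xe]; first by rewrite divr_gt0.
  apply: eP; rewrite /ball/= distrC (le_lt_trans xe)//.
  by rewrite ltr_pdivrMr// ltr_pMr// ltr1n.
have [e2 e20 e2P] := real_curve_local cS It0 d0.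
(* e1 keeps the k-th coordinate in the domain of the local inverse; e2 excludes
   the points of the curve whose parameters are far from t0. *)
pose e := Num.min e1 (e2 / 2).
have e0 : 0 < e by rewrite lt_min e10 divr_gt0.
pose cut (z : V) : R := bump (e ^+ 2 - sqdist p0 z).
have cutS : smooth_on setT cut.
  apply: (smooth_comp (O := setT)) => //; [exact: openT|exact: openT| |].
    by apply: smooth_bump; exact: openT.
  exact: (smoothB openT (smooth_cst _ openT) (smooth_sqdist p0)).
pose m (z : V) : R := z 0 j - ga j (sg (z 0 k)).
pose U1 := [set z : V | Y (z 0 k)].
have ck : continuous (fun z : V => z 0 k).
  by move=> z; exact/differentiable_continuous/differentiable_coord.
have oU1 : open U1.
  by apply: (open_comp (f := fun z : V => z 0 k)) => // z _; exact: ck.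
have mU1 : smooth_on U1 m.
  have sk : smooth_on U1 (fun z : V => ga j (sg (z 0 k))).
    exact: (smooth_comp oU1 oY msm (fun z Uz => Uz) (smooth_coord k oU1)).
  exact: (smoothB oU1 (smooth_coord j oU1) sk).
pose h (z : V) : R := cut z * m z.
pose U2 := [set z : V | e ^+ 2 < sqdist p0 z].
have oU2 : open U2.
  rewrite (_ : U2 = sqdist p0 @^-1` [set x | e ^+ 2 < x])//.
  apply: open_comp; last exact: open_gt.
  by move=> z _; exact: (smooth_continuous (smooth_sqdist p0)).
have hU2 : smooth_on U2 h.
  apply: (eq_smooth oU2 (f := fun=> 0)); last exact: smooth_cst.
  move=> z; rewrite inE /U2/= => ze; rewrite /h /cut bump_le0 ?mul0r//.
  by rewrite subr_le0 ltW.
have hU1 : smooth_on U1 h.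
  exact: (smoothM oU1 (smooth_subset (@subsetT _ _) cutS) mU1).
(* The product is smooth where the equation is defined, and zero where the
   cut-off vanishes; these two open sets cover the space. *)
have U12 : U1 `|` U2 = setT.
  apply/seteqP; split => // z _; have [ze|ze] := leP (sqdist p0 z) (e ^+ 2).
    left; apply: e1P; apply: (le_trans (coord_sqdist_le k (ltW e0) ze)).
    by rewrite ge_min lexx.
  by right.
exists h; split.
- by rewrite -U12; exact: smooth_setU.
- move=> p Sp; have [ze|ze] := leP (sqdist p0 p) (e ^+ 2); last first.
    by rewrite /h /cut bump_le0 ?mul0r// subr_le0 ltW.
  have pe : `|p - p0| < e2.
    apply: (le_lt_trans (dist_sqdist_le (ltW e0) ze)).
    by rewrite gt_min; apply/orP; right; rewrite ltr_pdivrMr// ltr_pMr// ltr1n.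
  have [s sd gs] := e2P p Sp pe; have [_ _ sgs _] := gP s sd.
  by rewrite /h /m -gs [sg _]sgs subrr mulr0.
have U1p0 : U1 p0 by [].
have Dh : 'D_T h p0 = cut p0 * 'D_T m p0 + m p0 * 'D_T cut p0.
  exact: (derive_mul T oU1 (smooth_subset (@subsetT _ _) cutS) mU1 U1p0).
have m0 : m p0 = 0 by rewrite /m sgp0 subrr.
have Dm : is_derive p0 T m (T 0 j - 'D_1 (ga j) t0 * ('D_1 (ga k) t0)^-1 * T 0 k).
  have dk i := is_derive_coord p0 T i.
  apply: is_deriveB => //.
  apply: (@is_derive_scalar_comp R V (fun y => ga j (sg y)) (fun z : V => z 0 k)) => //.
  have [_ sd] := sP _ Yp0; rewrite sgp0 in sd.
  have kd : is_derive (sg (p0 0 k)) (1 : R) (ga j) ('D_1 (ga j) t0).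
    by rewrite sgp0; exact: derivableP (smooth_derivable (gaU j) Ut0).
  exact: (@is_derive1_comp R (ga j) sg _ _ _ kd sd).
rewrite Dh m0 mul0r addr0 mulf_eq0 negb_or; apply/andP; split.
  rewrite gt_eqF// bump_gt0// subr_gt0 /sqdist big1 ?exprn_gt0// => i _.
  by rewrite subrr mul0r.
have [_ ->] := Dm; rewrite !Dga subr_eq0.
by apply: contra Tj => /eqP ->; apply/eqP; field.
Qed.

End Vanishing.

(** * Hermitian forms and moving frames *)

Section Vec.
Variable R : realType.
Local Notation V := 'rV[R]_4.
Implicit Types (v w : V).

Lemma ord2P (j : 'I_2) : j = 0 \/ j = 1.
Proof. by case: j => -[|[|//]] ij; [left|right]; exact: val_inj. Qed.

(** The point (a0 + i b0, a1 + i b1) of C^2. *)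
Definition vec (a0 a1 b0 b1 : R) : V :=
  a0 *: e_x R 0 + a1 *: e_x R 1 + (b0 *: e_y R 0 + b1 *: e_y R 1).

Lemma vec_x0 a0 a1 b0 b1 : vec a0 a1 b0 b1 0 (xi 0) = a0.
Proof. by rewrite /vec !mxE !xy_eq/=; ring. Qed.
Lemma vec_x1 a0 a1 b0 b1 : vec a0 a1 b0 b1 0 (xi 1) = a1.
Proof. by rewrite /vec !mxE !xy_eq/=; ring. Qed.
Lemma vec_y0 a0 a1 b0 b1 : vec a0 a1 b0 b1 0 (yi 0) = b0.
Proof. by rewrite /vec !mxE !xy_eq/=; ring. Qed.
Lemma vec_y1 a0 a1 b0 b1 : vec a0 a1 b0 b1 0 (yi 1) = b1.
Proof. by rewrite /vec !mxE !xy_eq/=; ring. Qed.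
Definition vec_coord := (vec_x0, vec_x1, vec_y0, vec_y1).

Lemma vecE v : v = vec (v 0 (xi 0)) (v 0 (xi 1)) (v 0 (yi 0)) (v 0 (yi 1)).
Proof. by apply: rV4_ext => j; have [->|->] := ord2P j; rewrite vec_coord. Qed.

Lemma J_vec a0 a1 b0 b1 : J (vec a0 a1 b0 b1) = vec (- b0) (- b1) a0 a1.
Proof. by rewrite [LHS]vecE !(J_x, J_y) !vec_coord. Qed.

Lemma vec_add a0 a1 b0 b1 c0 c1 d0 d1 : vec a0 a1 b0 b1 + vec c0 c1 d0 d1 =
  vec (a0 + c0) (a1 + c1) (b0 + d0) (b1 + d1).
Proof.
rewrite [LHS]vecE; set v := vec a0 _ _ _; set w := vec c0 _ _ _.
by rewrite !(mxE _ (fun i j => v i j + w i j)) !vec_coord.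
Qed.

Lemma vec_scale c a0 a1 b0 b1 : c *: vec a0 a1 b0 b1 =
  vec (c * a0) (c * a1) (c * b0) (c * b1).
Proof.
rewrite [LHS]vecE; set v := vec a0 _ _ _.
by rewrite !(mxE _ (fun i j => c * v i j)) !vec_coord.
Qed.

Lemma derive_vec (U : set V) (f : V -> R) p a0 a1 b0 b1 :
  open U -> smooth_on U f -> U p ->
  'D_(vec a0 a1 b0 b1) f p = a0 * 'D_(e_x R 0) f p + a1 * 'D_(e_x R 1) f p +
    (b0 * 'D_(e_y R 0) f p + b1 * 'D_(e_y R 1) f p).
Proof.
move=> oU fU Up; have df := smooth_differentiable oU fU Up.
by rewrite !deriveE// /vec !linearD !linearZ.
Qed.

Lemma smooth_field_derive (U : set V) (f : V -> R) (A : V -> V) :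
  open U -> smooth_on U f -> (forall i, smooth_on U (fun p => A p 0 i : R)) ->
  smooth_on U (fun p => 'D_(A p) f p).
Proof.
move=> oU fU AU.
apply: (eq_smooth oU (f := fun p => \sum_(i < 4) A p 0 i * 'D_(delta_mx 0 i) f p)).
  move=> p; rewrite inE => Up; have df := smooth_differentiable oU fU Up.
  rewrite deriveE// {2}(row_sum_delta (A p)) linear_sum/=; apply: eq_bigr => i _.
  by rewrite linearZ deriveE.
exact: (smooth_sum _ oU (fun i => smoothM oU (AU i) (smooth_derive _ fU))).
Qed.

(** The field B is frozen at p: the second derivative is a sum of second derivatives
along the coordinate vectors, with the coordinates of B as coefficients. *)
Lemma smooth_field_hess (U : set V) (f : V -> R) (A B : V -> V) :
  open U -> smooth_on U f -> (forall i, smooth_on U (fun p => A p 0 i : R)) ->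
  (forall i, smooth_on U (fun p => B p 0 i : R)) ->
  smooth_on U (fun p => hess f p (A p) (B p)).
Proof.
move=> oU fU AU BU.
apply: (eq_smooth oU (f := fun p => \sum_(i < 4) B p 0 i * 'D_(A p) ('D_(delta_mx 0 i) f) p)).
  move=> p; rewrite inE => Up; rewrite /hess.
  have E : {in U, 'D_(B p) f =1 fun q => \sum_(i < 4) B p 0 i * 'D_(delta_mx 0 i) f q}.
    move=> q; rewrite inE => Uq; have df := smooth_differentiable oU fU Uq.
    rewrite deriveE// {1}(row_sum_delta (B p)) linear_sum/=; apply: eq_bigr => i _.
    by rewrite linearZ deriveE.
  rewrite (eq_derive_on _ oU E Up).
  have sd i : smooth_on U (fun q => B p 0 i * 'D_(delta_mx 0 i) f q).
    exact: (smoothZ _ oU (smooth_derive _ fU)).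
  have d i : is_derive p (A p) (fun q => B p 0 i * 'D_(delta_mx 0 i) f q)
      (B p 0 i * 'D_(A p) ('D_(delta_mx 0 i) f) p).
    exact: (is_deriveZ _ (derivableP (smooth_derivable (smooth_derive _ fU) Up))).
  elim: (index_enum _) => [|i s IH].
    by rewrite big_nil; under eq_fun do rewrite big_nil; rewrite derive_cst.
  rewrite big_cons IH; under [in RHS]eq_fun do rewrite big_cons.
  have ss : smooth_on U (fun q => \sum_(j <- s) B p 0 j * 'D_(delta_mx 0 j) f q).
    exact: smooth_sum.
  by rewrite (derive_add _ oU (sd i) ss Up); have [_ ->] := d i.
exact: (smooth_sum _ oU (fun i =>
  smoothM oU (BU i) (smooth_field_derive oU (smooth_derive _ fU) AU))).
Qed.

Lemma smooth_field_J (U : set V) (A : V -> V) : open U ->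
  (forall i, smooth_on U (fun p => A p 0 i : R)) ->
  forall i, smooth_on U (fun p => J (A p) 0 i : R).
Proof.
move=> oU AU i; have [j ->|j ->] := split_ordP (i : 'I_(2 + 2)).
  rewrite (_ : (fun _ => _) = fun p => - A p 0 (yi j)); first exact: smoothN.
  by apply/funext => p; rewrite J_x.
by rewrite (_ : (fun _ => _) = fun p => A p 0 (xi j))//; apply/funext => p; rewrite J_y.
Qed.

Lemma smooth_field_levi (U : set V) (f : V -> R) (A : V -> V) :
  open U -> smooth_on U f -> (forall i, smooth_on U (fun p => A p 0 i : R)) ->
  smooth_on U (fun p => levi f p (A p)).
Proof.
move=> oU fU AU; have JAU := smooth_field_J oU AU.
exact: (smoothD oU (smooth_field_hess oU fU AU AU) (smooth_field_hess oU fU JAU JAU)).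
Qed.

(** The hermitian form v |-> B v v + B (J v) (J v) of a real bilinear form B, in
coordinates with respect to the complex directions T and N.  B T N and
B N T are kept apart: for a Hessian they are derivatives in different orders. *)
Lemma hermitian_expansion (B : V -> V -> R) :
  (forall a c v v' w, B (a *: v + c *: v') w = a * B v w + c * B v' w) ->
  (forall a c v v' w, B w (a *: v + c *: v') = a * B w v + c * B w v') ->
  forall (T N : V) a b c d, let L v := B v v + B (J v) (J v) in
  L ((a *: T + b *: J T) + (c *: N + d *: J N)) =
    (a ^+ 2 + b ^+ 2) * L T +
    (a * c + b * d) * (B T N + B N T + B (J T) (J N) + B (J N) (J T)) +
    (a * d - b * c) * (B T (J N) + B (J N) T - B (J T) N - B N (J T)) +
    (c ^+ 2 + d ^+ 2) * L N.
Proof.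
move=> Bl Br T N a b c d L; rewrite /L.
have Bl1 v v' w : B (v + v') w = B v w + B v' w.
  by have := Bl 1 1 v v' w; rewrite !scale1r !mul1r.
have Br1 v v' w : B w (v + v') = B w v + B w v'.
  by have := Br 1 1 v v' w; rewrite !scale1r !mul1r.
have JD v w : J (v + w) = J v + J w.
  by have := J_lin 1 v w; rewrite !scale1r.
have Blz x v w : B (x *: v) w = x * B v w.
  by have := Bl x 0 v v w; rewrite scale0r mul0r !addr0.
have Brz x v w : B w (x *: v) = x * B w v.
  by have := Br x 0 v v w; rewrite scale0r mul0r !addr0.
have sN x v : x *: - v = (- x) *: v by rewrite scalerN scaleNr.
by rewrite JD !J_lin2 !JJ !sN !(Bl1, Br1) !(Blz, Brz); ring.
Qed.

(** The discriminant criterion, by completing squares in c and d. *)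
Lemma hermitian_ge0 (a b c d alpha X Y zeta : R) : 0 <= alpha -> 0 < zeta ->
  X ^+ 2 + Y ^+ 2 <= 4 * alpha * zeta ->
  0 <= (a ^+ 2 + b ^+ 2) * alpha + (a * c + b * d) * X + (a * d - b * c) * Y
     + (c ^+ 2 + d ^+ 2) * zeta.
Proof.
move=> a0 z0 H; set e := (X in 0 <= X).
have E : 4 * zeta * e = (2 * zeta * c + a * X - b * Y) ^+ 2
   + (2 * zeta * d + b * X + a * Y) ^+ 2
   + (4 * alpha * zeta - (X ^+ 2 + Y ^+ 2)) * (a ^+ 2 + b ^+ 2) by rewrite /e; ring.
have z4 : 0 < 4 * zeta by rewrite mulr_gt0.
rewrite -(pmulr_rge0 _ z4) E.
by rewrite !addr_ge0 ?sqr_ge0// mulr_ge0 ?subr_ge0// addr_ge0 ?sqr_ge0.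
Qed.

End Vec.

(** * The weighted form in a boundary frame *)

Section Frame.
Variable R : realType.
Local Notation V := 'rV[R]_4.
Variables (U : set V) (r : V -> R).
Hypotheses (oU : open U) (rU : smooth_on U r).
Implicit Types (p v : V).

(** The gradient of r. *)
Definition normal_field (r : V -> R) p : V :=
  vec ('D_(e_x R 0) r p) ('D_(e_x R 1) r p) ('D_(e_y R 0) r p) ('D_(e_y R 1) r p).

(** Proportional to Re L; as a vector of C^2 it is 2 (r_w, - r_z). *)
Definition tangent_field (r : V -> R) p : V :=
  vec ('D_(e_x R 1) r p) (- 'D_(e_x R 0) r p) (- 'D_(e_y R 1) r p) ('D_(e_y R 0) r p).

Definition grad2 (r : V -> R) p : R :=
  'D_(e_x R 0) r p ^+ 2 + 'D_(e_x R 1) r p ^+ 2 +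
  ('D_(e_y R 0) r p ^+ 2 + 'D_(e_y R 1) r p ^+ 2).

Local Notation T := (tangent_field r).
Local Notation N := (normal_field r).

Lemma grad2_ge0 p : 0 <= grad2 r p.
Proof. by rewrite !addr_ge0// sqr_ge0. Qed.

Lemma derive_normal p : U p -> 'D_(N p) r p = grad2 r p.
Proof. by move=> Up; rewrite /normal_field (derive_vec _ _ _ _ oU rU Up) /grad2; deriv_ring. Qed.

Lemma derive_Jnormal p : U p -> 'D_(J (N p)) r p = 0.
Proof. by move=> Up; rewrite /normal_field J_vec (derive_vec _ _ _ _ oU rU Up); deriv_ring. Qed.

Lemma derive_tangent p : U p -> 'D_(T p) r p = 0.
Proof. by move=> Up; rewrite /tangent_field (derive_vec _ _ _ _ oU rU Up); deriv_ring. Qed.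

Lemma derive_Jtangent p : U p -> 'D_(J (T p)) r p = 0.
Proof. by move=> Up; rewrite /tangent_field J_vec (derive_vec _ _ _ _ oU rU Up); deriv_ring. Qed.

Lemma sumsq4_eq0 (a b c d : R) : a ^+ 2 + b ^+ 2 + (c ^+ 2 + d ^+ 2) = 0 ->
  [/\ a = 0, b = 0, c = 0 & d = 0].
Proof.
move=> /eqP; rewrite !paddr_eq0 ?addr_ge0 ?sqr_ge0// !sqrf_eq0.
by move=> /andP[/andP[/eqP ? /eqP ?] /andP[/eqP ? /eqP ?]].
Qed.

Lemma grad2_gt0 p v : U p -> 'D_v r p != 0 -> 0 < grad2 r p.
Proof.
move=> Up; rewrite lt_neqAle grad2_ge0 andbT [0 == _]eq_sym; apply: contra.
move=> /eqP/sumsq4_eq0[x0 x1 y0 y1].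
by rewrite (vecE v) (derive_vec _ _ _ _ oU rU Up) x0 x1 y0 y1 !mulr0 !addr0.
Qed.

(** T is orthogonal to N for the hermitian product of C^2 and has the same length,
so the coefficients are hermitian products divided by that length squared. *)
Lemma vec_decomposition (x0 x1 y0 y1 : R) v :
  0 < x0 ^+ 2 + x1 ^+ 2 + (y0 ^+ 2 + y1 ^+ 2) -> exists a b c d : R,
  v = (a *: vec x1 (- x0) (- y1) y0 + b *: J (vec x1 (- x0) (- y1) y0)) +
      (c *: vec x0 x1 y0 y1 + d *: J (vec x0 x1 y0 y1)).
Proof.
move=> g0; rewrite (vecE v).
move: (v 0 (xi 0)) (v 0 (xi 1)) (v 0 (yi 0)) (v 0 (yi 1)) => v0 v1 w0 w1.
pose g := x0 ^+ 2 + x1 ^+ 2 + (y0 ^+ 2 + y1 ^+ 2).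
have gn : g != 0 by rewrite gt_eqF.
exists ((v0 * x1 - v1 * x0 - w0 * y1 + w1 * y0) / g),
  ((v0 * y1 - v1 * y0 + w0 * x1 - w1 * x0) / g),
  ((v0 * x0 + v1 * x1 + w0 * y0 + w1 * y1) / g),
  ((- v0 * y0 - v1 * y1 + w0 * x0 + w1 * x1) / g).
rewrite !J_vec !vec_scale !vec_add.
by congr vec; rewrite /g in gn *; field.
Qed.

Lemma frame_decomposition p v : 0 < grad2 r p -> exists a b c d : R,
  v = (a *: T p + b *: J (T p)) + (c *: N p + d *: J (N p)).
Proof. exact: vec_decomposition. Qed.

Lemma smooth_vec (f0 f1 g0 g1 : V -> R) i :
  smooth_on U f0 -> smooth_on U f1 -> smooth_on U g0 -> smooth_on U g1 ->
  smooth_on U (fun p => vec (f0 p) (f1 p) (g0 p) (g1 p) 0 i : R).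
Proof.
move=> s0 s1 t0 t1; have [j ->|j ->] := split_ordP (i : 'I_(2 + 2)).
  have [->|->] := ord2P j.
    by rewrite (_ : (fun _ => _) = f0)//; apply/funext => p; exact: vec_x0.
  by rewrite (_ : (fun _ => _) = f1)//; apply/funext => p; exact: vec_x1.
have [->|->] := ord2P j.
  by rewrite (_ : (fun _ => _) = g0)//; apply/funext => p; exact: vec_y0.
by rewrite (_ : (fun _ => _) = g1)//; apply/funext => p; exact: vec_y1.
Qed.

Lemma smooth_normal i : smooth_on U (fun p => N p 0 i : R).
Proof. by apply: smooth_vec; exact: smooth_derive. Qed.

Lemma smooth_tangent i : smooth_on U (fun p => T p 0 i : R).
Proof.
apply: smooth_vec; [exact: smooth_derive| | |exact: smooth_derive].
  exact: (smoothN oU (smooth_derive _ rU)).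
exact: (smoothN oU (smooth_derive _ rU)).
Qed.

Lemma smooth_grad2 : smooth_on U (grad2 r).
Proof.
apply: (eq_smooth oU (f := fun p => 'D_(N p) r p)).
  by move=> p; rewrite inE; exact: derive_normal.
exact: (smooth_field_derive oU rU smooth_normal).
Qed.

(** Together with [mixed_im], up to a factor, the real and imaginary parts of the
off-diagonal term of the Levi form of f in the frame (T, N). *)
Definition mixed_re (r f : V -> R) p : R :=
  hess f p (tangent_field r p) (normal_field r p) +
  hess f p (normal_field r p) (tangent_field r p) +
  hess f p (J (tangent_field r p)) (J (normal_field r p)) +
  hess f p (J (normal_field r p)) (J (tangent_field r p)).

Definition mixed_im (r f : V -> R) p : R :=
  hess f p (tangent_field r p) (J (normal_field r p)) +
  hess f p (J (normal_field r p)) (tangent_field r p) -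
  hess f p (J (tangent_field r p)) (normal_field r p) -
  hess f p (normal_field r p) (J (tangent_field r p)).

Section Weight.
Variables (psi : V -> R) (tau : R).
Hypothesis psiU : smooth_on U psi.

(** Up to a positive factor, the Levi form of - (- r exp (- psi)) ^ tau.  It is
written without exponentials so that it makes sense and can be expanded up to
the boundary. *)
Definition df_form p v : R :=
  - r p * levi r p v + r p ^+ 2 * levi psi p v + (1 - tau) * sqgrad r p v
  + 2 * tau * r p * dotgrad r psi p v - tau * r p ^+ 2 * sqgrad psi p v.

Let rho1 p := r p * expR (- psi p).

Lemma smooth_weighted : smooth_on U rho1.
Proof.
exact: (smoothM oU rU (smooth_comp oU openT (smooth_expR openT)
  (fun _ _ => I) (smoothN oU psiU))).
Qed.

Lemma weighted_form p v : U p ->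
  - rho1 p * levi rho1 p v + (1 - tau) * sqgrad rho1 p v =
  expR (- psi p) ^+ 2 * df_form p v.
Proof.
move=> Up; pose h (t : R) := expR (- t).
have hd t : setT t -> is_derive t (1 : R) h (- expR (- t)).
  move=> _; have := @is_derive1_comp R expR -%R t _ _ (is_derive_expR (- t))
    (is_deriveN (is_derive_id t (1 : R))).
  by rewrite mulrN1.
have hd2 t : setT t -> is_derive t (1 : R) (fun t => - expR (- t)) (expR (- t)).
  by move=> /hd d; have := is_deriveN d; rewrite opprK.
have psiT x : U x -> setT (psi x) by [].
pose e q := h (psi q).
have eU : smooth_on U e.
  exact: (smooth_comp oU openT (smooth_expR openT) (fun _ _ => I) (smoothN oU psiU)).
have De w : 'D_w e p = - expR (- psi p) * 'D_w psi p.
  exact: (derive_comp psiU psiT Up hd).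
have Le : levi e p v = - expR (- psi p) * levi psi p v + expR (- psi p) * sqgrad psi p v.
  exact: (levi_comp oU psiU psiT Up hd hd2 v).
have L1 : levi rho1 p v = r p * levi e p v + 2 * dotgrad r e p v + e p * levi r p v.
  exact: (levi_mul v oU rU eU Up).
have D1 w : 'D_w rho1 p = r p * 'D_w e p + e p * 'D_w r p.
  exact: (derive_mul w oU rU eU Up).
have S1 : sqgrad rho1 p v = ('D_v rho1 p) ^+ 2 + ('D_(J v) rho1 p) ^+ 2 by [].
rewrite L1 /df_form S1 (D1 v) (D1 (J v)) Le /dotgrad (De v) (De (J v)) /sqgrad /e /h /rho1.
move: (levi psi p v) (levi r p v) => lp lr.
set E := expR _; move: E => E; deriv_ring.
Qed.

Definition cross_re p : R := mixed_re r r p - r p * mixed_re r psi p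
  - 2 * tau * grad2 r p * 'D_(T p) psi p
  + 2 * tau * r p * ('D_(T p) psi p * 'D_(N p) psi p
                  + 'D_(J (T p)) psi p * 'D_(J (N p)) psi p).

Definition cross_im p : R := mixed_im r r p - r p * mixed_im r psi p
  + 2 * tau * grad2 r p * 'D_(J (T p)) psi p
  + 2 * tau * r p * ('D_(T p) psi p * 'D_(J (N p)) psi p
                  - 'D_(J (T p)) psi p * 'D_(N p) psi p).

Definition tangent_coef p : R := levi psi p (T p) - tau * sqgrad psi p (T p).

Definition normal_coef p : R := - r p * levi r p (N p) + r p ^+ 2 * levi psi p (N p)
  + (1 - tau) * grad2 r p ^+ 2 + 2 * tau * r p * (grad2 r p * 'D_(N p) psi p)
  - tau * r p ^+ 2 * sqgrad psi p (N p).

(** Since r has derivative 0 along T and J T, every term outside the coefficient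
[normal_coef] of the normal direction carries a factor r. *)
Lemma df_form_expansion p a b c d : U p ->
  df_form p ((a *: T p + b *: J (T p)) + (c *: N p + d *: J (N p))) =
    (a ^+ 2 + b ^+ 2) * (- r p * (levi r p (T p) - r p * tangent_coef p)) +
    (a * c + b * d) * (- r p * cross_re p) +
    (a * d - b * c) * (- r p * cross_im p) +
    (c ^+ 2 + d ^+ 2) * normal_coef p.
Proof.
move=> Up.
pose B v w := - r p * hess r p v w + r p ^+ 2 * hess psi p v w +
  (1 - tau) * ('D_v r p * 'D_w r p) + 2 * tau * r p * ('D_v r p * 'D_w psi p)
  - tau * r p ^+ 2 * ('D_v psi p * 'D_w psi p).
have E v : df_form p v = B v v + B (J v) (J v).
  by rewrite /df_form /B /levi /sqgrad /dotgrad /hess; deriv_ring.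
have Bl x y v v' w : B (x *: v + y *: v') w = x * B v w + y * B v' w.
  rewrite /B (hess_lin2l _ _ _ _ _ oU rU Up) (hess_lin2l _ _ _ _ _ oU psiU Up).
  rewrite (derive_lin2 _ _ _ _ oU rU Up) (derive_lin2 _ _ _ _ oU psiU Up) /hess.
  by deriv_ring.
have Br x y v v' w : B w (x *: v + y *: v') = x * B w v + y * B w v'.
  rewrite /B (hess_lin2r _ _ _ _ _ oU rU Up) (hess_lin2r _ _ _ _ _ oU psiU Up).
  rewrite (derive_lin2 _ _ _ _ oU rU Up) (derive_lin2 _ _ _ _ oU psiU Up) /hess.
  by deriv_ring.
rewrite E (hermitian_expansion Bl Br) /B.
rewrite /tangent_coef /cross_re /cross_im /normal_coef /mixed_re /mixed_im /levi /sqgrad.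
move: (derive_normal Up) (derive_Jnormal Up) (derive_tangent Up) (derive_Jtangent Up).
move: (T p) (N p) (grad2 r p) => t n g.
move: (derive r p) (derive psi p) (hess r p) (hess psi p) => dr dp hr hp.
by move=> -> -> -> ->; ring.
Qed.

(** With [cross_im_bdry]: where psi is stationary along T, the cross terms on the
boundary depend on r alone, in particular not on the size of psi. *)
Lemma cross_re_bdry p : r p = 0 -> 'D_(T p) psi p = 0 -> cross_re p = mixed_re r r p.
Proof.
rewrite /cross_re.
move: (mixed_re r r p) (mixed_re r psi p) (T p) (N p) (derive psi p) (grad2 r p) (r p).
by move=> x y t n d g s -> ->; ring.
Qed.

Lemma cross_im_bdry p : r p = 0 -> 'D_(J (T p)) psi p = 0 ->
  cross_im p = mixed_im r r p.
Proof.
rewrite /cross_im.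
move: (mixed_im r r p) (mixed_im r psi p) (T p) (N p) (derive psi p) (grad2 r p) (r p).
by move=> x y t n d g s -> ->; ring.
Qed.

End Weight.
End Frame.

(** * Positivity near the boundary *)

Section Boundary.
Variable R : realType.
Local Notation V := 'rV[R]_4.
Variables (U : set V) (r : V -> R).
Hypotheses (oU : open U) (rU : smooth_on U r).
Local Notation T := (tangent_field r).
Local Notation N := (normal_field r).
Implicit Types (p q v : V).

Definition tangent_levi (r : V -> R) p : R := levi r p (tangent_field r p).
Definition bdry (U : set V) (r : V -> R) : set V := [set q | U q /\ r q = 0].
Definition inside (U : set V) (r : V -> R) : set V := [set p | U p /\ r p < 0].
Local Notation lambda := (tangent_levi r).

Lemma smooth_tangent_levi : smooth_on U lambda.
Proof. exact: (smooth_field_levi oU rU (smooth_tangent oU rU)). Qed.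

Hypothesis grad_bdry : forall q, bdry U r q -> 0 < grad2 r q.
Hypothesis pseudoconvex : forall q, bdry U r q -> 0 <= lambda q.

Lemma near_le_add (f : V -> R) q : {for q, continuous f} ->
  forall e : R, 0 < e -> \forall p \near q, f q - e < f p < f q + e.
Proof.
move=> fc e e0; have /cvgrPdist_lt/(_ _ e0) H := fc.
near=> p; have : `|f q - f p| < e by near: p.
by rewrite ltr_distlC.
Unshelve. all: by end_near. Qed.

Lemma near_gt0 (f : V -> R) q : {for q, continuous f} -> 0 < f q ->
  \forall p \near q, 0 < f p.
Proof.
move=> fc f0; have H := near_le_add fc f0.
near=> p; have : f q - f q < f p < f q + f q by near: p.
by rewrite subrr => /andP[].
Unshelve. all: by end_near. Qed.

(** Go from an inner point along a fixed vector v transversal to the boundary.  For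
m large, lam - m * r decreases along this segment; at the boundary point where
it ends it is nonnegative, so lam >= m * r at the starting point. *)
Lemma boundary_lower_bound (lam : V -> R) q0 : smooth_on U lam ->
  (forall q, bdry U r q -> 0 <= lam q) -> bdry U r q0 ->
  exists l : R, \forall p \near q0, inside U r p -> l * - r p <= lam p.
Proof.
move=> lamU lam_ge0 bq0; have [Uq0 rq0] := bq0; set v := N q0.
have g0 := grad_bdry bq0; set g := grad2 r q0 in g0.
have Drq0 : 'D_v r q0 = g := derive_normal oU rU Uq0.
have c1 := smooth_continuous (smooth_derive v rU) Uq0.
have c2 := smooth_continuous (smooth_derive v lamU) Uq0.
(* Near q0 the derivative of lam along v is less than M, and that of r is
   greater than c. *)
pose M := `|'D_v lam q0| + 1; pose c := g / 2.
have c0 : 0 < c by rewrite divr_gt0.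
have M0 : 0 < M by rewrite ltr_wpDl.
have near1 : \forall p \near q0, [/\ U p, c < 'D_v r p & 'D_v lam p < M].
  have nU : nbhs q0 U by exact: open_nbhs_nbhs.
  have H1 := near_le_add c1 c0; have H2 := near_le_add c2 ltr01.
  near=> p; split; first by near: p.
    have : 'D_v r q0 - c < 'D_v r p < 'D_v r q0 + c by near: p.
    by move=> /andP[+ _]; rewrite Drq0; have -> : g - c = c by rewrite /c; field.
  have : 'D_v lam q0 - 1 < 'D_v lam p < 'D_v lam q0 + 1 by near: p.
  by move=> /andP[_ H]; apply: (lt_le_trans H); rewrite lerD2r ler_norm.
have [e /= e0 eP] := (nbhs_ballP _ _).1 near1.
have eP' p : `|p - q0| < e -> [/\ U p, c < 'D_v r p & 'D_v lam p < M].
  by move=> pe; apply: eP; rewrite -ball_normE /= distrC.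
exists (- M / c).
have v1 : 0 < `|v| + 1 by rewrite ltr_wpDl.
have d0 : 0 < c * (e / 2) / (`|v| + 1).
  by apply: divr_gt0 => //; apply: mulr_gt0 => //; apply: divr_gt0.
have near2 := near_le_add (smooth_continuous rU Uq0) d0.
have near3 : \forall p \near q0, `|p - q0| < e / 2.
  apply/(nbhs_ballP _ _); exists (e / 2) => /=; first by rewrite divr_gt0.
  by move=> p; rewrite -ball_normE /= distrC.
near=> p => -[Up rp0].
have pe : `|p - q0| < e / 2 by near: p.
have rp : r q0 - c * (e / 2) / (`|v| + 1) < r p < r q0 + c * (e / 2) / (`|v| + 1).
  by near: p.
(* r grows at least with slope c, so it reaches 0 before the time t1. *)
pose t1 := - r p / c.
have t10 : 0 < t1 by rewrite divr_gt0// oppr_gt0.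
have t1v : t1 * `|v| <= e / 2.
  have H : t1 * (`|v| + 1) < e / 2.
    rewrite -ltr_pdivlMr// /t1 ltr_pdivrMr//.
    move: rp => /andP[+ _]; rewrite rq0 sub0r ltrNl => /lt_le_trans; apply.
    by rewrite le_eqVlt; apply/orP; left; apply/eqP; field; rewrite gt_eqF.
  by apply: le_trans (ltW H); rewrite ler_pM2l// lerDl.
have line t : 0 <= t <= t1 -> `|p + t *: v - q0| < e.
  move=> /andP[t0 tt1]; rewrite addrAC (le_lt_trans (ler_normD _ _))//.
  rewrite (splitr e) ltr_leD// normrZ (ger0_norm t0).
  by apply: le_trans t1v; rewrite ler_wpM2r.
pose f t := r (p + t *: v).
have fd t : 0 <= t <= t1 -> is_derive t (1 : R) f ('D_v r (p + t *: v)).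
  move=> /line/eP'[Ut _ _]; apply: is_derive_line.
  exact: smooth_derivable rU Ut.
have f1 : 0 <= f t1.
  pose h t := f t - c * t; pose dh t := 'D_v r (p + t *: v) - c.
  have : h 0 <= h t1.
    apply: (@derive_ge0_le R h dh t1 t10) => t.
      move=> /fd d; have d2 : is_derive t (1 : R) (fun t => c * t) c.
        have := is_deriveZ c (is_derive_id t (1 : R)).
        by rewrite /GRing.scale/= mulr1.
      exact: (is_deriveB d d2).
    move=> /andP[t0 tt1]; have tt : 0 <= t <= t1 by rewrite !ltW.
    by rewrite /dh subr_ge0 ltW//; have [] := eP' _ (line _ tt).
  have ct1 : c * t1 = - r p by rewrite /t1 mulrCA mulfV ?gt_eqF// mulr1.
  rewrite /h ct1 mulr0 subr0 {1}/f scale0r addr0; move: (f t1) => y; lra.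
have fc : {within `[0, t1], continuous f}.
  apply: continuous_in_subspaceT => t; rewrite inE/= in_itv/= => tt1.
  by apply/differentiable_continuous/derivable1_diffP; have [] := fd t tt1.
have f0 : f 0 = r p by rewrite /f scale0r addr0.
have [|t tt1 ft] := @IVT R f 0 t1 0 (ltW t10) fc.
  by rewrite f0 minElt maxElt (lt_le_trans rp0 f1)/= f1 ltW.
have t0 : 0 < t.
  move: tt1; rewrite in_itv/= le_eqVlt => /andP[/predU1P[t0|//] _].
  by move: rp0 ft; rewrite -t0 -f0 => + f00; rewrite f00 ltxx.
rewrite in_itv/= in tt1; have /andP[_ tle] := tt1.
have [Uq _ _] := eP' _ (line _ tt1).
have lq : 0 <= lam (p + t *: v) by apply: lam_ge0.
pose G s := - (lam (p + s *: v) - M / c * r (p + s *: v)).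
pose dG s := - ('D_v lam (p + s *: v) - M / c * 'D_v r (p + s *: v)).
have : G 0 <= G t.
  apply: (@derive_ge0_le R G dG t t0) => s.
    move=> /andP[s0 st]; have st1 : 0 <= s <= t1 by rewrite s0 (le_trans st).
    have [Us _ _] := eP' _ (line _ st1).
    have d1 : is_derive s (1 : R) (fun s => lam (p + s *: v)) ('D_v lam (p + s *: v)).
      by apply: is_derive_line; exact: smooth_derivable lamU Us.
    exact: (is_deriveN (is_deriveB d1 (is_deriveZ (M / c) (fd s st1)))).
  move=> /andP[s0 st]; have st1 : 0 <= s <= t1 by rewrite !ltW// (lt_le_trans st).
  have [_ H1 H2] := eP' _ (line _ st1).
  rewrite /dG oppr_ge0 subr_le0 (le_trans (ltW H2))//.
  by rewrite mulrAC ler_pdivlMr// ler_pM2l// ltW.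
have rq : r (p + t *: v) = 0 by exact: ft.
rewrite /G scale0r addr0 lerN2 rq mulr0 subr0 => H.
have := le_trans lq H; rewrite subr_ge0.
by rewrite !mulNr mulrN opprK.
Unshelve. all: by end_near. Qed.

Lemma levi_lower_bound q0 : bdry U r q0 ->
  exists l : R, \forall p \near q0, inside U r p -> l * - r p <= lambda p.
Proof. exact: boundary_lower_bound smooth_tangent_levi pseudoconvex. Qed.

Lemma smooth_mixed_re : smooth_on U (mixed_re r r).
Proof.
have sT := smooth_tangent oU rU; have sN := smooth_normal rU.
have sJT := smooth_field_J oU sT; have sJN := smooth_field_J oU sN.
exact: (smoothD oU (smoothD oU (smoothD oU
  (smooth_field_hess oU rU sT sN) (smooth_field_hess oU rU sN sT))
  (smooth_field_hess oU rU sJT sJN)) (smooth_field_hess oU rU sJN sJT)).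
Qed.

Lemma smooth_mixed_im : smooth_on U (mixed_im r r).
Proof.
have sT := smooth_tangent oU rU; have sN := smooth_normal rU.
have sJT := smooth_field_J oU sT; have sJN := smooth_field_J oU sN.
exact: (smoothB oU (smoothB oU (smoothD oU
  (smooth_field_hess oU rU sT sJN) (smooth_field_hess oU rU sJN sT))
  (smooth_field_hess oU rU sJT sN)) (smooth_field_hess oU rU sN sJT)).
Qed.

Section Weight.
Variables (psi : V -> R) (tau : R).
Hypotheses (psiU : smooth_on U psi) (tau1 : tau < 1).

Let sT := smooth_tangent oU rU.
Let sN := smooth_normal rU.
Let sJT := smooth_field_J oU sT.
Let sJN := smooth_field_J oU sN.

Let dT := smooth_field_derive oU psiU sT.
Let dJT := smooth_field_derive oU psiU sJT.
Let dN := smooth_field_derive oU psiU sN.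
Let dJN := smooth_field_derive oU psiU sJN.
Let gU := smooth_grad2 oU rU.
Let M f g (fU : smooth_on U f) (gU : smooth_on U g) := smoothM oU fU gU.
Let D f g (fU : smooth_on U f) (gU : smooth_on U g) := smoothD oU fU gU.
Let B f g (fU : smooth_on U f) (gU : smooth_on U g) := smoothB oU fU gU.
Let C (c : R) := @smooth_cst R V R U c oU.

Lemma smooth_tangent_coef : smooth_on U (tangent_coef r psi tau).
Proof.
exact: (B (smooth_field_levi oU psiU sT) (M (C tau) (D (M dT dT) (M dJT dJT)))).
Qed.

Lemma smooth_normal_coef : smooth_on U (normal_coef r psi tau).
Proof.
exact: (B (D (D (D (M (smoothN oU rU) (smooth_field_levi oU rU sN))
                   (M (M rU rU) (smooth_field_levi oU psiU sN)))
                (M (C (1 - tau)) (M gU gU)))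
             (M (M (C (2 * tau)) rU) (M gU dN)))
          (M (M (C tau) (M rU rU)) (D (M dN dN) (M dJN dJN)))).
Qed.

Let X f (fU : smooth_on U f) :=
  D (D (D (smooth_field_hess oU fU sT sN) (smooth_field_hess oU fU sN sT))
       (smooth_field_hess oU fU sJT sJN)) (smooth_field_hess oU fU sJN sJT).
Let Y f (fU : smooth_on U f) :=
  B (B (D (smooth_field_hess oU fU sT sJN) (smooth_field_hess oU fU sJN sT))
       (smooth_field_hess oU fU sJT sN)) (smooth_field_hess oU fU sN sJT).

Lemma smooth_cross_re : smooth_on U (cross_re r psi tau).
Proof.
exact: (D (B (B (X rU) (M rU (X psiU))) (M (M (C (2 * tau)) gU) dT))
          (M (M (C (2 * tau)) rU) (D (M dT dN) (M dJT dJN)))).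
Qed.

Lemma smooth_cross_im : smooth_on U (cross_im r psi tau).
Proof.
exact: (D (D (B (Y rU) (M rU (Y psiU))) (M (M (C (2 * tau)) gU) dJT))
          (M (M (C (2 * tau)) rU) (B (M dT dJN) (M dJT dN)))).
Qed.

(** Once lambda is bounded below by l * - r, the discriminant inequality for the
coefficients in [df_form_expansion] can be divided by r ^ 2.  What remains
compares functions that are continuous up to the boundary and is strict at q0, so
it persists near q0. *)
Lemma df_form_near q0 (l : R) : bdry U r q0 ->
  (\forall p \near q0, inside U r p -> l * - r p <= lambda p) ->
  0 < l + tangent_coef r psi tau q0 ->
  cross_re r psi tau q0 ^+ 2 + cross_im r psi tau q0 ^+ 2 <
    4 * (l + tangent_coef r psi tau q0) * ((1 - tau) * grad2 r q0 ^+ 2) ->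
  \forall p \near q0, inside U r p -> forall v, 0 <= df_form r psi tau p v.
Proof.
move=> bq0 lamP k0 strict; have [Uq0 rq0] := bq0.
have nq0 : normal_coef r psi tau q0 = (1 - tau) * grad2 r q0 ^+ 2.
  by rewrite /normal_coef rq0 !(expr0n, mulr0, mul0r, oppr0, add0r, addr0, subr0).
have g0 := grad_bdry bq0.
have n0 : 0 < normal_coef r psi tau q0.
  by rewrite nq0 mulr_gt0 ?subr_gt0// exprn_gt0.
pose gap p := 4 * (l + tangent_coef r psi tau p) * normal_coef r psi tau p -
  (cross_re r psi tau p ^+ 2 + cross_im r psi tau p ^+ 2).
have gap0 : 0 < gap q0 by rewrite /gap subr_gt0 nq0.
have gapU : smooth_on U gap.
  exact: (B (M (M (C 4) (D (C l) smooth_tangent_coef)) smooth_normal_coef)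
            (D (M smooth_cross_re smooth_cross_re) (M smooth_cross_im smooth_cross_im))).
have kU : smooth_on U (fun p => l + tangent_coef r psi tau p).
  exact: (D (C l) smooth_tangent_coef).
have cont_gt0 (f : V -> R) (fU : smooth_on U f) := near_gt0 (smooth_continuous fU Uq0).
have H1 := cont_gt0 _ gapU gap0; have H2 := cont_gt0 _ kU k0.
have H3 := cont_gt0 _ smooth_normal_coef n0; have H4 := cont_gt0 _ gU g0.
near=> p => -[Up rp] v.
have gapp : 0 < gap p by near: p.
have kp : 0 < l + tangent_coef r psi tau p by near: p.
have np : 0 < normal_coef r psi tau p by near: p.
have gp : 0 < grad2 r p by near: p.
have lp : l * - r p <= lambda p by apply: (near lamP p).
have [a [b [c [d ->]]]] := frame_decomposition v gp.
rewrite (df_form_expansion oU rU tau psiU)//.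
move: gapp kp np lp; rewrite /gap /tangent_levi subr_gt0.
move: (levi r p (T p)) (tangent_coef r psi tau p) (normal_coef r psi tau p).
move: (cross_re r psi tau p) (cross_im r psi tau p) => x y la k n gapp kp np lp.
have s0 : 0 < - r p by rewrite oppr_gt0.
move: (- r p) (opprK (r p)) s0 lp => s <- s0 lp.
have al : s * (s * (l + k)) <= s * (la - - s * k).
  by rewrite ler_pM2l// mulrDr mulNr opprK lerD2r mulrC.
have al0 : 0 <= s * (s * (l + k)) by rewrite !mulr_ge0// ltW.
apply: hermitian_ge0 => //; first exact: le_trans al.
rewrite !exprMn -mulrDr; apply: (@le_trans _ _ (s ^+ 2 * (4 * (l + k) * n))).
  by rewrite ler_wpM2l ?sqr_ge0// ltW.
have -> : s ^+ 2 * (4 * (l + k) * n) = 4 * (s * (s * (l + k))) * n by ring.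
by rewrite ler_pM2r// ler_pM2l.
Unshelve. all: by end_near. Qed.

End Weight.
End Boundary.

Section Global.
Variable R : realType.
Local Notation V := 'rV[R]_4.
Variables (U : set V) (r : V -> R).
Hypotheses (oU : open U) (rU : smooth_on U r).
Local Notation T := (tangent_field r).
Local Notation lambda := (tangent_levi r).
Hypothesis grad_bdry : forall q, bdry U r q -> 0 < grad2 r q.
Hypothesis pseudoconvex : forall q, bdry U r q -> 0 <= lambda q.
Hypothesis compact_bdry : compact (bdry U r).
Implicit Types (p q v : V).

Definition flat_points (U : set V) (r : V -> R) : set V :=
  [set q | bdry U r q /\ tangent_levi r q = 0].

Variables (phi : V -> R) (tau : R).
Hypotheses (phiU : smooth_on U phi) (tau1 : tau < 1).
Hypothesis dphi0 : forall q, flat_points U r q ->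
  'D_(T q) phi q = 0 /\ 'D_(J (T q)) phi q = 0.
Hypothesis levi_phi : forall q, flat_points U r q -> 0 < levi phi q (T q).

Let psi K p := K * phi p.

Let psiU K : smooth_on U (psi K).
Proof. exact: smoothZ. Qed.

Lemma derive_scalar (K : R) p v : U p -> 'D_v (psi K) p = K * 'D_v phi p.
Proof.
by move=> Up; have [_] := is_deriveZ K (derivableP (smooth_derivable (v := v) phiU Up)).
Qed.

Lemma hess_scalar (K : R) p v w : U p -> hess (psi K) p v w = K * hess phi p v w.
Proof.
move=> Up; rewrite /hess (@eq_derive_on _ _ _ U _ (fun q => K * 'D_w phi q))//.
  have d := smooth_derivable (v := v) (smooth_derive w phiU) Up.
  by have [_] := is_deriveZ K (derivableP d).
by move=> q; rewrite inE => Uq; exact: derive_scalar.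
Qed.

Let X := mixed_re r r.
Let Y := mixed_im r r.

Let tangent_coef_flat K q : flat_points U r q ->
  tangent_coef r (psi K) tau q = K * levi phi q (T q).
Proof.
move=> Sq; have [[Uq _] _] := Sq; have [d1 d2] := dphi0 Sq.
rewrite /tangent_coef /levi /sqgrad.
rewrite (hess_scalar _ (T q) (T q) Uq) (hess_scalar _ (J (T q)) (J (T q)) Uq).
rewrite (derive_scalar _ (T q) Uq) (derive_scalar _ (J (T q)) Uq).
by move: (derive phi q) (hess phi q) d1 d2 => d h -> ->; ring.
Qed.

Let cross_flat K q : flat_points U r q ->
  cross_re r (psi K) tau q = X q /\ cross_im r (psi K) tau q = Y q.
Proof.
move=> Sq; have [[Uq rq] _] := Sq; have [d1 d2] := dphi0 Sq.
have e1 : 'D_(T q) (psi K) q = 0 by rewrite (derive_scalar K (T q) Uq) d1 mulr0.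
have e2 : 'D_(J (T q)) (psi K) q = 0.
  by rewrite (derive_scalar K (J (T q)) Uq) d2 mulr0.
by split; [exact: cross_re_bdry|exact: cross_im_bdry].
Qed.

(** The constants are chosen to leave room for a perturbation of the data c, a and m,
so that one K serves a whole neighborhood of a boundary point. *)
Lemma large_slope (l a c m : R) : 0 <= a -> 0 < c -> 0 < m ->
  exists K0 : R, forall K c' a' m', K0 < K -> c / 2 < c' -> a' < a + 1 ->
    m / 2 < m' -> 0 < l + K * c' /\ a' < 4 * (l + K * c') * m'.
Proof.
move=> a0 c0 m0; pose B := (a + 1) / (2 * m).
have B0 : 0 <= B by apply: divr_ge0; [exact: addr_ge0|rewrite mulr_ge0// ltW].
exists ((`|l| + 1 + B) / (c / 2)) => K c' a' m' KK cc aa mm.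
have c2 : 0 < c / 2 by rewrite divr_gt0.
have m2 : 0 < m / 2 by rewrite divr_gt0.
have K0 : 0 < K.
  by apply: le_lt_trans KK; apply: divr_ge0; [rewrite !addr_ge0|exact: ltW].
have KLT : `|l| + 1 + B < K * c'.
  apply: (@lt_trans _ _ (K * (c / 2))); first by rewrite -ltr_pdivrMr.
  by rewrite ltr_pM2l.
have lB : 1 + B < l + K * c'.
  have := ler_norm (- l); rewrite normrN; move: KLT; lra.
have p0 : 0 < l + K * c' by apply: le_lt_trans lB; rewrite addr_ge0.
split => //; apply: (lt_trans aa); apply: (@le_lt_trans _ _ (4 * B * (m / 2))).
  by rewrite le_eqVlt; apply/orP; left; apply/eqP; rewrite /B; field; rewrite gt_eqF.
apply: (@le_lt_trans _ _ (4 * (l + K * c') * (m / 2))).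
  by rewrite ler_pM2r// ler_pM2l//; lra.
by rewrite ltr_pM2l// mulr_gt0.
Qed.

(** The hypotheses of [df_form_near] at a point where the cross terms do not depend
on K; k stands for the T-coefficient contributed by the weight. *)
Definition good_at q (k : R) : Prop :=
  exists l : R, [/\ \forall p \near q, inside U r p -> l * - r p <= lambda p,
    0 < l + k &
    X q ^+ 2 + Y q ^+ 2 < 4 * (l + k) * ((1 - tau) * grad2 r q ^+ 2)].

Let lambda_cont q : U q -> {for q, continuous lambda}.
Proof. exact: smooth_continuous (smooth_tangent_levi oU rU). Qed.

(** Near a Levi-flat point the bound l and the cross terms stay bounded while the
Levi form of K * phi grows with K; near the other boundary points there is
nothing to prove.  The boundary is compact, so that one K serves all points. *)
Lemma large_weight : exists K : R, forall q, flat_points U r q ->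
  good_at q (K * levi phi q (T q)).
Proof.
have : \forall K \near +oo, bdry U r `<=`
    [set q | flat_points U r q -> good_at q (K * levi phi q (T q))].
  apply: ((compact_near_coveringP (bdry U r)).1 compact_bdry R (pinfty_nbhs R)
    (fun K q => flat_points U r q -> good_at q (K * levi phi q (T q)))).
  move=> q0 bq0; have [Uq0 rq0] := bq0.
  have [l0|l0] := ltP 0 (lambda q0).
    have H := near_gt0 (lambda_cont Uq0) l0.
    exists ([set q | 0 < lambda q], setT); first by split; [exact: H|exact: filterT].
    by move=> [q K] [/= lq _] [_ lq0]; move: lq; rewrite lq0 ltxx.
  have Sq0 : flat_points U r q0.
    by split => //; apply/eqP; rewrite eq_le l0 pseudoconvex.
  have [l lP] := levi_lower_bound oU rU grad_bdry pseudoconvex bq0.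
  have H1 := near_join lP.
  pose LT q := levi phi q (T q); pose A q := X q ^+ 2 + Y q ^+ 2.
  pose m q := (1 - tau) * grad2 r q ^+ 2.
  have c0 : 0 < LT q0 by exact: levi_phi.
  have m0 : 0 < m q0 by rewrite /m mulr_gt0 ?subr_gt0// exprn_gt0// grad_bdry.
  have LTU : smooth_on U LT := smooth_field_levi oU phiU (smooth_tangent oU rU).
  have XU : smooth_on U X := smooth_mixed_re oU rU.
  have YU : smooth_on U Y := smooth_mixed_im oU rU.
  have AU : smooth_on U A := smoothD oU (smoothM oU XU XU) (smoothM oU YU YU).
  have gU := smooth_grad2 oU rU.
  have mU : smooth_on U m := smoothZ (1 - tau) oU (smoothM oU gU gU).
  have c2 : 0 < LT q0 / 2 by rewrite divr_gt0.
  have m2 : 0 < m q0 / 2 by rewrite divr_gt0.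
  have N1 := near_le_add (smooth_continuous LTU Uq0) c2.
  have N2 := near_le_add (smooth_continuous AU Uq0) ltr01.
  have N3 := near_le_add (smooth_continuous mU Uq0) m2.
  have A0 : 0 <= A q0 by apply: addr_ge0; exact: sqr_ge0.
  have [K0 K0P] := large_slope l A0 c0 m0.
  exists ([set q | [/\ \forall p \near q, inside U r p -> l * - r p <= lambda p,
      LT q0 / 2 < LT q, A q < A q0 + 1 & m q0 / 2 < m q]], [set K | K0 < K]).
    split; last by exists K0; split => //; exact: num_real.
    near=> q; split => /=.
    - by near: q.
    - have : LT q0 - LT q0 / 2 < LT q < LT q0 + LT q0 / 2 by near: q.
      by move: (LT q0) (LT q) => x y /andP[H _]; lra.
    - have : A q0 - 1 < A q < A q0 + 1 by near: q.
      by move=> /andP[].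
    - have : m q0 - m q0 / 2 < m q < m q0 + m q0 / 2 by near: q.
      by move: (m q0) (m q) => x y /andP[H _]; lra.
  move=> [q K] [/= [lq LTq Aq mq] KK0] _; exists l.
  by have [] := K0P K _ _ _ KK0 LTq Aq mq.
move=> KP; have [K KK] := filter_ex KP.
by exists K => q Sq; apply: KK => //; have [] := Sq.
Unshelve. all: by end_near. Qed.

(** At a strictly pseudoconvex point the bound l of [df_form_near] may be any
number: lambda is positive there while r vanishes. *)
Lemma df_form_near_bdry : exists K : R, forall q, bdry U r q ->
  \forall p \near q, inside U r p -> forall v, 0 <= df_form r (psi K) tau p v.
Proof.
have [K KP] := large_weight; exists K => q bq; have [Uq rq] := bq.
have [l0|l0] := ltP 0 (lambda q); last first.
  have Sq : flat_points U r q.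
    by split => //; apply/eqP; rewrite eq_le l0 pseudoconvex.
  have [l [l1 l2 l3]] := KP q Sq; have [x1 y1] := cross_flat K Sq.
  apply: (df_form_near oU rU grad_bdry (psiU K) tau1 bq l1).
    by rewrite tangent_coef_flat.
  by rewrite tangent_coef_flat// x1 y1.
pose k := tangent_coef r (psi K) tau q.
pose A := cross_re r (psi K) tau q ^+ 2 + cross_im r (psi K) tau q ^+ 2.
pose m := (1 - tau) * grad2 r q ^+ 2.
have m0 : 0 < m by rewrite /m mulr_gt0 ?subr_gt0// exprn_gt0// grad_bdry.
have A0 : 0 <= A by apply: addr_ge0; exact: sqr_ge0.
(* The bound l is free here, so it is chosen to satisfy the discriminant
   inequality. *)
pose l := 1 + (A + 1) / (4 * m) - k.
have [lk0 lkA] : 0 < l + k /\ A < 4 * (l + k) * m.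
  have -> : l + k = 1 + (A + 1) / (4 * m) by rewrite /l; ring.
  move: (A) (m) A0 m0 => x y x0 y0.
  have B0 : 0 <= (x + 1) / (4 * y) by apply: divr_ge0; [exact: addr_ge0|rewrite mulr_ge0// ltW].
  split; first by rewrite ltr_wpDr.
  have -> : 4 * (1 + (x + 1) / (4 * y)) * y = 4 * y + (x + 1) by field; rewrite gt_eqF.
  lra.
apply: (@df_form_near _ U r oU rU grad_bdry (psi K) tau (psiU K) tau1 q l bq).
- pose f p := lambda p - l * - r p.
  have fU : smooth_on U f.
    exact: (smoothB oU (smooth_tangent_levi oU rU) (smoothZ l oU (smoothN oU rU))).
  have f0 : 0 < f q by rewrite /f rq oppr0 mulr0 subr0.
  have H := near_gt0 (smooth_continuous fU Uq) f0.
  near=> p => _; rewrite -subr_ge0; apply: ltW.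
  by have : 0 < f p by near: p.
- exact: lk0.
- exact: lkA.
Unshelve. all: by end_near. Qed.

(** By compactness it suffices to treat points near a given point q of the closure.
Near a boundary point the form is nonnegative; near an inner point no point
satisfies - c < rho1 as soon as c is small. *)
Lemma df_form_shell : compact (inside U r `|` bdry U r) -> exists K c : R, 0 < c /\
  forall p, inside U r p -> - c < r p * expR (- (K * phi p)) ->
    forall v, 0 <= df_form r (fun q => K * phi q) tau p v.
Proof.
move=> cpt; have [K KP] := df_form_near_bdry; exists K.
pose rho1 p := r p * expR (- psi K p).
have rho1U : smooth_on U rho1 := smooth_weighted oU rU (psiU K).
have : \forall c \near (0 : R), (inside U r `|` bdry U r) `<=` [set p |
    inside U r p -> - c < rho1 p -> forall v, 0 <= df_form r (psi K) tau p v].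
  apply: ((compact_near_coveringP _).1 cpt R (nbhs (0 : R)) (fun c p =>
    inside U r p -> - c < rho1 p -> forall v, 0 <= df_form r (psi K) tau p v)).
  move=> q [iq|bq]; last first.
    exists ([set p | inside U r p -> forall v, 0 <= df_form r (psi K) tau p v], setT).
      by split; [exact: KP|exact: filterT].
    by move=> [p c] [/= H _] ip _; exact: H.
  have [Uq rq] := iq.
  have rq1 : 0 < - rho1 q by rewrite oppr_gt0 pmulr_llt0// expR_gt0.
  have e0 : 0 < - rho1 q / 2 by rewrite divr_gt0.
  have H1 := near_le_add (smooth_continuous rho1U Uq) e0.
  exists ([set p | rho1 p < rho1 q / 2], [set c | c < - rho1 q / 2]).
    split => /=; last exact: lt_nbhsl.
    near=> p => /=; have : rho1 q - - rho1 q / 2 < rho1 p < rho1 q + - rho1 q / 2 by near: p.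
    by move: (rho1 q) (rho1 p) => x y /andP[_ H]; lra.
  move=> [p c] [/= H2 H3] _ H4; exfalso.
  have {}H4 : - c < rho1 p := H4.
  have {}H2 : rho1 p < rho1 q / 2 := H2.
  have {}H3 : c < - rho1 q / 2 := H3.
  by move: (rho1 p) (rho1 q) H2 H3 H4 => x y; lra.
move=> /nbhs_ballP[e /= e0 eP]; exists (e / 2); split; first by rewrite divr_gt0.
move=> p ip H; apply: (eP (e / 2)) => //; last by left.
rewrite /ball/= sub0r normrN ger0_norm ?divr_ge0 ?ltW//.
by rewrite ltr_pdivrMr// ltr_pMr// ltr1n.
Unshelve. all: by end_near. Qed.

End Global.

(** * Flattening a potential away from the boundary *)

Section Shell.
Variable R : realType.

(** For k t = bump c - bump (c - t) the claim is k k' <= x (k' ^ 2 - k k''), that is,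
log k is a concave function of log t.  Here - k'' = q * k', with
q = (1 - 2 y) / y ^ 2 at y = c - t.  Divided by k' the claim at t = x becomes
Phi x >= 0, where Phi 0 = 0 and Phi' >= 0 because q is nonnegative and increases
with t; this uses y <= 1 / 2. *)
Lemma bump_shell_ineq (c x : R) : 0 < x -> x < c -> c <= 2^-1 ->
  (bump c - bump (c - x)) * dbump (c - x) <=
  x * (dbump (c - x) ^+ 2 + (bump c - bump (c - x)) * d2bump (c - x)).
Proof.
move=> x0 xc c2.
pose k t := bump c - bump (c - t).
pose q (y : R) := (1 - 2 * y) / y ^+ 2.
have dcst (t : R) : is_derive t (1 : R) (fun t => c - t) (-1).
  have := is_deriveB (is_derive_cst c t (1 : R)) (is_derive_id t (1 : R)).
  by rewrite sub0r.
have kd t : is_derive t (1 : R) k (dbump (c - t)).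
  have d := @is_derive1_comp R (@bump R) (fun t => c - t) t _ _ (is_derive_bump (c - t)) (dcst t).
  have := is_deriveB (is_derive_cst (bump c) t (1 : R)) d.
  by rewrite mulrN1 sub0r opprK.
have dbd t : is_derive t (1 : R) (fun t => dbump (c - t)) (- d2bump (c - t)).
  have := @is_derive1_comp R (@dbump R) (fun t => c - t) t _ _ (is_derive_dbump (c - t)) (dcst t).
  by rewrite mulrN1.
have qd t : 0 <= t <= x -> is_derive t (1 : R) (fun t => q (c - t))
    (2 * (1 - (c - t)) / (c - t) ^+ 3).
  move=> /andP[t0 tx]; have y0 : c - t != 0 by rewrite gt_eqF// subr_gt0 (le_lt_trans tx).
  have d1 : is_derive t (1 : R) (fun t => (c - t)^-1) ((c - t) ^- 2).
    have d0 := @is_deriveV R (fun t => c - t) t (-1) 1 y0 (dcst t).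
    by move: d0; rewrite /GRing.scale/= mulrNN mulr1.
  have d2 := is_deriveM d1 d1.
  have d3 := is_deriveB d2 (is_deriveZ 2 d1).
  rewrite (_ : (fun t => q (c - t)) = (fun t => (c - t)^-1 * (c - t)^-1 - 2 * (c - t)^-1)).
    apply: (is_derive_eq d3); rewrite /GRing.scale/=.
    by field; rewrite y0.
  apply/funext => s; rewrite /q; have [->|s0] := eqVneq (c - s) 0.
    by rewrite expr0n/= invr0 !mulr0 subr0.
  by field; rewrite s0.
have dq t : 0 <= t <= x -> d2bump (c - t) = dbump (c - t) * q (c - t).
  move=> /andP[t0 tx]; have y0 : 0 < c - t by rewrite subr_gt0 (le_lt_trans tx).
  by rewrite d2bumpE// dbumpE// /q; field; rewrite gt_eqF.
pose Phi t := t * dbump (c - t) + t * (k t * q (c - t)) - k t.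
pose dPhi t := k t * q (c - t) + t * (k t * (2 * (1 - (c - t)) / (c - t) ^+ 3)).
have Phi0 : 0 <= Phi x.
  have -> : 0 = Phi 0 by rewrite /Phi /k subr0 subrr !mul0r addr0 subr0.
  apply: (@derive_ge0_le R Phi dPhi x x0) => t.
    move=> tx; have d1 := is_deriveM (is_derive_id t (1 : R)) (dbd t).
    have d2 := is_deriveM (is_derive_id t (1 : R)) (is_deriveM (kd t) (qd t tx)).
    apply: (is_derive_eq (is_deriveB (is_deriveD d1 d2) (kd t))).
    by rewrite (dq t tx) /GRing.scale/= /dPhi fctE; ring.
  move=> /andP[t0 tx]; have y0 : 0 < c - t by rewrite subr_gt0 (lt_trans tx).
  have k0 : 0 <= k t by rewrite subr_ge0 bump_le// gerBl ltW.
  have y1 : c - t <= 2^-1 by apply: le_trans c2; rewrite gerBl ltW.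
  have q0 : 0 <= q (c - t) by apply: divr_ge0; [lra|rewrite exprn_ge0// ltW].
  have dq0 : 0 <= 2 * (1 - (c - t)) / (c - t) ^+ 3.
    by apply: divr_ge0; [lra|rewrite exprn_ge0// ltW].
  by apply: addr_ge0; apply: mulr_ge0 => //; [exact: ltW|exact: mulr_ge0].
have x0x : 0 <= x <= x by rewrite lexx ltW.
rewrite (dq x x0x) -/(k x).
have db0 : 0 <= dbump (c - x).
  have y0 : 0 < c - x by rewrite subr_gt0.
  by rewrite dbumpE// divr_ge0 ?bump_ge0// exprn_ge0// ltW.
rewrite -subr_ge0 (_ : _ - _ = dbump (c - x) * Phi x); first exact: mulr_ge0.
by rewrite /Phi; ring.
Qed.

Lemma smooth_powR (U : set R) (a : R) : open U -> (forall x, U x -> 0 < x) ->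
  smooth_on U (fun x : R => x `^ a).
Proof.
move=> oU U0; apply: (@smooth_coind1 R U
   (fun f => exists b d : R, f = fun x => b * x `^ d)) => //.
- by move=> c _ [b [d ->]]; exists (c * b), d; apply/funext => x; rewrite mulrA.
- move=> _ [b [d ->]]; exists (fun x => (b * d) * x `^ (d - 1)).
    by exists (b * d), (d - 1).
  move=> x /U0/(is_derive1_powR d) D; apply: (is_derive_eq (is_deriveZ b D)).
  by rewrite /GRing.scale/= mulrA.
- by exists 1, a; apply/funext => x; rewrite mul1r.
Qed.

End Shell.

Section Potential.
Variable R : realType.
Local Notation V := 'rV[R]_4.
Variables (W : set V) (rho : V -> R) (tau c : R).
Hypotheses (oW : open W) (rhoW : smooth_on W rho) (rho_lt0 : forall p, W p -> rho p < 0).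
Hypotheses (tau01 : 0 < tau < 1) (c0 : 0 < c) (c2 : c <= 2^-1).
Hypothesis shell : forall p, W p -> - c < rho p -> forall v,
  0 <= - rho p * levi rho p v + (1 - tau) * sqgrad rho p v.
Implicit Types (p v : V).

(** For c > 0 it has the same sign as rho everywhere, and it is constant where
rho <= - c. *)
Definition flattened (c : R) (rho : V -> R) p : R := bump (c + rho p) - bump c.

Let k (x : R) := bump c - bump (c + x).

Let kd (x : R) : is_derive x (1 : R) k (- dbump (c + x)).
Proof.
have d0 : is_derive x (1 : R) (fun x => c + x) 1.
  have := is_deriveD (is_derive_cst c x (1 : R)) (is_derive_id x (1 : R)).
  by rewrite add0r.
have d := @is_derive1_comp R (@bump R) (fun x => c + x) x _ _ (is_derive_bump (c + x)) d0.
have := is_deriveB (is_derive_cst (bump c) x (1 : R)) d.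
by rewrite mulr1 sub0r.
Qed.

Let kd2 (x : R) : is_derive x (1 : R) (fun x => - dbump (c + x)) (- d2bump (c + x)).
Proof.
have d0 : is_derive x (1 : R) (fun x => c + x) 1.
  have := is_deriveD (is_derive_cst c x (1 : R)) (is_derive_id x (1 : R)).
  by rewrite add0r.
have d := @is_derive1_comp R (@dbump R) (fun x => c + x) x _ _ (is_derive_dbump (c + x)) d0.
by have := is_deriveN d; rewrite mulr1.
Qed.

Let k_gt0 (x : R) : x < 0 -> 0 < k x.
Proof.
move=> x0; rewrite subr_gt0; have [cx|cx] := ltP 0 (c + x).
  by apply: bump_lt => //; rewrite gtrDl.
by rewrite bump_le0// bump_gt0.
Qed.

Let kap p := k (rho p).

Let kapW : smooth_on W kap.
Proof.
have s1 : smooth_on W (fun p => bump (c + rho p)).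
  exact: (smooth_comp oW openT (smooth_bump openT) (fun _ _ => I)
    (smoothD oW (smooth_cst c oW) rhoW)).
exact: (smoothB oW (smooth_cst (bump c) oW) s1).
Qed.

Let kap_gt0 p : W p -> 0 < kap p.
Proof. by move=> /rho_lt0; exact: k_gt0. Qed.

Let opos : open [set y : R | 0 < y] := @open_gt R 0.

Lemma smooth_potential : smooth_on W (fun p => - (- flattened c rho p) `^ tau).
Proof.
have sp : smooth_on [set y : R | 0 < y] (fun y : R => y `^ tau).
  by apply: smooth_powR => // y; exact.
have := smoothN oW (smooth_comp oW opos sp kap_gt0 kapW).
by apply: eq_smooth => // p _; rewrite /flattened opprB.
Qed.

(** Up to the positive factor tau * P, the form splits into a multiple of the form
of rho, nonnegative by the shell hypothesis, and a multiple of S: what is left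
of the gradient term is nonnegative by [bump_shell_ineq]. *)
Lemma potential_scalar (L S x kx b1 b2 P : R) : 0 <= S -> 0 <= P -> 0 < x -> 0 < kx ->
  0 <= b1 -> 0 <= b2 -> 0 <= x * L + (1 - tau) * S ->
  kx * b1 <= x * (b1 ^+ 2 + kx * b2) ->
  0 <= - (tau * (P * kx)) * (- b1 * L + - b2 * S) +
       - (tau * ((tau - 1) * P)) * ((- b1) ^+ 2 * S).
Proof.
move=> S0 P0 x0 kx0 b10 b20 H E; have /andP[t0 t1] := tau01.
have -> : - (tau * (P * kx)) * (- b1 * L + - b2 * S) +
       - (tau * ((tau - 1) * P)) * ((- b1) ^+ 2 * S) =
   tau * P * (kx * (b1 * L + b2 * S) + (1 - tau) * b1 ^+ 2 * S) by ring.
rewrite mulr_ge0 ?mulr_ge0 ?(ltW t0)// -(pmulr_rge0 _ x0).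
have -> : x * (kx * (b1 * L + b2 * S) + (1 - tau) * b1 ^+ 2 * S) =
  kx * b1 * (x * L + (1 - tau) * S) +
  S * ((1 - tau) * (x * (b1 ^+ 2 + kx * b2) - kx * b1) + tau * (x * (kx * b2))) by ring.
have t1' : 0 <= 1 - tau by rewrite subr_ge0 ltW.
have kx' := ltW kx0; have x' := ltW x0; have t0' := ltW t0.
by rewrite addr_ge0 ?mulr_ge0// addr_ge0 ?mulr_ge0// subr_ge0.
Qed.

(** Where rho <= - c the first two derivatives of the flattening vanish; elsewhere
[potential_scalar] applies with x = - rho. *)
Lemma levi_potential_ge0 p : W p -> forall v,
  0 <= levi (fun p => - (- flattened c rho p) `^ tau) p v.
Proof.
move=> Wp v.
have -> : (fun p => - (- flattened c rho p) `^ tau) = (fun p => - kap p `^ tau).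
  by apply/funext => q; rewrite /flattened opprB.
pose g (y : R) := - y `^ tau.
pose dg (y : R) := - (tau * y `^ (tau - 1)).
pose d2g (y : R) := - (tau * ((tau - 1) * y `^ (tau - 1 - 1))).
have gd (y : R) : 0 < y -> is_derive y (1 : R) g (dg y).
  by move=> y0; have := is_deriveN (is_derive1_powR tau y0).
have gd2 (y : R) : 0 < y -> is_derive y (1 : R) dg (d2g y).
  by move=> y0; have := is_deriveN (is_deriveZ tau (is_derive1_powR (tau - 1) y0)).
have k0 := kap_gt0 Wp.
have IT x : W x -> [set: R] (rho x) by [].
rewrite (@levi_comp R W [set y : R | 0 < y] g dg d2g kap p oW kapW kap_gt0 Wp gd gd2 v).
rewrite (@levi_comp R W setT k (fun x => - dbump (c + x)) (fun x => - d2bump (c + x))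
  rho p oW rhoW IT Wp (fun t _ => kd t) (fun t _ => kd2 t) v).
rewrite (@sqgrad_comp R W setT k (fun x => - dbump (c + x)) rho p rhoW IT Wp
  (fun t _ => kd t) v).
have S0 : 0 <= sqgrad rho p v by rewrite /sqgrad addr_ge0 ?sqr_ge0.
have [cp|cp] := leP (c + rho p) 0.
  by rewrite /dbump /d2bump !flat_le0// oppr0 expr2 !mul0r addr0 !mulr0 addr0.
have E : kap p `^ (tau - 1) = kap p `^ (tau - 1 - 1) * kap p.
  have := @powRD R (kap p) (tau - 1 - 1) 1.
  by rewrite subrK (powRr1 (ltW k0)) => -> //; rewrite (gt_eqF k0) implybT.
rewrite /dg /d2g E.
have r0 := rho_lt0 Wp.
have cr : - c < rho p by rewrite -subr_gt0 opprK addrC.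
have b10 : 0 <= dbump (c + rho p).
  by rewrite dbumpE// divr_ge0 ?bump_ge0// exprn_ge0// ltW.
have b20 : 0 <= d2bump (c + rho p).
  rewrite d2bumpE// divr_ge0 ?exprn_ge0 ?(ltW cp)// mulr_ge0 ?bump_ge0//.
  by move: r0 c2 => {}r0; move: (rho p) r0 => x; lra.
apply: (@potential_scalar _ _ (- rho p)) => //.
- exact: powR_ge0.
- by rewrite oppr_gt0.
- exact: shell.
have xr0 : 0 < - rho p by rewrite oppr_gt0.
have xc : - rho p < c by rewrite ltrNl.
by have := bump_shell_ineq xr0 xc c2; rewrite opprK.
Qed.

End Potential.

(** * The Levi form and the field L in real coordinates *)

Section LeviForm.
Variable R : realType.
Local Notation V := 'rV[R]_4.
Variables (U : set V) (r : V -> R).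
Hypotheses (oU : open U) (rU : smooth_on U r).
Implicit Types (p q v w : V).
Local Open Scope complex_scope.

Lemma cderive_real v p : cderive v (toC r) p = 'D_v r p +i* 0.
Proof.
rewrite /cderive; congr (_ +i* _).
by rewrite (_ : (fun q => complex.Im (toC r q)) = fun=> 0) ?derive_cst//.
Qed.

Lemma dz_real j p : dz j (toC r) p =
  ('D_(e_x R j) r p / 2) +i* (- 'D_(e_y R j) r p / 2).
Proof.
rewrite /dz !cderive_real.
have -> : (2 : R[i])^-1 = (2^-1)%:C by rewrite fmorphV/= rmorph_nat.
by move: ('D_(e_x R j) r p) ('D_(e_y R j) r p) => x y; simpc; congr (_ +i* _); ring.
Qed.

Lemma dzbar_real j p : dzbar j (toC r) p =
  ('D_(e_x R j) r p / 2) +i* ('D_(e_y R j) r p / 2).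
Proof.
rewrite /dzbar !cderive_real.
have -> : (2 : R[i])^-1 = (2^-1)%:C by rewrite fmorphV/= rmorph_nat.
by move: ('D_(e_x R j) r p) ('D_(e_y R j) r p) => x y; simpc; congr (_ +i* _); ring.
Qed.

Lemma dz_dzbar_real j k p : U p -> dz j (dzbar k (toC r)) p =
  ((hess r p (e_x R j) (e_x R k) + hess r p (e_y R j) (e_y R k)) / 4) +i*
  ((hess r p (e_x R j) (e_y R k) - hess r p (e_y R j) (e_x R k)) / 4).
Proof.
move=> Up.
have E v : cderive v (dzbar k (toC r)) p =
    (hess r p v (e_x R k) / 2) +i* (hess r p v (e_y R k) / 2).
  have D w : 'D_v (fun q => 'D_w r q / 2) p = hess r p v w / 2.
    have d := derivableP (smooth_derivable (v := v) (smooth_derive w rU) Up).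
    have [_ D] := is_deriveZ 2^-1 d.
    rewrite (_ : (fun q => 'D_w r q / 2) = 2^-1 \*: 'D_w r); last first.
      by apply/funext => q; exact: mulrC.
    by rewrite D [RHS]mulrC.
  have Fx : (fun q => complex.Re (dzbar k (toC r) q)) = (fun q => 'D_(e_x R k) r q / 2).
    by apply/funext => q; rewrite dzbar_real.
  have Fy : (fun q => complex.Im (dzbar k (toC r) q)) = (fun q => 'D_(e_y R k) r q / 2).
    by apply/funext => q; rewrite dzbar_real.
  rewrite /cderive Fx Fy; congr (_ +i* _); exact: D.
rewrite /dz (E (e_x R j)) (E (e_y R j)).
have -> : (2 : R[i])^-1 = (2^-1)%:C by rewrite fmorphV/= rmorph_nat.
move: (hess r p (e_x R j) (e_x R k)) (hess r p (e_x R j) (e_y R k)).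
move: (hess r p (e_y R j) (e_x R k)) (hess r p (e_y R j) (e_y R k)) => a b c d.
by simpc; congr (_ +i* _); field.
Qed.

Lemma sqrtC_half_norm (x0 x1 y0 y1 : R) :
  sqrtC (`|(x0 / 2) +i* (- y0 / 2)| ^+ 2 + `|(x1 / 2) +i* (- y1 / 2)| ^+ 2) =
  (Num.sqrt ((x0 ^+ 2 + x1 ^+ 2 + (y0 ^+ 2 + y1 ^+ 2)) / 4))%:C.
Proof.
set n := _ / 4; have n0 : 0 <= n.
  by apply: divr_ge0 => //; rewrite !addr_ge0 ?sqr_ge0.
rewrite -[RHS]sqrCK ?lecR ?sqrtr_ge0//; congr sqrtC.
rewrite !normc_def -!rmorphXn/= -rmorphD/=; congr (_%:C).
rewrite !sqr_sqrtr//; [by rewrite /n; field| |]; by rewrite addr_ge0 ?sqr_ge0.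
Qed.

(** L is the tangent field up to the normalizing factor k. *)
Lemma Lcoef_real p : exists2 k : R, (0 < grad2 r p -> k ^+ 2 = (grad2 r p)^-1) &
  Lcoef r p 0 = (k * 'D_(e_x R 1) r p) +i* (- (k * 'D_(e_y R 1) r p)) /\
  Lcoef r p 1 = (- (k * 'D_(e_x R 0) r p)) +i* (k * 'D_(e_y R 0) r p).
Proof.
pose s := Num.sqrt (grad2 r p / 4); exists (2 * s)^-1.
  move=> g0; rewrite exprVn exprMn sqr_sqrtr ?divr_ge0 ?ltW//.
  by congr (_^-1); field.
rewrite /Lcoef (dz_real 0) (dz_real 1) sqrtC_half_norm -/(grad2 r p) -/s -fmorphV/= invfM.
move: ('D_(e_x R 0) r p) ('D_(e_x R 1) r p) ('D_(e_y R 0) r p) ('D_(e_y R 1) r p).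
move: s^-1 => t x0 x1 y0 y1.
by split; simpc; congr (_ +i* _); ring.
Qed.

Lemma sum_ord2 (A : nmodType) (F : 'I_2 -> A) : \sum_(j < 2) F j = F 0 + F 1.
Proof. by rewrite big_ord_recl big_ord1; congr (_ + F _); exact: val_inj. Qed.

Lemma bilinear_vec (h : V -> V -> R) (u0 u1 w0 w1 : V) a0 a1 b0 b1 c0 c1 d0 d1 :
  (forall a c v v' w, h (a *: v + c *: v') w = a * h v w + c * h v' w) ->
  (forall a c v v' w, h w (a *: v + c *: v') = a * h w v + c * h w v') ->
  h (a0 *: u0 + a1 *: u1 + (b0 *: w0 + b1 *: w1))
    (c0 *: u0 + c1 *: u1 + (d0 *: w0 + d1 *: w1)) =
  a0 * (c0 * h u0 u0 + c1 * h u0 u1 + (d0 * h u0 w0 + d1 * h u0 w1)) +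
  a1 * (c0 * h u1 u0 + c1 * h u1 u1 + (d0 * h u1 w0 + d1 * h u1 w1)) +
  (b0 * (c0 * h w0 u0 + c1 * h w0 u1 + (d0 * h w0 w0 + d1 * h w0 w1)) +
   b1 * (c0 * h w1 u0 + c1 * h w1 u1 + (d0 * h w1 w0 + d1 * h w1 w1))).
Proof.
move=> Bl Br.
have Bl1 v v' w : h (v + v') w = h v w + h v' w.
  by have := Bl 1 1 v v' w; rewrite !scale1r !mul1r.
have Br1 v v' w : h w (v + v') = h w v + h w v'.
  by have := Br 1 1 v v' w; rewrite !scale1r !mul1r.
have Br4 v : h v (c0 *: u0 + c1 *: u1 + (d0 *: w0 + d1 *: w1)) =
    c0 * h v u0 + c1 * h v u1 + (d0 * h v w0 + d1 * h v w1).
  by rewrite Br1 !Br.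
by rewrite Bl1 !Bl !Br4.
Qed.

Lemma hess_vec p a0 a1 b0 b1 c0 c1 d0 d1 : U p ->
  let h := hess r p in
  let u0 := e_x R 0 in let u1 := e_x R 1 in let w0 := e_y R 0 in let w1 := e_y R 1 in
  h (vec a0 a1 b0 b1) (vec c0 c1 d0 d1) =
  a0 * (c0 * h u0 u0 + c1 * h u0 u1 + (d0 * h u0 w0 + d1 * h u0 w1)) +
  a1 * (c0 * h u1 u0 + c1 * h u1 u1 + (d0 * h u1 w0 + d1 * h u1 w1)) +
  (b0 * (c0 * h w0 u0 + c1 * h w0 u1 + (d0 * h w0 w0 + d1 * h w0 w1)) +
   b1 * (c0 * h w1 u0 + c1 * h w1 u1 + (d0 * h w1 w0 + d1 * h w1 w1))).
Proof.
move=> Up; apply: bilinear_vec => *.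
  exact: (hess_lin2l _ _ _ _ _ oU rU Up).
exact: (hess_lin2r _ _ _ _ _ oU rU Up).
Qed.

(** L is the tangent field divided by its length, whose square is grad2 r p; the 4
comes from [levi] being four times the complex Hessian. *)
Lemma levi_form_Re p : U p -> 0 < grad2 r p ->
  complex.Re (levi_form r p) = tangent_levi r p / (4 * grad2 r p).
Proof.
move=> Up g0; have [k /(_ g0) kE [L0 L1]] := Lcoef_real p.
pose F j i := dz j (dzbar i (toC r)) p * Lcoef r p j * (Lcoef r p i)^*.
have -> : levi_form r p = F 0 0 + F 0 1 + (F 1 0 + F 1 1).
  by rewrite /levi_form sum_ord2; congr (_ + _); exact: sum_ord2.
have FE j i : F j i = (
  ((hess r p (e_x R j) (e_x R i) + hess r p (e_y R j) (e_y R i)) / 4) +i*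
  ((hess r p (e_x R j) (e_y R i) - hess r p (e_y R j) (e_x R i)) / 4)) *
  Lcoef r p j * (Lcoef r p i)^*.
  by rewrite /F dz_dzbar_real.
clearbody F; move: (Lcoef r p) L0 L1 FE => L L0 L1 FE.
rewrite !FE L0 L1.
rewrite invfM -kE /tangent_levi /levi /tangent_field J_vec.
rewrite (hess_vec _ _ _ _ _ _ _ _ Up) (hess_vec _ _ _ _ _ _ _ _ Up).
move: (hess r p) (derive r p) => h d.
move: (e_x R 0) (e_x R 1) (e_y R 0) (e_y R 1) => u0 u1 w0 w1.
by simpc; rewrite /=; field.
Qed.

End LeviForm.

(** * A weight adapted to the Levi-flat points *)

Section Weight.
Variable R : realType.
Local Notation V := 'rV[R]_4.
Variables (U : set V) (r : V -> R).
Hypotheses (oU : open U) (rU : smooth_on U r).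
Implicit Types (p q v w : V).

Lemma ReL_tangent p : exists k : R, ReL r p = k *: tangent_field r p.
Proof.
have [k _ [L0 L1]] := Lcoef_real r p; exists (k / 2).
have iE : 'i = 'i%C :> R[i] by [].
have Lx j : Lvec r p 0 (xi j) = Lcoef r p j * 2^-1.
  rewrite /Lvec summxE (bigD1 j)//= big1 ?addr0 => [|i ij].
    by rewrite !mxE !xy_eq ?eqxx/= ?mulr1n ?mulr0n; ring.
  by rewrite !mxE !xy_eq ?(negbTE ij) ?[j == i]eq_sym ?(negbTE ij) /= ?mulr0n; ring.
have Ly j : Lvec r p 0 (yi j) = Lcoef r p j * (2^-1 * - 'i%C).
  rewrite /Lvec summxE (bigD1 j)//= big1 ?addr0 => [|i ij].
    by rewrite !mxE !xy_eq ?eqxx/= ?mulr1n ?mulr0n iE; ring.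
  by rewrite !mxE !xy_eq ?(negbTE ij) ?[j == i]eq_sym ?(negbTE ij) /= ?mulr0n; ring.
have half : (2 : R[i])^-1 = (2^-1)%:C%C by rewrite fmorphV/= rmorph_nat.
apply: rV4_ext => j; rewrite /ReL mxE ?Lx ?Ly half [RHS]mxE.
  by have [->|->] := ord2P j; rewrite ?L0 ?L1 vec_coord;
    move: (derive r p) => d; simpc; rewrite /=; field.
by have [->|->] := ord2P j; rewrite ?L0 ?L1 vec_coord;
  move: (derive r p) => d; simpc; rewrite /=; field.
Qed.

(** Re L is proportional to the tangent field, so if the latter were a multiple of
the velocity g, then g and Re L would be dependent. *)
Lemma transversal_tangent (g : V) p : free [:: g; ReL r p; ImL r p] ->
  g != 0 /\ forall c : R, tangent_field r p <> c *: g.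
Proof.
move=> fr; split; first by apply: (free_not0 fr); rewrite inE eqxx.
move=> c Tg; have [k RT] := ReL_tangent p.
have : free [:: ReL r p; g; ImL r p].
  rewrite (@perm_free _ _ _ [:: g; ReL r p; ImL r p])//.
  by rewrite (perm_catCA [:: ReL r p] [:: g] [:: ImL r p]).
rewrite free_cons RT Tg => /andP[/negP + _]; apply.
by rewrite scalerA memvZ// memv_span// inE eqxx.
Qed.

Lemma levi_cst p v : levi (fun _ : V => 0 : R) p v = 0.
Proof.
have z w : 'D_w (fun _ : V => 0 : R) = (fun _ : V => 0 : R).
  by apply/funext => q; exact: derive_cst.
have z0 w : 'D_w (fun _ : V => 0 : R) p = 0 by exact: derive_cst.
by rewrite /levi /hess !z; apply: etrans (addr0 0); congr (_ + _); exact: z0.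
Qed.

Lemma levi_sum (I : Type) (s : seq I) (F : I -> V -> R) p v :
  U p -> (forall i, smooth_on U (F i)) ->
  levi (fun x => \sum_(i <- s) F i x) p v = \sum_(i <- s) levi (F i) p v.
Proof.
move=> Up FU; elim: s => [|i s IH].
  rewrite big_nil; under [fun x => _]eq_fun do rewrite big_nil.
  exact: levi_cst.
rewrite big_cons -IH; under [fun x => _]eq_fun do rewrite big_cons.
exact: (levi_add v oU (FU i) (smooth_sum s oU FU) Up).
Qed.

Lemma derive_sum_fun (I : Type) (s : seq I) (F : I -> V -> R) p v :
  U p -> (forall i, smooth_on U (F i)) ->
  'D_v (fun x => \sum_(i <- s) F i x) p = \sum_(i <- s) 'D_v (F i) p.
Proof.
move=> Up FU; elim: s => [|i s IH].
  by rewrite big_nil; under [fun x => _]eq_fun do rewrite big_nil; exact: derive_cst.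
rewrite big_cons -IH; under [fun x => _]eq_fun do rewrite big_cons.
exact: (derive_add v oU (FU i) (smooth_sum s oU FU) Up).
Qed.

Lemma open_positive (f : V -> R) : smooth_on U f -> open [set p | U p /\ 0 < f p].
Proof.
move=> fU; rewrite openE => p [Up fp].
have nU : nbhs p U by exact: open_nbhs_nbhs.
have H := near_gt0 (smooth_continuous fU Up) fp.
by rewrite /interior; near=> q; split; near: q.
Unshelve. all: by end_near. Qed.

Hypothesis compact_bdry : compact (bdry U r).
Local Notation S := (flat_points U r).
Hypothesis local_equation : forall q, S q -> exists h : V -> R,
  [/\ smooth_on setT h, forall p, S p -> h p = 0 & 'D_(tangent_field r q) h q != 0].

(** A sum of squares h ^ 2 of local equations vanishes to second order where all the
h do, and its Levi form there is twice the sum of the squared gradients of the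
h, one of which is nonzero along T.  Finitely many h are enough by compactness
of the boundary. *)
Lemma flat_weight : exists phi : V -> R, [/\ smooth_on U phi,
  forall q, S q -> 'D_(tangent_field r q) phi q = 0 /\
                   'D_(J (tangent_field r q)) phi q = 0 &
  forall q, S q -> 0 < levi phi q (tangent_field r q)].
Proof.
pose T := tangent_field r.
have loc q : exists hf : (V -> R) * (V -> R), bdry U r q ->
    [/\ smooth_on setT hf.1, forall p, S p -> hf.1 p = 0, smooth_on U hf.2,
        0 < hf.2 q & forall p, S p -> 0 < hf.2 p -> 0 < sqgrad hf.1 p (T p)].
  have [bq|nbq] := pselect (bdry U r q); last by exists (fun=> 0, fun=> 0).
  (* Each boundary point q gets a function to be squared and a neighborhood: near
     a Levi-flat point a local equation, elsewhere 0 on a neighborhood that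
     contains no Levi-flat point. *)
  have [lq|lq] := eqVneq (tangent_levi r q) 0.
    have [h [hT hS hq]] := local_equation (conj bq lq).
    have hU : smooth_on U h := smooth_subset (@subsetT _ _) hT.
    exists (h, fun p => sqgrad h p (T p)) => _; split.
    - exact: hT.
    - exact: hS.
    - have d1 := smooth_field_derive oU hU (smooth_tangent oU rU).
      have d2 := smooth_field_derive oU hU (smooth_field_J oU (smooth_tangent oU rU)).
      exact: (smoothD oU (smoothM oU d1 d1) (smoothM oU d2 d2)).
    - rewrite /= /sqgrad ltr_wpDr ?sqr_ge0// lt_neqAle sqr_ge0 andbT eq_sym.
      by rewrite expf_neq0.
    - by [].
  exists (fun=> 0, fun p => tangent_levi r p * tangent_levi r p) => _; split.
  - exact: smooth_cst openT.
  - by [].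
  - exact: (smoothM oU (smooth_tangent_levi oU rU) (smooth_tangent_levi oU rU)).
  - by rewrite /= -expr2 lt_neqAle sqr_ge0 andbT eq_sym expf_neq0.
  - by move=> p [_ /= ->]; rewrite mul0r ltxx.
have [hf hfP] := choice loc.
pose O q := [set p | U p /\ 0 < (hf q).2 p].
have := compact_bdry; rewrite compact_cover => /(_ _ (bdry U r) O).
case=> [q bq|q bq|D DB Dcov].
- by apply: open_positive; have [] := hfP q bq.
- by exists q => //; split; [case: bq|have [] := hfP q bq].
pose s : seq V := finmap.enum_fset D.
have bds q : q \in s -> bdry U r q by move=> qs; have := DB q qs; rewrite inE.
have scov q : bdry U r q -> exists2 i, i \in s & 0 < (hf i).2 q.
  by move=> /Dcov[i iD [_ fi]]; exists i.
pose phi p := \sum_(q <- s) (hf q).1 p * (hf q).1 p.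
pose F q : V -> R :=
  if q \in s then fun p => (hf q).1 p * (hf q).1 p else fun=> 0.
have phiE : phi = fun p => \sum_(q <- s) F q p.
  by apply/funext => p; apply: eq_big_seq => q qD; rewrite /F qD.
have FU q : smooth_on U (F q).
  rewrite /F; case: ifPn => [/bds/hfP[hT _ _ _ _]|_]; last exact: smooth_cst.
  have hU := smooth_subset (@subsetT _ U) hT.
  exact: (smoothM oU hU hU).
have DF q p v : S p -> 'D_v (F q) p = 0.
  move=> Sp; have Up : U p by case: Sp => -[].
  rewrite /F; case: ifPn => [/bds/hfP[hT hS _ _ _]|_]; last exact: derive_cst.
  have hU := smooth_subset (@subsetT _ U) hT.
  by rewrite (derive_mul v oU hU hU Up) hS// !mul0r addr0.
have LF q p v : S p -> levi (F q) p v = if q \in s then 2 * sqgrad (hf q).1 p v else 0.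
  move=> Sp; have Up : U p by case: Sp => -[].
  rewrite /F; case: ifPn => [/bds/hfP[hT hS _ _ _]|_]; last exact: levi_cst.
  have hU := smooth_subset (@subsetT _ U) hT.
  by rewrite (levi_mul v oU hU hU Up) hS// !mul0r addr0 add0r /dotgrad /sqgrad -!expr2.
exists phi; rewrite phiE; split.
- exact: smooth_sum.
- move=> q Sq; have Uq : U q by case: Sq => -[].
  by split; rewrite (derive_sum_fun _ _ Uq FU) big1// => i _; exact: DF.
move=> q Sq; have Uq : U q by case: Sq => -[].
rewrite (levi_sum _ _ Uq FU).
have [i iD fi] := scov q Sq.1.
have [_ _ _ _ pos] := hfP i (bds i iD).
rewrite (big_rem i)//= ltr_pwDl//.
  by rewrite LF// iD mulr_gt0// pos.
apply: sumr_ge0 => j _; rewrite LF//; case: ifP => // _.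
by rewrite mulr_ge0// addr_ge0 ?sqr_ge0.
Qed.

End Weight.

(** * The Diederich-Fornaess index *)

Section Main.
Variable R : realType.
Local Notation V := 'rV[R]_4.

Lemma compact_bounded_closure (A : set V) : bounded_set A -> compact (closure A).
Proof.
move=> [M [_ AM]]; apply: bounded_closed_compact; last exact: closed_closure.
have AB : A `<=` [set x : V | `|x| <= M + 1].
  by move=> x Ax; apply: AM => //; rewrite ltrDl.
have cB : closed [set x : V | `|x| <= M + 1].
  by apply: (closed_comp (fun x _ => @norm_continuous _ V x) (@closed_le R (M + 1))).
exists (M + 1); split; first exact: num_real.
move=> N MN x /(closure_subset AB); rewrite -(closure_id _).1// => /= xM.
exact: le_trans xM (ltW MN).
Qed.

Lemma closure_inside (Omega U : set V) (rho : V -> R) :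
  open Omega -> Omega = inside U rho -> frontier Omega = bdry U rho ->
  closure Omega = inside U rho `|` bdry U rho.
Proof.
move=> oO OE bdE; rewrite -OE -bdE /frontier ((interior_id _).1 oO) setDUK//; exact: subset_closure.
Qed.

Lemma complex_ge0E (x : R[i]) : (0 <= x) = (0 <= complex.Re x) && (complex.Im x == 0).
Proof. by case: x => a b; rewrite lecE /= andbC eq_sym. Qed.

Section Exponent.
Variables (Omega U : set V) (rho phi : V -> R) (tau K c : R).
Hypotheses (oU : open U) (rU : smooth_on U rho) (phiU : smooth_on U phi).
Hypotheses (oO : open Omega) (cU : closure Omega `<=` U).
Hypotheses (OE : Omega = inside U rho) (bdE : frontier Omega = bdry U rho).
Hypothesis grad : forall p, frontier Omega p -> exists v, 'D_v rho p != 0.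
Hypotheses (tau01 : 0 < tau < 1) (c0 : 0 < c) (c2 : c <= 2^-1).
Hypothesis shell : forall p, inside U rho p -> - c < rho p * expR (- (K * phi p)) ->
  forall v, 0 <= df_form rho (fun q => K * phi q) tau p v.

Let psi p := K * phi p.
Let rho1 p := rho p * expR (- psi p).

Let psiU : smooth_on U psi.
Proof. exact: (smoothM oU (smooth_cst K oU) phiU). Qed.

Let rho1U : smooth_on U rho1.
Proof. exact: (smooth_weighted oU rU psiU). Qed.

Let rho1_lt0 p : (rho1 p < 0) = (rho p < 0).
Proof. by rewrite /rho1 pmulr_llt0 ?expR_gt0. Qed.

Let rho1_eq0 p : (rho1 p == 0) = (rho p == 0).
Proof. by rewrite /rho1 mulf_eq0 [expR _ == 0]gt_eqF ?expR_gt0 ?orbF. Qed.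

Let flattened_lt0 p : (flattened c rho1 p < 0) = (rho p < 0).
Proof.
rewrite /flattened subr_lt0 -rho1_lt0; case: (ltrgtP (rho1 p) 0) => h.
- have [h1|h1] := leP (c + rho1 p) 0; first by rewrite bump_le0 ?bump_gt0.
  by apply: bump_lt => //; rewrite gtrDl.
- by apply/negbTE; rewrite -leNgt ltW// bump_lt// ltrDl.
- by rewrite h addr0 ltxx.
Qed.

Let flattened_eq0 p : flattened c rho1 p = 0 <-> rho p = 0.
Proof.
split => [|/eqP]; last by rewrite -rho1_eq0 /flattened => /eqP ->; rewrite addr0 subrr.
move=> fp; apply/eqP; rewrite -rho1_eq0 eq_le; apply/andP; split; last first.
  by rewrite leNgt rho1_lt0 -flattened_lt0 fp ltxx.
rewrite leNgt; apply/negP => h.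
have : bump c < bump (c + rho1 p) by rewrite bump_lt// ltrDl.
by rewrite -subr_gt0 -/(flattened c rho1 p) fp ltxx.
Qed.

(** On the boundary the derivative of the flattened function is a positive multiple
of that of rho. *)
Lemma flattened_defining : defining_function Omega (flattened c rho1).
Proof.
have tU : smooth_on U (fun p => c + rho1 p).
  exact: (smoothD oU (smooth_cst c oU) rho1U).
have oT := @openT R.
have bU : smooth_on U (fun p => bump (c + rho1 p)).
  exact: (smooth_comp oU oT (smooth_bump oT) (fun _ _ => Logic.I) tU).
exists U; split.
- exact: oU.
- exact: cU.
- exact: (smoothB oU bU (smooth_cst (bump c) oU)).
- by rewrite OE; apply/seteqP; split => p [Up rp]; split;
    rewrite //= ?flattened_lt0// -flattened_lt0.
split.
  by rewrite bdE; apply/seteqP; split => p [Up /flattened_eq0].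
move=> p bp; have [v vp] := grad bp; exists v.
have [Up rp] : bdry U rho p by rewrite -bdE.
have d1 : 'D_v rho1 p = expR (- psi p) * 'D_v rho p.
  have eU : smooth_on U (fun q => expR (- psi q)).
    exact: (smooth_comp oU oT (smooth_expR oT) (fun _ _ => Logic.I) (smoothN oU psiU)).
  by rewrite (derive_mul v oU rU eU Up) rp mul0r add0r.
have dc : 'D_v (fun q => c + rho1 q) p = 'D_v rho1 p.
  rewrite (derive_add v oU (smooth_cst c oU) rho1U Up).
  by rewrite [X in X + _](derive_cst c) add0r.
have db : 'D_v (fun q => bump (c + rho1 q)) p = dbump (c + rho1 p) * 'D_v rho1 p.
  rewrite -dc.
  exact: (@derive_comp _ U setT _ _ _ _ tU (fun _ _ => Logic.I) Up
    (fun t _ => is_derive_bump t) v).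
have df : 'D_v (flattened c rho1) p = dbump (c + rho1 p) * 'D_v rho1 p.
  rewrite -db -[RHS]addr0.
  rewrite (derive_add v oU bU (smooth_cst (- bump c) oU) Up).
  by congr (_ + _); exact: derive_cst.
rewrite df d1 /rho1 rp mul0r addr0 mulf_neq0//.
  by rewrite dbumpE// mulf_neq0 ?invr_neq0 ?expf_neq0 ?gt_eqF// bump_gt0.
by rewrite mulf_neq0// gt_eqF ?expR_gt0.
Qed.

Lemma flattened_exponent : DF_exponent Omega tau.
Proof.
split=> //; exists (flattened c rho1); first exact: flattened_defining.
have OU : Omega `<=` U by move=> p /subset_closure/cU.
have rO : smooth_on Omega rho1 := smooth_subset OU rho1U.
have neg p : Omega p -> rho1 p < 0 by rewrite OE rho1_lt0 => -[].
apply: (psh_of_levi oO (smooth_potential tau oO rO neg c0)) => p Op v.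
apply: (levi_potential_ge0 oO rO neg tau01 c0 c2 _ Op) => q Oq cq w.
rewrite (weighted_form oU rU tau psiU w (OU _ Oq)).
by rewrite mulr_ge0 ?sqr_ge0// shell// -OE.
Qed.

End Exponent.

Lemma sup_unit_interval : sup [set tau : R | 0 < tau < 1] = 1.
Proof.
have -> : [set tau : R | 0 < tau < 1] = `]0, 1[%classic.
  by apply/seteqP; split => x; rewrite /= in_itv.
by rewrite sup_itv// bnd_simp.
Qed.

End Main.

Unset Implicit Arguments.

Theorem theorem2 (R : realType) (Omega : set (C2 R)) (rho : C2 R -> R)
    (I : set R) (gamma : R -> C2 R)
    (Omega_bounded : bounded_set Omega)
    (Omega_domain : is_domain Omega)
    (Omega_smooth : defining_function Omega rho)
    (Omega_pseudoconvex : levi_pseudoconvex Omega rho)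
    (Sigma_curve : real_curve I gamma (levi_flat_points Omega rho))
    (Sigma_transversal : transversal_to_L rho I gamma) :
  DF_index Omega = 1.
Proof.
have [U [oU cU rU OE0 [bdE0 grad]]] := Omega_smooth.
have OE : Omega = inside U rho by exact: OE0.
have bdE : frontier Omega = bdry U rho by exact: bdE0.
have [oO _ _] := Omega_domain.
have cE := closure_inside oO OE bdE.
have compact_cl : compact (inside U rho `|` bdry U rho).
  by rewrite -cE; exact: compact_bounded_closure.
have compact_bdry : compact (bdry U rho).
  rewrite -bdE /frontier; rewrite -cE in compact_cl.
  apply: compact_closedI compact_cl _; apply: open_closedC; exact: open_interior.
have grad_bdry q : bdry U rho q -> 0 < grad2 rho q.
  move=> bq; have [v vq] : exists v, 'D_v rho q != 0 by apply: grad; rewrite bdE.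
  exact: (grad2_gt0 oU rU bq.1 vq).
have ReE q (bq : bdry U rho q) := levi_form_Re oU rU bq.1 (grad_bdry q bq).
have pc q : bdry U rho q -> 0 <= tangent_levi rho q.
  move=> bq; have : 0 <= levi_form rho q by apply: Omega_pseudoconvex; rewrite bdE.
  rewrite complex_ge0E ReE// => /andP[+ _].
  by rewrite pmulr_lge0// invr_gt0 mulr_gt0// grad_bdry.
have flatE : levi_flat_points Omega rho = flat_points U rho.
  rewrite /levi_flat_points bdE; apply/seteqP; split => q [bq].
    move=> lq; split=> //; have := ReE q bq; rewrite lq /= => /esym/eqP.
    rewrite mulf_eq0 invr_eq0 mulf_eq0 pnatr_eq0 (gt_eqF (grad_bdry q bq)) /=.
    by rewrite orbF => /eqP.
  move=> lq; split=> //; have : 0 <= levi_form rho q.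
    by apply: Omega_pseudoconvex; rewrite bdE.
  have := ReE q bq; rewrite complex_ge0E lq mul0r.
  by case: (levi_form rho q) => a b /= -> /andP[_ /eqP ->].
have local_eq q : flat_points U rho q -> exists h : C2 R -> R,
    [/\ smooth_on setT h, forall p, flat_points U rho p -> h p = 0
      & 'D_(tangent_field rho q) h q != 0].
  rewrite flatE in Sigma_curve; have [_ _ gI] := Sigma_curve.
  rewrite -[X in X q]gI => -[t It <-].
  have [g0 Tg] := transversal_tangent (Sigma_transversal t It).
  exact: (vanishing_function Sigma_curve It g0 Tg).
have [phi [phiU dphi lphi]] := flat_weight oU rU compact_bdry local_eq.
rewrite /DF_index (_ : [set tau | DF_exponent Omega tau] = [set tau : R | 0 < tau < 1]).
  exact: sup_unit_interval.
apply/seteqP; split => tau /=; first by case.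
move=> tau01; have tau1 : tau < 1 by case/andP: tau01.
have [K [c [c0 shell]]] :=
  df_form_shell oU rU grad_bdry pc compact_bdry phiU tau1 dphi lphi compact_cl.
have m0 : 0 < Num.min c 2^-1 :> R by rewrite lt_min c0 invr_gt0 ltr0n.
have m2 : Num.min c 2^-1 <= 2^-1 :> R by rewrite ge_min lexx orbT.
apply: (flattened_exponent oU rU phiU oO cU OE bdE grad tau01 m0 m2) => p ip mp.
apply: (shell p ip); apply: le_lt_trans mp.
by rewrite lerN2 ge_min lexx.
Qed.
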